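(* Let $\Gamma$ be a finitely presented group with a finite generating set $S$. If $\Gamma$ has Kazhdan's property (T), then for every unitary representation $\pi$ of $\Gamma$ on a Hilbert space $E$ such that $H^2(\Gamma,\pi)$ is reduced there exists $\varepsilon=\varepsilon(\Gamma,S,\pi)>0$ such that for every $\varepsilon$-deformation $\rho$ of $\pi$, every affine action of $\Gamma$ on $E$ with linear part $\rho$ has a fixed point. Moreover, if $\Gamma$ has property (T) and $H^2(\Gamma,\pi)$ is reduced for every unitary representation $\pi$ of $\Gamma$, then $\varepsilon$ can be chosen independently of $\pi$.
   Context: A representation of $\Gamma$ on a Banach space $E$ is a homomorphism $\gamma\mapsto\pi_\gamma$ from $\Gamma$ to the group of bounded invertible linear operators on $E$ (no uniform boundedness is assumed). A (not necessarily unitary) representation $\rho$ on the same space $E$ is an $\varepsilon$-deformation of $\pi$ if $\sup_{s\in S}\|\pi_s-\rho_s\|_{B(E)}\le\varepsilon$. An affine action with linear part $\rho$ is an action of the form $\gamma\cdot v=\rho_\gamma v+b_\gamma$ with $b_\gamma\in E$. Since $\Gamma$ is finitely presented it has an Eilenberg-MacLane simplicial complex with finite $2$-skeleton; let $X$ be its universal cover. Let $C^k(X,\pi)$ be the space of alternating functions $f$ from ordered $k$-simplices of $X$ to $E$ with $f(\gamma\sigma)=\pi_\gamma f(\sigma)$, and $d^k f(\sigma)=\sum_{i=0}^{k+1}(-1)^i f(\sigma_i)$, where $\sigma_i$ omits the $i$-th vertex. $H^k(\Gamma,\pi)=\ker d^k/\operatorname{im}d^{k-1}$. For $k\le 2$,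 $C^k(X,\pi)$ is identified, by evaluation on finitely many orbit representatives, with a finite direct sum of copies of $E$ and so is a Banach space. $H^2(\Gamma,\pi)$ is reduced if $\operatorname{im}d^1$ is closed in $C^2(X,\pi)$. *)

(* Defs.v *)
From HB Require Import structures.
From mathcomp Require Import all_boot all_order all_algebra all_fingroup.
From mathcomp Require Import sesquilinear finmap complex.
From mathcomp Require Import all_classical all_reals all_analysis.

Set Implicit Arguments.
Unset Strict Implicit.
Unset Printing Implicit Defensive.

Import Order.TTheory GRing.Theory Num.Theory.
Import numFieldNormedType.Exports.

Local Open Scope classical_set_scope.
Local Open Scope complex_scope.
Local Open Scope ring_scope.

(* Norms over [R[i]] take values in [R[i]]; [{dot E for conjC}] is the type of
   positive definite forms, linear on the left and conjugate-linear on the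
   right. *)
HB.mixin Record isHilbert (R : realType) E
    & CompleteNormedModule (R[i] : numFieldType) E := {
  hdot : {dot E for (@Num.conj (R[i] : numClosedFieldType))} ;
  hdot_norm : forall v : E, `|v| ^+ 2 = hdot v v
}.

#[short(type="hilbertType")]
HB.structure Definition Hilbert (R : realType) :=
  {E of isHilbert R E & CompleteNormedModule (R[i] : numFieldType) E}.

(* The letter [(i, b)] stands for the [i]-th generator if [b], and for its
   inverse otherwise. *)
Definition word (n : nat) := seq ('I_n * bool).

Definition letter_eval (G : groupType) n (x : 'I_n -> G) (a : 'I_n * bool) : G :=
  (if a.2 then x a.1 else (x a.1)^-1)%g.

Definition word_eval (G : groupType) n (x : 'I_n -> G) (w : word n) : G :=
  (\prod_(a <- w) letter_eval x a)%g.

(* Equality of words in the group presented by the relators [rels]. *)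
Inductive word_eq n (rels : seq (word n)) : word n -> word n -> Prop :=
| word_eq_refl w : word_eq rels w w
| word_eq_sym w w' : word_eq rels w w' -> word_eq rels w' w
| word_eq_trans w w' w'' :
    word_eq rels w w' -> word_eq rels w' w'' -> word_eq rels w w''
| word_eq_cat u u' w w' :
    word_eq rels u u' -> word_eq rels w w' -> word_eq rels (u ++ w) (u' ++ w')
| word_eq_cancel i b : word_eq rels [:: (i, b); (i, ~~ b)] [::]
| word_eq_relator r : r \in rels -> word_eq rels r [::].

Definition finitely_presented (G : groupType) : Prop :=
  exists n (x : 'I_n -> G) (rels : seq (word n)),
    (forall g, exists w, word_eval x w = g) /\
    (forall w, word_eval x w = 1%g <-> word_eq rels w [::]).

Definition generates (G : groupType) (S : {fset G}) : Prop :=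
  forall H : set G,
    (forall s, s \in S -> H s) -> H 1%g ->
    (forall g h, H g -> H h -> H (g * h^-1)%g) ->
    forall g, H g.

(* Invertibility of each [rep g] follows from [rep1] and [repM]. *)
Record representation (K : numFieldType) (G : groupType)
    (E : completeNormedModType K) := Representation {
  rep :> G -> {linear E -> E} ;
  rep_bounded : forall g, exists M : K, forall v, `|rep g v| <= M * `|v| ;
  rep1 : forall v, rep 1%g v = v ;
  repM : forall g h v, rep (g * h)%g v = rep g (rep h v)
}.

Definition unitary_rep (R : realType) (G : groupType) (E : hilbertType R)
    (pi : representation G E) : Prop :=
  forall g u v, hdot (pi g u) (pi g v) = hdot u v.

Definition op_norm (R : realType) (E F : normedModType R[i]) (T : E -> F) : R :=
  sup [set complex.Re `|T v| | v in [set v : E | `|v| <= 1]].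

Definition deformation (R : realType) (G : groupType)
    (E : completeNormedModType R[i]) (S : {fset G}) (eps : R)
    (pi rho : representation G E) : Prop :=
  forall s, s \in S -> op_norm (fun v => pi s v - rho s v) <= eps.

Definition affine_action (K : numFieldType) (G : groupType)
    (E : completeNormedModType K) (rho : representation G E)
    (A : G -> E -> E) : Prop :=
  [/\ forall v, A 1%g v = v,
      forall g h v, A (g * h)%g v = A g (A h v)
    & exists b : G -> E, forall g v, A g v = rho g v + b g].

Definition has_fixed_point (G : groupType) (E : Type) (A : G -> E -> E) : Prop :=
  exists v, forall g, A g v = v.

(* Existence of a Kazhdan pair [(Q, kappa)], for the discrete topology on [G]. *)
Definition property_T (R : realType) (G : groupType) : Prop :=
  exists (Q : {fset G}) (kappa : R), 0 < kappa /\
    forall (E : hilbertType R) (pi : representation G E), unitary_rep pi ->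
      (exists2 v : E, v != 0 &
         forall q, q \in Q -> `|pi q v - v| < kappa%:C * `|v|) ->
      exists2 v : E, v != 0 & forall g, pi g v = v.

Record simplicial_complex (V : choiceType) := SimplicialComplex {
  simplex :> {fset V} -> Prop ;
  simplex_neq0 : forall s, simplex s -> s != fset0 ;
  simplex_sub : forall s t, simplex t -> (s `<=` t)%fset -> s != fset0 ->
    simplex s ;
  simplex_vertex : forall v, simplex [fset v]%fset
}.

Section realization.
Variables (R : realType) (V : choiceType) (X : simplicial_complex V).

Definition barycentric : set (V -> R) :=
  [set x | exists2 s, X s &
     [/\ forall v, 0 <= x v, forall v, v \notin s -> x v = 0
       & \sum_(v <- s) x v = 1]].

Definition realization : Type := set_type barycentric.

HB.instance Definition _ := Choice.on realization.

Definition carried (s : {fset V}) (x : realization) : Prop :=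
  forall v, v \notin s -> val x v = 0.

(* Coherent (weak) topology: [U] is open iff its trace on every closed simplex
   is open for the Euclidean topology of that simplex. *)
Definition realization_open (U : set realization) : Prop :=
  forall s x, X s -> carried s x -> U x ->
    exists2 delta : R, 0 < delta &
      forall y, carried s y -> (forall v, `|val x v - val y v| < delta) -> U y.

Lemma realization_openT : realization_open setT.
Proof. by move=> s x _ _ _; exists 1. Qed.

Lemma realization_openI : setI_closed realization_open.
Proof.
move=> A B oA oB s x Xs sx [Ax Bx].
have [a a0 hA] := oA s x Xs sx Ax; have [b b0 hB] := oB s x Xs sx Bx.
exists (Num.min a b); first by rewrite lt_min a0.
move=> y sy xy; split; [apply: hA | apply: hB] => // v.
all: by move: (xy v); rewrite lt_min => /andP[].
Qed.

Lemma realization_open_bigU (I : Type) (f : I -> set realization) :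
  (forall i, realization_open (f i)) -> realization_open (\bigcup_i f i).
Proof.
move=> of_ s x Xs sx [i _ fx]; have [d d0 hd] := of_ i s x Xs sx fx.
by exists d => // y sy xy; exists i => //; exact: hd.
Qed.

HB.instance Definition _ := isOpenTopological.Build realization
  realization_openT realization_openI realization_open_bigU.

End realization.

Definition contractible (R : realType) (T : topologicalType) : Prop :=
  exists (p : T) (H : T * R -> T),
    [/\ {within [set: T] `*` `[0, 1], continuous H},
        forall x, H (x, 0) = x & forall x, H (x, 1) = p].

(* [p] is nondegenerate on simplices and maps the simplices at each vertex
   bijectively onto those at its image; equivalently, the induced map of
   realizations is a covering map. *)
Definition simplicial_covering (V W : choiceType) (X : simplicial_complex V)
    (Y : simplicial_complex W) (p : V -> W) : Prop :=
  [/\ forall w, exists v, p v = w,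
      forall s, X s -> Y [fset p v | v in s]%fset,
      forall s, X s -> {in s &, injective p}
    & forall v t, Y t -> p v \in t ->
        exists! s, [/\ X s, v \in s & [fset p u | u in s]%fset = t]].

(* A simplicial Eilenberg-MacLane complex [em_base] for [G] with finite
   2-skeleton, and its universal cover [em_cover]. The latter is contractible,
   and [G], as the fundamental group of [em_base], acts on it as the group of
   deck transformations, i.e. freely with the fibres of [em_proj] as orbits. *)
Record EM_cover (R : realType) (G : groupType) := EMCover {
  em_base_vertex : choiceType ;
  em_base : simplicial_complex em_base_vertex ;
  em_vertex : choiceType ;
  em_cover :> simplicial_complex em_vertex ;
  em_proj : em_vertex -> em_base_vertex ;
  em_deck : G -> em_vertex -> em_vertex ;
  em_base_finite :
    finite_set [set s : {fset em_base_vertex} | em_base s /\ (#|` s| <= 3)%N] ;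
  em_covering : simplicial_covering em_cover em_base em_proj ;
  em_contractible : contractible R (realization R em_cover) ;
  em_deck1 : forall v, em_deck 1%g v = v ;
  em_deckM : forall g h v, em_deck (g * h)%g v = em_deck g (em_deck h v) ;
  em_deck_simplex : forall g s, em_cover s ->
    em_cover [fset em_deck g v | v in s]%fset ;
  em_deck_proj : forall g v, em_proj (em_deck g v) = em_proj v ;
  em_deck_free : forall g v, em_deck g v = v -> g = 1%g ;
  em_deck_trans : forall u v, em_proj u = em_proj v -> exists g, em_deck g u = v
}.

Definition ordered_simplex (V : choiceType) (X : simplicial_complex V)
    (k : nat) : set {ffun 'I_k.+1 -> V} :=
  [set s : {ffun 'I_k.+1 -> V} | injective s /\ X [fset s i | i in 'I_k.+1]%fset].
Arguments ordered_simplex {V} X k.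

Lemma face_subproof (V : choiceType) (X : simplicial_complex V) k
    (s : ordered_simplex X k.+1) (i : 'I_k.+2) :
  [ffun j => val s (lift i j)] \in ordered_simplex X k.
Proof.
have [s_inj Xs] := set_mem (valP s); apply/mem_set; split.
  by move=> j j'; rewrite !ffunE => /s_inj /lift_inj.
apply: simplex_sub Xs _ _.
  by apply/fsubsetP => _ /imfsetP[j _ ->]; rewrite ffunE in_imfset.
by apply/fset0Pn; eexists; apply: (@in_imfset _ _ _ _ _ ord0).
Qed.

Definition face (V : choiceType) (X : simplicial_complex V) k
    (s : ordered_simplex X k.+1) (i : 'I_k.+2) : ordered_simplex X k :=
  SigSub (face_subproof s i).

Section cochains.
Variables (R : realType) (G : groupType) (X : EM_cover R G).
Variables (E : completeNormedModType R[i]) (pi : representation G E).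

Definition alternating k (f : ordered_simplex X k -> E) : Prop :=
  forall (p : 'S_k.+1) (s t : ordered_simplex X k),
    (forall i, val t i = val s (p i)) -> f t = (-1) ^+ p *: f s.

Definition equivariant k (f : ordered_simplex X k -> E) : Prop :=
  forall g (s t : ordered_simplex X k),
    (forall i, val t i = em_deck g (val s i)) -> f t = pi g (f s).

Definition cochain k : set (ordered_simplex X k -> E) :=
  [set f | alternating f /\ equivariant f].

Definition coboundary k (f : ordered_simplex X k -> E) :
    ordered_simplex X k.+1 -> E :=
  fun s => \sum_(i < k.+2) (-1) ^+ i *: f (face s i).

(* Every [k]-simplex is, up to reordering its vertices, a translate of exactly
   one of the [r j]. *)
Definition orbit_representatives k m (r : 'I_m -> ordered_simplex X k) : Prop :=
  forall s : ordered_simplex X k, exists! j, exists (g : G) (p : 'S_k.+1),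
    forall i, val s i = em_deck g (val (r j) (p i)).

(* Evaluation on orbit representatives identifies the space of 2-cochains with
   [E^m], here ['rV[E]_m] with the product topology. *)
Definition H2_reduced : Prop :=
  exists m (r : 'I_m -> ordered_simplex X 2), orbit_representatives r /\
    closed ([set \row_j coboundary f (r j) | f in @cochain 1] : set 'rV[E]_m).

End cochains.

(* Main.v *)
(* Property (T) makes every cocycle of a unitary representation pi bounded: for
   an unbounded cocycle b, the kernel exp(-c |b x - b y|^2) with c small has an
   almost invariant unit vector in its reproducing kernel Hilbert space, while
   translates k g that lie far apart are nearly orthogonal, so that an invariant
   vector must vanish. Hence H^1(G, pi) = 0, and a Hilbert direct sum of putative
   counterexamples bounds the solution of b g = y - pi g y by max_S |b|,
   uniformly in pi.

   Let now b be a cocycle of a deformation rho of pi. Transported to pi, the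
   homogeneous cochain of b on the universal cover is closed only up to
   O(eps |b|). As the image of d^1 is closed, the open mapping theorem corrects it
   to a genuine cocycle, uniformly in pi if H^2 is always reduced (direct sums
   again). The cover being simply connected, this cocycle is the difference of a
   potential, which yields a pi-cocycle close to b and hence some y of size O(|b|)
   with b - (y - rho y) = O(eps |b|) on S. For small eps the iteration of this step
   converges and solves b g = y - rho g y exactly. *)
From HB Require Import structures.
Require Import Defs.
From mathcomp Require Import all_boot all_order all_algebra all_fingroup.
From mathcomp Require Import sesquilinear finmap complex.
From mathcomp Require Import all_classical all_reals all_analysis.
From mathcomp Require Import ring lra.

Set Implicit Arguments.
Unset Strict Implicit.
Unset Printing Implicit Defensive.
Import Order.TTheory GRing.Theory Num.Theory.
Import numFieldNormedType.Exports.
Local Open Scope classical_set_scope.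
Local Open Scope complex_scope.
Local Open Scope ring_scope.

(** * Norms and geometric convergence *)

(** Closeness of rho to pi on S gives no uniform closeness on G, as the error at g grows with the
    length of a word for g. What saves the argument is that only finitely many elements of G ever
    matter: the 2-skeleton is finite modulo deck transformations, and pi is unitary, so an estimate
    on orbit representatives holds on whole orbits. This is why the cochain of b is moved from rho
    to pi, and why each estimate reads [exists C e0] with constants fixed before the Hilbert space
    and the representations. The final eps then depends on pi only through the bound [K] for the
    inverse of d^1.

    Property (T) is given by almost invariant vectors, so the vanishing of H^1 has to be derived;
    this is the Delorme half of the Delorme-Guichardet theorem. It needs new Hilbert spaces, and so
    do the direct sums: both come from one reproducing kernel construction.

    Norms over [R[i]] are complex numbers; [nrm] is their real value, on which linear arithmetic
    works. Every limit is taken along a sequence whose steps are bounded by a multiple of 2^-n. *)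

Definition nrm (R : realType) (E : normedZmodType R[i]) (v : E) : R :=
  complex.Re `|v|.

Section nrm.
Variable R : realType.
Implicit Type E : normedZmodType R[i].

Lemma rcD (a b : R) : (a + b)%:C = a%:C + b%:C.
Proof. exact: rmorphD. Qed.

Lemma rcB (a b : R) : (a - b)%:C = a%:C - b%:C.
Proof. exact: rmorphB. Qed.

Lemma rcM (a b : R) : (a * b)%:C = a%:C * b%:C.
Proof. exact: rmorphM. Qed.

Lemma ge0_Re (z : R[i]) : 0 <= z -> z = (complex.Re z)%:C.
Proof. by case: z => a b; rewrite lecE /= => /andP[/eqP-> _]. Qed.

Lemma nrmE E (v : E) : `|v| = (nrm v)%:C.
Proof. exact: ge0_Re. Qed.

Lemma nrm_ge0 E (v : E) : 0 <= nrm v.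
Proof. by have := normr_ge0 v; rewrite nrmE lecR. Qed.

Lemma nrm0 E : nrm (0 : E) = 0.
Proof. by rewrite /nrm normr0. Qed.

Lemma nrm_eq0 E (v : E) : nrm v = 0 -> v = 0.
Proof. by move=> v0; apply/normr0_eq0; rewrite nrmE v0. Qed.

Lemma nrm_gt0 E (v : E) : v != 0 -> 0 < nrm v.
Proof.
move=> v0; rewrite lt_def nrm_ge0 andbT; apply: contra v0 => /eqP /nrm_eq0 ->.
exact: eqxx.
Qed.

Lemma nrmN E (v : E) : nrm (- v) = nrm v.
Proof. by rewrite /nrm normrN. Qed.

Lemma nrmBC E (u v : E) : nrm (u - v) = nrm (v - u).
Proof. by rewrite -nrmN opprB. Qed.

Lemma nrmD E (u v : E) : nrm (u + v) <= nrm u + nrm v.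
Proof. by have := ler_normD u v; rewrite !nrmE -rmorphD lecR. Qed.

Lemma nrmB E (u v : E) : nrm (u - v) <= nrm u + nrm v.
Proof. by rewrite -(nrmN v) nrmD. Qed.

Lemma nrm_dist E (w u v : E) : nrm (u - v) <= nrm (u - w) + nrm (w - v).
Proof. by rewrite -[u - v](subrKA w) nrmD. Qed.

Lemma nrm_distl E (u v : E) : `|nrm u - nrm v| <= nrm (u - v).
Proof.
have h1 := nrmD (u - v) v; have h2 := nrmD (v - u) u.
by rewrite subrK in h1; rewrite subrK nrmBC in h2; rewrite ler_norml; lra.
Qed.

Lemma nrm_sum E (I : Type) (r : seq I) (P : pred I) (f : I -> E) :
  nrm (\sum_(i <- r | P i) f i) <= \sum_(i <- r | P i) nrm (f i).
Proof.
elim/big_ind2: _ => //; first by rewrite nrm0.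
by move=> a x b y ax yb; apply: le_trans (nrmD _ _) (lerD ax yb).
Qed.

Lemma nrmM (a b : R[i]) : nrm (a * b) = nrm a * nrm b.
Proof. by apply/(@complexI R); rewrite rmorphM -!nrmE normrM. Qed.

Lemma nrm_real (r : R) : nrm r%:C = `|r|.
Proof. by rewrite /nrm normc_def /= expr0n /= addr0 sqrtr_sqr. Qed.

Lemma nrmZ (E : normedModType R[i]) (a : R[i]) (v : E) :
  nrm (a *: v) = nrm a * nrm v.
Proof. by rewrite /nrm normrZ nrmE [in LHS]nrmE -rmorphM. Qed.

End nrm.

Section geometric.
Variable R : realType.

Lemma half_exp_lt (e : R) : 0 < e -> exists n, 2^-1 ^+ n < e.
Proof.
move=> e0; have : 2^-1 ^+ n @[n --> \oo] --> (0 : R).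
  by apply: cvg_expr; rewrite ger0_norm ?invr_ge0// invf_lt1 ?ltr1n.
move=> /cvgrPdist_lt /(_ _ e0) [N _ /(_ N (leqnn N))] /=.
by rewrite sub0r normrN ger0_norm ?exprn_ge0 ?invr_ge0// => h; exists N.
Qed.

Lemma half_exp_gt0 n : 0 < (2^-1 : R) ^+ n.
Proof. by rewrite exprn_gt0 // invr_gt0. Qed.

Lemma half_exp_anti m n : (m <= n)%N -> (2^-1 : R) ^+ n <= 2^-1 ^+ m.
Proof. by move=> mn; apply: ler_wiXn2l => //; lra. Qed.

Lemma le_half_eq0 (x C : R) : 0 <= x -> (forall n, x <= C * 2^-1 ^+ n) -> x = 0.
Proof.
move=> x0 xC; apply/eqP; rewrite eq_le x0 andbT leNgt; apply/negP => xp.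
have C0 : 0 < C by have := xC 0%N; rewrite expr0; lra.
have [n] := half_exp_lt (divr_gt0 xp C0).
by rewrite ltr_pdivlMr// mulrC ltNge xC.
Qed.

Lemma geometric_dist (E : normedZmodType R[i]) (u : nat -> E) (C : R) :
  (forall n, nrm (u n.+1 - u n) <= C * 2^-1 ^+ n) ->
  forall n m, (n <= m)%N -> nrm (u m - u n) <= 2 * C * 2^-1 ^+ n.
Proof.
move=> h n m nm.
have C0 : 0 <= C by have := h 0%N; rewrite expr0 mulr1; apply: le_trans (nrm_ge0 _).
(* The sharper bound with the subtracted term is the exact sum of the steps, and it is the one that
   survives induction on m - n. *)
suff : nrm (u m - u n) <= 2 * C * (2^-1 ^+ n - 2^-1 ^+ m).
  move=> /le_trans; apply; rewrite ler_wpM2l//; first lra.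
  by have := half_exp_gt0 m; lra.
rewrite -(subnKC nm); elim: (m - n)%N => [|k IH].
  by rewrite addn0 !subrr nrm0 mulr0.
rewrite addnS; apply: le_trans (nrm_dist (u (n + k)%N) _ _) _.
apply: le_trans (lerD (h _) IH) _; rewrite exprS; lra.
Qed.

Lemma geometric_complete (E : completeNormedModType R[i]) (u : nat -> E) (C : R) :
  (forall n, nrm (u n.+1 - u n) <= C * 2^-1 ^+ n) ->
  exists l, forall n, nrm (l - u n) <= 2 * C * 2^-1 ^+ n.
Proof.
move=> h; have C0 : 0 <= C.
  by have := h 0%N; rewrite expr0 mulr1; apply: le_trans (nrm_ge0 _).
have gd := geometric_dist h.
have : cvg (u @ \oo).
  apply/cauchy_cvgP/cauchy_exP => e e0.
  have [e1 e1E] : exists e1 : R, e = e1%:C by exists (complex.Re e); apply/ge0_Re/ltW.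
  rewrite e1E in e0 *; rewrite ltcR in e0.
  have C1 : 0 < 2 * C + 1 by lra.
  have [n nE] := half_exp_lt (divr_gt0 e0 C1).
  exists (u n); exists n => // m /= nm.
  rewrite -ball_normE /= nrmE ltcR nrmBC.
  apply: le_lt_trans (gd _ _ nm) _.
  rewrite ltr_pdivlMr// in nE; apply: le_lt_trans nE.
  by rewrite mulrC ler_wpM2l ?(ltW (half_exp_gt0 _))//; lra.
move=> /cvg_ex[l ul]; exists l => n.
apply/ler_addgt0Pr => e e0.
have e0C : 0 < e%:C by rewrite ltcR.
have [N _ hN] := iffLR (cvgrPdist_lt _ _) ul _ e0C.
have := hN (maxn N n) (leq_maxl _ _); rewrite nrmE ltcR => h1.
apply: le_trans (nrm_dist (u (maxn N n)) _ _) _.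
by have := gd n (maxn N n) (leq_maxr _ _); lra.
Qed.

(** A Cauchy filter contains a ball of radius 2^-n / 2 for every n. Two balls of a proper filter
    meet, so consecutive centres are at distance at most 2^-n, and the limit of the centres is the
    limit of the filter. *)
Lemma complete_of_geometric (E : normedModType R[i]) :
  (forall u : nat -> E, (forall n, nrm (u n.+1 - u n) <= 2^-1 ^+ n) ->
     exists l (C : R), forall n, nrm (l - u n) <= C * 2^-1 ^+ n) ->
  forall F : set_system E, ProperFilter F -> cauchy F -> cvg F.
Proof.
move=> h F FF /cauchyP cF.
have {cF} cF n : exists x : E, F (ball x ((2^-1 : R) ^+ n / 2)%:C).
  by apply: cF; rewrite ltcR divr_gt0 ?half_exp_gt0.
have [u uF] := choice cF.
have [|l [C lu]] := h u.
  move=> n; have uI : F (ball (u n) ((2^-1 : R) ^+ n / 2)%:C `&`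
      ball (u n.+1) ((2^-1 : R) ^+ n.+1 / 2)%:C).
    by apply: filterI; exact: uF.
  have [x []] := filter_ex uI; rewrite -ball_normE /= !nrmE !ltcR => h1 h2.
  apply: le_trans (nrm_dist x _ _) _; rewrite (nrmBC x).
  by have := half_exp_gt0 n; move: h1 h2; rewrite exprS; lra.
apply/cvg_ex; exists l; apply/fcvgrPdist_lt => e e0.
have [e1 e1E] : exists e1 : R, e = e1%:C by exists (complex.Re e); apply/ge0_Re/ltW.
rewrite e1E in e0 *; rewrite ltcR in e0.
have C1 : 0 < `|C| + 1 by have := normr_ge0 C; lra.
have [n nE] := half_exp_lt (divr_gt0 e0 C1).
apply: filterS (uF n) => x; rewrite -ball_normE /= !nrmE !ltcR => h1.
apply: le_lt_trans (nrm_dist (u n) _ _) _.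
rewrite ltr_pdivlMr// in nE; apply: le_lt_trans nE.
have h2 := lu n; have h3 := half_exp_gt0 n; have h4 := ler_norm C.
have h5 : C * 2^-1 ^+ n <= `|C| * 2^-1 ^+ n by rewrite ler_wpM2r// ltW.
by rewrite mulrDr mulr1 [_ * `|C|]mulrC; lra.
Qed.

Lemma normc_Re_Im (z : R[i]) : nrm z <= `|complex.Re z| + `|complex.Im z|.
Proof.
rewrite {1}(complexE z); apply: le_trans (nrmD _ _) _.
rewrite nrmM !nrm_real.
suff -> : nrm ('i%C : R[i]) = 1 by rewrite mul1r.
by rewrite /nrm normc_def /= expr0n expr1n add0r sqrtr1.
Qed.

Lemma nrm_ge_Re (z : R[i]) : `|complex.Re z| <= nrm z.
Proof. by have := normc_ge_Re z; rewrite nrmE lecR. Qed.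

Lemma nrm_ge_Im (z : R[i]) : `|complex.Im z| <= nrm z.
Proof.
rewrite /nrm normc_def /= -(sqrtr_sqr (complex.Im z)).
by rewrite ler_sqrt; have := sqr_ge0 (complex.Re z); have := sqr_ge0 (complex.Im z); lra.
Qed.

Lemma real_geometric_complete (u : nat -> R) (C : R) :
  (forall n, `|u n.+1 - u n| <= C * 2^-1 ^+ n) ->
  exists l, forall n, `|l - u n| <= 2 * C * 2^-1 ^+ n.
Proof.
move=> h; have C0 : 0 <= C.
  by have := h 0%N; rewrite expr0 mulr1; apply: le_trans (normr_ge0 _).
pose v n : R[i] := (u n)%:C.
have hv n : nrm (v n.+1 - v n) <= C * 2^-1 ^+ n.
  by rewrite /v -rmorphB nrm_real.
have gd n m : (n <= m)%N -> `|u m - u n| <= 2 * C * 2^-1 ^+ n.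
  by move=> nm; have := geometric_dist hv nm; rewrite /v -rmorphB nrm_real.
have : cvg (u @ \oo).
  apply/cauchy_cvgP/cauchy_exP => e e0.
  have C1 : 0 < 2 * C + 1 by lra.
  have [n nE] := half_exp_lt (divr_gt0 e0 C1).
  exists (u n); exists n => // m /= nm.
  rewrite -ball_normE /= distrC.
  apply: le_lt_trans (gd _ _ nm) _.
  rewrite ltr_pdivlMr// in nE; apply: le_lt_trans nE.
  by rewrite mulrC ler_wpM2l ?(ltW (half_exp_gt0 _))//; lra.
move=> /cvg_ex[l ul]; exists l => n.
apply/ler_addgt0Pr => e e0.
have [N _ hN] := iffLR (cvgrPdist_lt _ _) ul _ e0.
have h1 := hN (maxn N n) (leq_maxl _ _).
have := gd n (maxn N n) (leq_maxr _ _).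
rewrite -[l - u n](subrKA (u (maxn N n))) => h2.
apply: le_trans (ler_normD _ _) _; rewrite /= in h1; lra.
Qed.

Lemma complex_geometric_complete (u : nat -> R[i]) (C : R) :
  (forall n, nrm (u n.+1 - u n) <= C * 2^-1 ^+ n) ->
  exists l, forall n, nrm (l - u n) <= 4 * C * 2^-1 ^+ n.
Proof.
move=> h.
have [a ha] : exists l, forall n, `|l - complex.Re (u n)| <= 2 * C * 2^-1 ^+ n.
  apply: real_geometric_complete => n; apply: le_trans (h n).
  by rewrite -raddfB nrm_ge_Re.
have [b hb] : exists l, forall n, `|l - complex.Im (u n)| <= 2 * C * 2^-1 ^+ n.
  apply: real_geometric_complete => n; apply: le_trans (h n).
  by rewrite -raddfB nrm_ge_Im.
exists (a +i* b) => n; apply: le_trans (normc_Re_Im _) _.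
rewrite !raddfB /=; have := ha n; have := hb n; lra.
Qed.

End geometric.

Section geometric_limit.
Variable R : realType.
Implicit Type E : normedZmodType R[i].

(* All limits taken below are geometric, and this notion of convergence is stable
   under the operations needed without any topology on [E]. *)
Definition gcvg E (u : nat -> E) (l : E) : Prop :=
  exists D : R, forall n, nrm (l - u n) <= D * 2^-1 ^+ n.

Lemma gcvg_uniq E (u : nat -> E) l l' : gcvg u l -> gcvg u l' -> l = l'.
Proof.
move=> [D h] [D' h']; apply/subr0_eq/nrm_eq0/(@le_half_eq0 _ _ (D + D')).
  exact: nrm_ge0.
move=> n; apply: le_trans (nrm_dist (u n) _ _) _.
by rewrite mulrDl (nrmBC (u n)) lerD.
Qed.

Lemma gcvg_cst E (l : E) : gcvg (fun=> l) l.
Proof. by exists 0 => n; rewrite subrr nrm0 mul0r. Qed.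

Lemma gcvgD E (u v : nat -> E) l l' :
  gcvg u l -> gcvg v l' -> gcvg (fun n => u n + v n) (l + l').
Proof.
move=> [D h] [D' h']; exists (D + D') => n; rewrite opprD addrACA mulrDl.
exact: le_trans (nrmD _ _) (lerD (h n) (h' n)).
Qed.

Lemma gcvg_lip E E' (f : E -> E') (M : R) (u : nat -> E) l :
  (forall x y, nrm (f x - f y) <= M * nrm (x - y)) ->
  gcvg u l -> gcvg (fun n => f (u n)) (f l).
Proof.
move=> hf [D h]; exists (`|M| * D) => n; apply: le_trans (hf _ _) _.
rewrite -mulrA; apply: le_trans (_ : `|M| * nrm (l - u n) <= _).
  by rewrite ler_wpM2r ?nrm_ge0 ?ler_norm.
by rewrite ler_wpM2l.
Qed.

Lemma gcvgN E (u : nat -> E) l : gcvg u l -> gcvg (fun n => - u n) (- l).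
Proof.
by move=> [D h]; exists D => n; rewrite -opprD nrmN.
Qed.

Lemma gcvgZ (E : normedModType R[i]) (a : R[i]) (u : nat -> E) l :
  gcvg u l -> gcvg (fun n => a *: u n) (a *: l).
Proof.
by apply: (@gcvg_lip E E _ (nrm a)) => x y; rewrite -scalerBr nrmZ.
Qed.

Lemma gcvg_shift E (u : nat -> E) l N : gcvg u l -> gcvg (fun n => u (n + N)%N) l.
Proof.
move=> [D h]; exists D => n; apply: le_trans (h _) _.
have D0 : 0 <= D by have := h 0%N; rewrite expr0 mulr1; apply: le_trans (nrm_ge0 _).
by rewrite ler_wpM2l// half_exp_anti// leq_addr.
Qed.

Lemma gcvg_bound E (u : nat -> E) l (M : R) : gcvg u l ->
  (forall n, nrm (u n) <= M) -> nrm l <= M.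
Proof.
move=> [D h] hM; rewrite leNgt; apply/negP => ml.
suff : nrm l - M = 0 by lra.
apply: (@le_half_eq0 _ _ D); first lra.
move=> n; have := h n; have := hM n; have := nrm_distl l (u n).
by rewrite ler_norml => /andP[_]; lra.
Qed.

Lemma gcvg_of_cauchy (E : completeNormedModType R[i]) (u : nat -> E) (C : R) :
  (forall n, nrm (u n.+1 - u n) <= C * 2^-1 ^+ n) -> exists l, gcvg u l.
Proof.
by move=> /geometric_complete[l h]; exists l, (2 * C).
Qed.

End geometric_limit.

(** * Reproducing kernel Hilbert spaces *)

Section rkhs.
Variables (R : realType) (Om : Type) (K : Om -> Om -> R[i]).
Local Notation C := R[i].
Local Notation comb := (seq (C * Om)).
Implicit Types (F G : Om -> C) (s t u : comb).

(* The Hilbert space of the kernel [K] is built inside [Om -> C], without taking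
   a completion: its elements are the functions that are approximated by the
   combinations [kcomb t] for the (dual) norm [rnorm] defined by testing against
   such combinations with [pairing]. *)
Definition pairing F s : C := \sum_(b <- s) conjc b.1 * F b.2.
Definition kcomb t : Om -> C := fun x => \sum_(a <- t) a.1 * K a.2 x.
Definition gram t s : C := pairing (kcomb t) s.
Definition qform s : R := complex.Re (gram s s).
Definition scale_comb (c : C) s : comb := [seq (c * a.1, a.2) | a <- s].

Definition psd_kernel : Prop :=
  (forall x y, K y x = conjc (K x y)) /\ forall s, 0 <= qform s.

Lemma pairing_cat F s t : pairing F (s ++ t) = pairing F s + pairing F t.
Proof. by rewrite /pairing big_cat. Qed.

Lemma pairing_scale F c s : pairing F (scale_comb c s) = conjc c * pairing F s.
Proof.
rewrite /pairing big_map mulr_sumr; apply: eq_bigr => b _ /=.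
by rewrite rmorphM mulrA.
Qed.

Lemma pairingD F G s : pairing (F + G) s = pairing F s + pairing G s.
Proof. by rewrite /pairing -big_split; apply: eq_bigr => b _; exact: mulrDr. Qed.

Lemma pairingZ (c : C) F s : pairing (c *: F) s = c * pairing F s.
Proof.
rewrite /pairing mulr_sumr; apply: eq_bigr => b _.
by rewrite mulrCA.
Qed.

Lemma pairingB F G s : pairing (F - G) s = pairing F s - pairing G s.
Proof. by rewrite -scaleN1r pairingD pairingZ mulN1r. Qed.

Lemma kcomb_cat s t : kcomb (s ++ t) = kcomb s + kcomb t.
Proof. by apply/funext => x; rewrite /kcomb big_cat. Qed.

Lemma kcomb_scale (c : C) s : kcomb (scale_comb c s) = c *: kcomb s.
Proof.
apply/funext => x; rewrite -[RHS]/(c * _) /kcomb big_map mulr_sumr.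
by apply: eq_bigr => a _; rewrite -mulrA.
Qed.

Lemma gram_catl s t u : gram (s ++ t) u = gram s u + gram t u.
Proof. by rewrite /gram kcomb_cat pairingD. Qed.

Lemma gram_catr s t u : gram u (s ++ t) = gram u s + gram u t.
Proof. exact: pairing_cat. Qed.

Lemma gram_scalel c s u : gram (scale_comb c s) u = c * gram s u.
Proof. by rewrite /gram kcomb_scale pairingZ. Qed.

Lemma gram_scaler c s u : gram u (scale_comb c s) = conjc c * gram u s.
Proof. exact: pairing_scale. Qed.

Hypothesis psdK : psd_kernel.

Lemma gram_herm s t : gram s t = conjc (gram t s).
Proof.
rewrite /gram /pairing /kcomb rmorph_sum /=.
under eq_bigr do rewrite mulr_sumr.
rewrite exchange_big; apply: eq_bigr => a _ /=.
rewrite rmorphM /= conjcK rmorph_sum mulr_sumr; apply: eq_bigr => b _ /=.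
by rewrite rmorphM /= -psdK.1 mulrCA.
Qed.

Lemma gram_real s : gram s s = (qform s)%:C.
Proof.
have := gram_herm s s; rewrite /qform; case: (gram s s) => a b [] /eqP /= h.
by have -> : b = 0 by lra.
Qed.

Lemma nrm_sqr (z : C) : nrm z ^+ 2 = complex.Re z ^+ 2 + complex.Im z ^+ 2.
Proof. by apply/(@complexI R); rewrite rmorphXn /= -nrmE add_Re2_Im2. Qed.

Lemma qform_ge0 s : 0 <= qform s. Proof. exact: psdK.2. Qed.

Lemma gram_cauchy_schwarz t s : nrm (gram t s) ^+ 2 <= qform t * qform s.
Proof.
set m := nrm _ ^+ 2; have m0 : 0 <= m by apply: sqr_ge0.
(* This is the form of the combination t - r <t, s> s. *)
have key (r : R) : 0 <= qform t - 2 * r * m + r ^+ 2 * m * qform s.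
  have := qform_ge0 (t ++ scale_comb (- (r%:C * gram t s)) s).
  rewrite {1}/qform gram_catl !gram_catr !gram_scalel !gram_scaler.
  rewrite (gram_herm s t) !gram_real /m nrm_sqr; case: (gram t s) => a b /=.
  move=> h; apply: le_trans h _; rewrite le_eqVlt; apply/orP; left; apply/eqP; ring.
have := qform_ge0 s; rewrite le_eqVlt => /orP[/eqP s0|s0].
  rewrite -s0 mulr0 leNgt; apply/negP => mp.
  (* When [qform s] vanishes the expression is affine in r, and this r makes it equal to -1. *)
  have := key ((qform t + 1) / (2 * m)).
  rewrite -s0 mulr0 addr0 [2 * _]mulrC -mulrA divfK ?gt_eqF//; last lra.
  lra.
set i := (qform s)^-1; have iq : i * qform s = 1 by rewrite mulVf ?gt_eqF.
have := key i.
have -> : i ^+ 2 * m * qform s = i * m * (i * qform s) by ring.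
rewrite iq mulr1 => h.
have h2 : 0 <= qform s * (qform t - i * m) by apply: mulr_ge0; [exact: ltW | lra].
have h3 : m = i * qform s * m by rewrite iq mul1r.
by rewrite h3; move: h2; rewrite mulrBr; lra.
Qed.

(** F is viewed as a conjugate-linear functional on combinations, seminormed by the square root of
    [qform]; M bounds its dual norm. *)
Definition bound F (M : R) := forall s, nrm (pairing F s) <= M * Num.sqrt (qform s).

Definition approximable F := forall e, 0 < e -> exists t, bound (F - kcomb t) e.

Lemma boundD F G M M' : bound F M -> bound G M' -> bound (F + G) (M + M').
Proof.
move=> h h' s; rewrite pairingD mulrDl.
exact: le_trans (nrmD _ _) (lerD (h s) (h' s)).
Qed.

Lemma boundZ (c : C) F M : bound F M -> bound (c *: F) (nrm c * M).
Proof. by move=> h s; rewrite pairingZ nrmM -mulrA ler_wpM2l ?nrm_ge0. Qed.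

Lemma boundW F M M' : M <= M' -> bound F M -> bound F M'.
Proof. by move=> MM h s; apply: le_trans (h s) _; rewrite ler_wpM2r ?sqrtr_ge0. Qed.

Lemma bound0 : bound 0 0.
Proof.
by move=> s; rewrite mul0r /pairing big1 ?nrm0// => b _; exact: mulr0.
Qed.

Lemma bound_kcomb t : bound (kcomb t) (Num.sqrt (qform t)).
Proof.
move=> s; rewrite -[leLHS]ger0_norm ?nrm_ge0// -sqrtr_sqr -sqrtrM ?qform_ge0//.
by rewrite ler_wsqrtr// gram_cauchy_schwarz.
Qed.

Lemma approximable_bound F : approximable F -> exists2 M, 0 <= M & bound F M.
Proof.
move=> /(_ 1 ltr01)[t h]; exists (1 + Num.sqrt (qform t)).
  by rewrite addr_ge0 ?sqrtr_ge0.
by rewrite -[F](subrK (kcomb t)); apply: boundD => //; exact: bound_kcomb.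
Qed.

Definition rnorm F : R := inf [set M | 0 <= M /\ bound F M].

Section rnorm_theory.
Variable F : Om -> C.
Hypothesis bF : exists2 M, 0 <= M & bound F M.

Let hinf : has_inf [set M | 0 <= M /\ bound F M].
Proof.
by split; [have [M M0 h] := bF; exists M | exists 0 => M []].
Qed.

Lemma rnorm_ge0 : 0 <= rnorm F.
Proof. by apply: lb_le_inf; [exact: hinf.1 | move=> M []]. Qed.

Lemma rnorm_le M : 0 <= M -> bound F M -> rnorm F <= M.
Proof. by move=> M0 h; apply: ge_inf; [exact: hinf.2 | split]. Qed.

Lemma rnorm_bound : bound F (rnorm F).
Proof.
move=> s; have := qform_ge0 s; rewrite le_eqVlt => /orP[/eqP s0|s0].
  (* On a null combination any single bound already forces the pairing to vanish, and no division is
     possible. *)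
  have [M _ /(_ s)] := bF; rewrite -s0 sqrtr0 !mulr0.
  by [].
rewrite -ler_pdivrMr ?sqrtr_gt0//.
apply: lb_le_inf; first exact: hinf.1.
by move=> M [_ /(_ s)]; rewrite ler_pdivrMr ?sqrtr_gt0.
Qed.

End rnorm_theory.

(** Cauchy-Schwarz gives one inequality; testing [kcomb t] against [t] itself gives the other. *)
Lemma rnorm_kcomb t : rnorm (kcomb t) = Num.sqrt (qform t).
Proof.
have bt : exists2 M, 0 <= M & bound (kcomb t) M.
  by exists (Num.sqrt (qform t)); [exact: sqrtr_ge0|exact: bound_kcomb].
apply: le_anti; apply/andP; split.
  by apply: rnorm_le; [exact: bt | exact: sqrtr_ge0 | exact: bound_kcomb].
have /predU1P[t0|t0] : (0 == qform t) || (0 < qform t).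
    by rewrite -le_eqVlt qform_ge0.
  by rewrite -t0 sqrtr0 rnorm_ge0.
have /(_ t) := rnorm_bound bt.
rewrite -/(gram t t) gram_real nrm_real ger0_norm ?qform_ge0//.
by rewrite -{1}(sqr_sqrtr (ltW t0)) expr2 ler_pM2r ?sqrtr_gt0.
Qed.

End rkhs.

Section space.
Variables (R : realType) (Om : Type) (K : Om -> Om -> R[i]).
Local Notation C := R[i].
Local Notation comb := (seq (C * Om)).

(** Indexing the predicate and the type by [psdK] lets the instances whose proofs rest on positivity
    be found from the type alone. *)
Definition rkhs_pred (psdK : psd_kernel K) : {pred Om -> C} :=
  fun F => `[< approximable K F >].

Record rkhs (psdK : psd_kernel K) := Rkhs {
  rkhs_fun : Om -> C; rkhs_funP : rkhs_fun \in rkhs_pred psdK }.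

Variable psdK : psd_kernel K.
Local Notation V := (rkhs psdK).

HB.instance Definition _ := [isSub of V for @rkhs_fun psdK].
HB.instance Definition _ := [Choice of V by <:].

Lemma rkhs_submod_closed : GRing.subsemimod_closed (rkhs_pred psdK).
Proof.
have P0 : 0 \in rkhs_pred psdK.
  apply/asboolP => e e0; exists [::]; apply: boundW (ltW e0) _.
  have -> : kcomb K [::] = 0 by apply/funext => x; rewrite /kcomb big_nil.
  by rewrite subr0; exact: bound0.
have PD F G : F \in rkhs_pred psdK -> G \in rkhs_pred psdK -> F + G \in rkhs_pred psdK.
  move=> /asboolP hF /asboolP hG; apply/asboolP => e e0.
  have e2 : 0 < e / 2 by lra.
  have [t ht] := hF _ e2; have [s hs] := hG _ e2; exists (t ++ s).
  rewrite kcomb_cat opprD addrACA; apply: boundW (boundD ht hs); lra.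
split; first by split.
move=> a F /asboolP hF; apply/asboolP => e e0.
have a1 : 0 < nrm a + 1 by have := nrm_ge0 a; lra.
have [t ht] := hF _ (divr_gt0 e0 a1); exists (scale_comb a t).
rewrite kcomb_scale -scalerBr; apply: boundW (boundZ a ht).
by rewrite mulrCA -[leRHS]mulr1 ler_pM2l// ler_pdivrMr// mul1r; lra.
Qed.

HB.instance Definition _ := GRing.isSubmodClosed.Build _ _ (rkhs_pred psdK)
  rkhs_submod_closed.
HB.instance Definition _ := [SubChoice_isSubLmodule of V by <:].

Lemma rkhs_approximable (F : V) : approximable K (val F).
Proof. exact/asboolP/(rkhs_funP F). Qed.

Lemma rkhs_has_bound (F : V) : exists2 M, 0 <= M & bound K (val F) M.
Proof. exact: approximable_bound (rkhs_approximable F). Qed.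

Definition rkhs_norm (F : V) : C := (rnorm K (val F))%:C.

Let bnd (F : V) := rnorm_bound psdK (rkhs_has_bound F).
Let bnd0 (F : V) := rnorm_ge0 (rkhs_has_bound F).

Lemma rkhs_valD (F G : V) : val (F + G) = val F + val G. Proof. exact: raddfD. Qed.
Lemma rkhs_valB (F G : V) : val (F - G) = val F - val G. Proof. exact: raddfB. Qed.
Lemma rkhs_valZ c (F : V) : val (c *: F) = c *: val F. Proof. exact: linearZ. Qed.

Lemma rkhs_norm_le (F : V) M : 0 <= M -> bound K (val F) M -> rnorm K (val F) <= M.
Proof. by move=> M0 h; apply: rnorm_le => //; exact: rkhs_has_bound. Qed.

Lemma rkhs_normD (F G : V) : rkhs_norm (F + G) <= rkhs_norm F + rkhs_norm G.
Proof.
rewrite /rkhs_norm -rcD lecR; apply: rkhs_norm_le; first exact: addr_ge0.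
by rewrite rkhs_valD; exact: boundD.
Qed.

Lemma rkhs_normZ_le (c : C) (F : V) : rkhs_norm (c *: F) <= `|c| * rkhs_norm F.
Proof.
rewrite nrmE /rkhs_norm -rcM lecR; apply: rkhs_norm_le.
  by rewrite mulr_ge0 ?nrm_ge0.
by rewrite rkhs_valZ; exact: boundZ.
Qed.

Lemma rkhs_normZ (c : C) (F : V) : rkhs_norm (c *: F) = `|c| * rkhs_norm F.
Proof.
apply: le_anti; rewrite rkhs_normZ_le /=.
have [->|c0] := eqVneq c 0.
  by rewrite normr0 mul0r lecR bnd0.
rewrite -ler_pdivlMl ?normr_gt0// -normfV.
by apply: le_trans (rkhs_normZ_le _ _); rewrite scalerA mulVf// scale1r.
Qed.

Lemma pairing1 (F : Om -> C) x : pairing F [:: (1, x)] = F x.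
Proof. by rewrite /pairing big_seq1 conjc1 mul1r. Qed.

(** Pairing with a point mass evaluates F there, so the norm controls every value of F. *)
Lemma rkhs_norm0_eq0 (F : V) : rkhs_norm F = 0 -> F = 0.
Proof.
move=> /(@complexI R) N0; apply/val_inj/funext => x; apply: nrm_eq0.
have := bnd F [:: (1, x)]; rewrite pairing1 N0 mul0r => h.
by apply: le_anti; rewrite h nrm_ge0.
Qed.

HB.instance Definition _ := Lmodule_isNormed.Build C V
  rkhs_normD rkhs_normZ rkhs_norm0_eq0.

Lemma rkhs_nrm (F : V) : nrm F = rnorm K (val F).
Proof. by []. Qed.

Lemma kcomb_mem t : kcomb K t \in rkhs_pred psdK.
Proof.
apply/asboolP => e e0; exists t; rewrite subrr; apply: boundW (ltW e0) _.
exact: bound0.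
Qed.

Definition kvec t : V := Rkhs (kcomb_mem t).

Lemma nrm_kvec t : nrm (kvec t) ^+ 2 = qform K t.
Proof. by rewrite rkhs_nrm rnorm_kcomb// sqr_sqrtr// qform_ge0. Qed.

Lemma kvec_dense (F : V) e : 0 < e -> exists t, nrm (F - kvec t) <= e.
Proof.
move=> e0; have [t ht] := rkhs_approximable F e0; exists t; rewrite rkhs_nrm.
by apply: rnorm_le; rewrite ?(ltW e0)//; exact: rkhs_has_bound.
Qed.

(** Along a geometric sequence the pairings with each fixed combination converge as scalars. Their
    limit is the pairing with the pointwise limit [L], since a pairing is a finite sum of values; so
    the limit is again a function on [Om]. *)
Lemma rkhs_complete (F : set_system V) : ProperFilter F -> cauchy F -> cvg F.
Proof.
apply: complete_of_geometric => u hu.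
pose c s := Num.sqrt (qform K s).
have hs s n : nrm (pairing (val (u n.+1)) s - pairing (val (u n)) s) <= c s * 2^-1 ^+ n.
  rewrite -pairingB -rkhs_valB; apply: le_trans (bnd _ s) _.
  by rewrite mulrC ler_wpM2l ?sqrtr_ge0//; exact: hu.
have [l hl] := choice (fun s => complex_geometric_complete (hs s)).
pose L x := l [:: (1, x)].
have lL s : l s = pairing L s.
  apply: (@gcvg_uniq _ _ (fun n => pairing (val (u n)) s)).
    by exists (4 * c s) => n; exact: hl.
  exists (\sum_(b <- s) nrm b.1 * (4 * c [:: (1, b.2)])) => n.
  rewrite -pairingB; apply: le_trans (nrm_sum _ _ _) _.
  rewrite mulr_suml; apply: ler_sum => b _; rewrite nrmM -mulrA.
  have -> : nrm (conjc b.1) = nrm b.1 by rewrite /nrm normcJ.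
  by rewrite ler_wpM2l ?nrm_ge0//; have := hl [:: (1, b.2)] n; rewrite pairing1.
have bL n : bound K (L - val (u n)) (4 * 2^-1 ^+ n).
  by move=> s; rewrite pairingB -lL mulrAC; exact: hl.
have LV : L \in rkhs_pred psdK.
  apply/asboolP => e e0.
  have e2 : 0 < e / 2 by lra.
  (* 2^-n < e / 8 makes the distance 4 * 2^-n from L to u n smaller than e / 2. *)
  have [n nE] := half_exp_lt (divr_gt0 e0 (ltr0n R 8)).
  have [t ht] := rkhs_approximable (u n) e2; exists t.
  rewrite -(subrKA (val (u n))); apply: boundW (boundD (bL n) ht).
  by move: nE; rewrite ltr_pdivlMr//; lra.
exists (Rkhs LV), 4 => n; rewrite rkhs_nrm; apply: rnorm_le.
- exact: rkhs_has_bound.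
- by rewrite mulr_ge0// ltW// half_exp_gt0.
- by rewrite rkhs_valB; exact: bL.
Qed.

HB.instance Definition _ := Uniform_isComplete.Build V rkhs_complete.

End space.

Section dot.
Variables (R : realType) (Om : Type) (K : Om -> Om -> R[i]).
Variable psdK : psd_kernel K.
Local Notation C := R[i].
Local Notation comb := (seq (C * Om)).
Local Notation V := (rkhs psdK).
Implicit Types F G : V.

Lemma kvec_cat t s : kvec psdK (t ++ s) = kvec psdK t + kvec psdK s.
Proof. by apply/val_inj; rewrite rkhs_valD; exact: kcomb_cat. Qed.

Lemma kvec_scale c t : kvec psdK (scale_comb c t) = c *: kvec psdK t.
Proof. by apply/val_inj; rewrite rkhs_valZ; exact: kcomb_scale. Qed.

Lemma kvec_seq F : exists t : nat -> comb, gcvg (fun n => kvec psdK (t n)) F.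
Proof.
have [t ht] := choice (fun n => kvec_dense F (half_exp_gt0 R n)).
by exists t, 1 => n; rewrite mul1r.
Qed.

(** Polarization defines the form from the norm alone, hence on the whole space at once. Its
    algebraic laws are checked on combinations, where it equals [gram], and then passed to
    limits. *)
Definition rdot F G : R := (nrm (F + G) ^+ 2 - nrm (F - G) ^+ 2) / 4.
Definition rkhs_dot F G : C := rdot F G +i* rdot F ('i%C *: G).

Lemma qform_cat t s : qform K (t ++ s) = qform K t + qform K s + 2 * complex.Re (gram K t s).
Proof.
rewrite /qform gram_catl !gram_catr (gram_herm psdK s t).
by case: (gram K t s) (gram K t t) (gram K s s) => [a b] [c d] [e f] /=; ring.
Qed.

Lemma qform_scale c t : qform K (scale_comb c t) = nrm c ^+ 2 * qform K t.
Proof.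
rewrite /qform gram_scalel gram_scaler gram_real// nrm_sqr.
by case: c => a b /=; ring.
Qed.

Lemma rdot_kvec t s : rdot (kvec psdK t) (kvec psdK s) = complex.Re (gram K t s).
Proof.
rewrite /rdot.
have -> : kvec psdK t - kvec psdK s = kvec psdK (t ++ scale_comb (-1) s).
  by rewrite kvec_cat kvec_scale scaleN1r.
rewrite -kvec_cat !nrm_kvec !qform_cat qform_scale gram_scaler nrm_sqr.
by case: (gram K t s) => a b /=; field.
Qed.

Lemma rkhs_dot_kvec t s : rkhs_dot (kvec psdK t) (kvec psdK s) = gram K t s.
Proof.
rewrite /rkhs_dot -kvec_scale !rdot_kvec gram_scaler.
by case: (gram K t s) => a b /=; congr (_ +i* _); ring.
Qed.

Lemma gcvg_sqr (u : nat -> V) F : gcvg u F ->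
  exists D, forall n, `|nrm F ^+ 2 - nrm (u n) ^+ 2| <= D * 2^-1 ^+ n.
Proof.
move=> [D h]; exists (D * (2 * nrm F + D)) => n.
have D0 : 0 <= D by have := h 0%N; rewrite expr0 mulr1; apply: le_trans (nrm_ge0 _).
rewrite subr_sqr normrM mulrAC; apply: ler_pM => //.
  exact: le_trans (nrm_distl _ _) (h n).
rewrite ger0_norm ?addr_ge0 ?nrm_ge0//.
have := h n; have := half_exp_anti R (leq0n n); rewrite expr0 => h1 h2.
have h3 : D * 2^-1 ^+ n <= D by rewrite -[leRHS]mulr1 ler_wpM2l.
by have := nrm_distl F (u n); rewrite ler_norml => /andP[]; lra.
Qed.

Lemma rdot_gcvg (u v : nat -> V) F G : gcvg u F -> gcvg v G ->
  exists D, forall n, `|rdot F G - rdot (u n) (v n)| <= D * 2^-1 ^+ n.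
Proof.
move=> uF vG; have [D h] := gcvg_sqr (gcvgD uF vG).
have [D' h'] := gcvg_sqr (gcvgD uF (gcvgN vG)).
exists (D + D') => n; have := h n; have := h' n; rewrite /rdot.
rewrite !ler_norml => /andP[? ?] /andP[? ?]; apply/andP; split; lra.
Qed.

Lemma rkhs_dot_gcvg (u v : nat -> V) F G : gcvg u F -> gcvg v G ->
  gcvg (fun n => rkhs_dot (u n) (v n)) (rkhs_dot F G).
Proof.
move=> uF vG; have [D h] := rdot_gcvg uF vG.
have [D' h'] := rdot_gcvg uF (gcvgZ 'i%C vG).
exists (D + D') => n; rewrite mulrDl; apply: le_trans (normc_Re_Im _) _.
by rewrite !raddfB /= lerD.
Qed.

Lemma nrm_conjc (z : C) : nrm (conjc z) = nrm z.
Proof. by rewrite /nrm normcJ. Qed.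

Lemma gcvg_conj (u : nat -> C) l :
  gcvg u l -> gcvg (fun n => conjc (u n)) (conjc l).
Proof. by apply: (gcvg_lip (M := 1)) => x y; rewrite mul1r -rmorphB nrm_conjc. Qed.

Lemma gcvg_mull (a : C) (u : nat -> C) l :
  gcvg u l -> gcvg (fun n => a * u n) (a * l).
Proof. by apply: (gcvg_lip (M := nrm a)) => x y; rewrite -mulrBr nrmM. Qed.

Lemma rkhs_dotC F G : rkhs_dot F G = conjc (rkhs_dot G F).
Proof.
have [t ht] := kvec_seq F; have [s hs] := kvec_seq G.
have h1 := rkhs_dot_gcvg ht hs.
apply: (gcvg_uniq h1); have := gcvg_conj (rkhs_dot_gcvg hs ht).
suff -> : (fun n => conjc (rkhs_dot (kvec psdK (s n)) (kvec psdK (t n)))) =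
  (fun n => rkhs_dot (kvec psdK (t n)) (kvec psdK (s n))) by [].
by apply/funext => n; rewrite !rkhs_dot_kvec -gram_herm.
Qed.

Lemma rkhs_dot_linear a F F' G :
  rkhs_dot (a *: F + F') G = a * rkhs_dot F G + rkhs_dot F' G.
Proof.
have [t ht] := kvec_seq F; have [t' ht'] := kvec_seq F'; have [s hs] := kvec_seq G.
have h1 := rkhs_dot_gcvg (gcvgD (gcvgZ a ht) ht') hs.
apply: (gcvg_uniq h1).
have := gcvgD (gcvg_mull a (rkhs_dot_gcvg ht hs)) (rkhs_dot_gcvg ht' hs).
set f := fun n => _; set g := fun n => _; suff -> : f = g by [].
apply/funext => n; rewrite /f /g -kvec_scale -kvec_cat !rkhs_dot_kvec.
by rewrite gram_catl gram_scalel.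
Qed.

Lemma rkhs_dot_nrm F : rkhs_dot F F = (nrm F ^+ 2)%:C.
Proof.
have [t ht] := kvec_seq F; apply: (gcvg_uniq (rkhs_dot_gcvg ht ht)).
have [D hD] := gcvg_sqr ht; exists D => n.
by rewrite rkhs_dot_kvec gram_real// -nrm_kvec -rcB nrm_real.
Qed.

Lemma rkhs_dot_scalel G : GRing.scalable_for *%R (rkhs_dot ^~ G).
Proof.
move=> a F; rewrite -[a *: F]addr0 rkhs_dot_linear.
suff -> : rkhs_dot 0 G = 0 by rewrite addr0.
by have := rkhs_dot_linear 1 0 0 G; rewrite scale1r addr0 mul1r => /eqP;
  rewrite addrC -subr_eq subrr => /eqP.
Qed.

Lemma rkhs_dot_subl G : zmod_morphism (rkhs_dot ^~ G).
Proof.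
by move=> F F'; rewrite addrC -scaleN1r rkhs_dot_linear mulN1r addrC.
Qed.

Lemma rkhs_dot_subr F : zmod_morphism (rkhs_dot F).
Proof.
move=> G G'.
rewrite (rkhs_dotC F G) (rkhs_dotC F G') rkhs_dotC rkhs_dot_subl; exact: rmorphB.
Qed.

Lemma rkhs_dot_scaler F :
  GRing.scalable_for (@Num.conj (C : numClosedFieldType) \; *%R) (rkhs_dot F).
Proof.
move=> a G; rewrite (rkhs_dotC F G) rkhs_dotC rkhs_dot_scalel; exact: rmorphM.
Qed.

HB.instance Definition _ := isBilinear.Build C V V C *%R
  (@Num.conj (C : numClosedFieldType) \; *%R) rkhs_dot
  rkhs_dot_subl rkhs_dot_subr rkhs_dot_scalel rkhs_dot_scaler.

Lemma rkhs_dot_herm F G :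
  rkhs_dot F G = (-1) ^+ false * @Num.conj (C : numClosedFieldType) (rkhs_dot G F).
Proof. by rewrite expr0 mul1r rkhs_dotC. Qed.

HB.instance Definition _ := isHermitianSesquilinear.Build C V false
  (@Num.conj (C : numClosedFieldType)) rkhs_dot rkhs_dot_herm.

Lemma rkhs_dot_gt0 F : F != 0 -> 0 < rkhs_dot F F.
Proof. by move=> F0; rewrite rkhs_dot_nrm ltcR exprn_gt0 ?nrm_gt0. Qed.

HB.instance Definition _ := isDotProduct.Build C V rkhs_dot rkhs_dot_gt0.

Lemma rkhs_dot_norm F : `|F| ^+ 2 = rkhs_dot F F.
Proof. by rewrite nrmE -rmorphXn rkhs_dot_nrm. Qed.

HB.instance Definition _ := isHilbert.Build R V rkhs_dot_norm.

End dot.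

(** The interface of the construction: prescribed inner products and a dense span. The Gaussian
    model and the direct sum are both built from it. *)
Theorem rkhs_exists (R : realType) (Om : Type) (K : Om -> Om -> R[i]) :
  psd_kernel K -> exists (H : hilbertType R) (k : Om -> H),
    (forall x y, hdot (k x) (k y) = K x y) /\
    (forall v e, 0 < e -> exists t : seq (R[i] * Om),
       nrm (v - \sum_(a <- t) a.1 *: k a.2) <= e).
Proof.
move=> psdK; exists (rkhs psdK), (fun x => kvec psdK [:: (1, x)]); split.
  move=> x y; rewrite -[LHS]/(rkhs_dot _ _) rkhs_dot_kvec /gram pairing1 /kcomb.
  by rewrite big_seq1 mul1r.
move=> v e /(kvec_dense v)[t ht]; exists t.
suff <- : kvec psdK t = \sum_(a <- t) a.1 *: kvec psdK [:: (1, a.2)] by [].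
elim: t {ht} => [|[a x] t IH].
  by rewrite big_nil; apply/val_inj/funext => x; rewrite /= /kcomb big_nil.
rewrite big_cons -IH -kvec_scale -kvec_cat; congr kvec.
by rewrite /= mulr1.
Qed.

(** * Hilbert spaces and the GNS representation *)

Section hilbert_theory.
Variables (R : realType) (E : hilbertType R).
Local Notation C := R[i].
Implicit Types u v w : E.

Lemma hdotC u v : hdot u v = conjc (hdot v u).
Proof. by have := hermC hdot u v; rewrite expr0 mul1r. Qed.

Lemma hdot_nrm v : hdot v v = (nrm v ^+ 2)%:C.
Proof. by rewrite -hdot_norm nrmE -rmorphXn. Qed.

Lemma hdotDl u v w : hdot (u + v) w = hdot u w + hdot v w.
Proof. exact: linearDl. Qed.

Lemma hdotDr u v w : hdot w (u + v) = hdot w u + hdot w v.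
Proof. exact: linearDr. Qed.

Lemma hdotBr u v w : hdot w (u - v) = hdot w u - hdot w v.
Proof. exact: linearBr. Qed.

Lemma hdotZl (a : C) u v : hdot (a *: u) v = a * hdot u v.
Proof. exact: linearZl_LR. Qed.

Lemma hdotZr (a : C) u v : hdot u (a *: v) = conjc a * hdot u v.
Proof. by rewrite hdotC hdotZl rmorphM /= -hdotC. Qed.

Lemma hdot0l v : hdot 0 v = 0. Proof. exact: linear0l. Qed.

Lemma hdot0r v : hdot v 0 = 0. Proof. exact: linear0r. Qed.

Lemma hdotNr u v : hdot u (- v) = - hdot u v. Proof. exact: linearNr. Qed.

Lemma hdot_suml (I : Type) (r : seq I) (f : I -> E) v :
  hdot (\sum_(i <- r) f i) v = \sum_(i <- r) hdot (f i) v.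
Proof. by elim/big_ind2: _ => [|a x b y <- <-|//]; rewrite ?hdot0l ?hdotDl. Qed.

Lemma hdot_sumr (I : Type) (r : seq I) (f : I -> E) v :
  hdot v (\sum_(i <- r) f i) = \sum_(i <- r) hdot v (f i).
Proof. by elim/big_ind2: _ => [|a x b y <- <-|//]; rewrite ?hdot0r ?hdotDr. Qed.

Lemma sqr_nrmD u v :
  nrm (u + v) ^+ 2 = nrm u ^+ 2 + nrm v ^+ 2 + 2 * complex.Re (hdot u v).
Proof.
have -> : nrm (u + v) ^+ 2 = complex.Re (hdot (u + v) (u + v)) by rewrite hdot_nrm.
rewrite hdotDl !hdotDr (hdotC v u) !hdot_nrm.
by case: (hdot u v) => a b /=; ring.
Qed.

Lemma sqr_nrmB u v :
  nrm (u - v) ^+ 2 = nrm u ^+ 2 + nrm v ^+ 2 - 2 * complex.Re (hdot u v).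
Proof. by rewrite sqr_nrmD nrmN hdotNr raddfN /= mulrN. Qed.

Lemma parallelogram u v :
  nrm (u + v) ^+ 2 + nrm (u - v) ^+ 2 = 2 * nrm u ^+ 2 + 2 * nrm v ^+ 2.
Proof. by rewrite sqr_nrmD sqr_nrmB; ring. Qed.

(** Expand the square of the norm of |v| u - |u| v, which is nonnegative. *)
Lemma Re_hdot_le u v : complex.Re (hdot u v) <= nrm u * nrm v.
Proof.
have [->|u0] := eqVneq u 0; first by rewrite hdot0l nrm0 mul0r.
have [->|v0] := eqVneq v 0; first by rewrite hdot0r nrm0 mulr0.
have nu := nrm_gt0 u0; have nv := nrm_gt0 v0.
have := sqr_ge0 (nrm ((nrm v)%:C *: u - (nrm u)%:C *: v)).
rewrite sqr_nrmB hdotZl hdotZr !nrmZ !nrm_real !ger0_norm ?nrm_ge0//.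
have -> : complex.Re ((nrm v)%:C * (conjc (nrm u)%:C * hdot u v)) =
  nrm u * nrm v * complex.Re (hdot u v) by case: (hdot u v) => a b /=; ring.
move=> h; have : 0 <= nrm u * nrm v * (nrm u * nrm v - complex.Re (hdot u v)).
  by rewrite mulrBr -expr2; move: h; rewrite !exprMn; lra.
by rewrite pmulr_rge0 ?subr_ge0// mulr_gt0.
Qed.

Lemma nrm_hdot_le u v : nrm (hdot u v) <= nrm u * nrm v.
Proof.
set z := hdot u v; have [z0|z0] := eqVneq z 0.
  by rewrite z0 nrm0 mulr_ge0 ?nrm_ge0.
have nz := nrm_gt0 z0.
(* Multiplying u by the conjugate of z turns the inner product into the real number |z|^2. *)
have := Re_hdot_le (conjc z *: u) v; rewrite hdotZl -/z nrmZ nrm_conjc.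
have -> : complex.Re (conjc z * z) = nrm z ^+ 2.
  by rewrite nrm_sqr; case: (z) => a b /=; ring.
by rewrite expr2 -mulrA ler_pM2l.
Qed.

Lemma hdot_inj u : (forall v, hdot u v = 0) -> u = 0.
Proof.
move=> /(_ u); rewrite hdot_nrm => /(@complexI R) /eqP; rewrite sqrf_eq0.
by move=> /eqP /nrm_eq0.
Qed.

Lemma isometry_hdot (f : {linear E -> E}) :
  (forall v, nrm (f v) = nrm v) -> forall u v, hdot (f u) (f v) = hdot u v.
Proof.
move=> hf; have hRe u v : complex.Re (hdot (f u) (f v)) = complex.Re (hdot u v).
  by have := hf (u + v); have := sqr_nrmD (f u) (f v);
    rewrite linearD !hf => h1 h2; move: h1; rewrite -linearD hf sqr_nrmD; lra.
move=> u v; apply/eqP; rewrite eq_complex hRe eqxx /=.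
have := hRe u ('i%C *: v); rewrite linearZ !hdotZr.
by case: (hdot u v) (hdot (f u) (f v)) => [a b] [c d] /= h; apply/eqP; lra.
Qed.

End hilbert_theory.

(** * Extension of contractions from a dense span *)

Definition lincomb (R : realType) (Om : Type) (E : lmodType R[i]) (k : Om -> E)
  (t : seq (R[i] * Om)) : E := \sum_(a <- t) a.1 *: k a.2.

Section extension.
Variables (R : realType) (Om : Type) (H E : completeNormedModType R[i]).
Variables (k : Om -> H) (j : Om -> E).
Local Notation comb := (seq (R[i] * Om)).

Lemma lincomb_cat (F : lmodType R[i]) (f : Om -> F) s t :
  lincomb f (s ++ t) = lincomb f s + lincomb f t.
Proof. exact: big_cat. Qed.

Lemma lincomb_scale (F : lmodType R[i]) (f : Om -> F) c t :
  lincomb f (scale_comb c t) = c *: lincomb f t.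
Proof.
by rewrite /lincomb big_map scaler_sumr; apply: eq_bigr => a _; rewrite scalerA.
Qed.

Lemma lincombB (F : lmodType R[i]) (f : Om -> F) s t :
  lincomb f (s ++ scale_comb (-1) t) = lincomb f s - lincomb f t.
Proof. by rewrite lincomb_cat lincomb_scale scaleN1r. Qed.

Lemma lincomb1 (F : lmodType R[i]) (f : Om -> F) x : lincomb f [:: (1, x)] = f x.
Proof. by rewrite /lincomb big_seq1 scale1r. Qed.

Hypothesis dense_k : forall v e, 0 < e -> exists t, nrm (v - lincomb k t) <= e.

Lemma dense_seq v : exists t : nat -> comb, gcvg (fun n => lincomb k (t n)) v.
Proof.
have [t ht] := choice (fun n => dense_k v (half_exp_gt0 R n)).
by exists t, 1 => n; rewrite mul1r.
Qed.

Lemma eq_of_dense (f g : {linear H -> E}) M :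
  (forall v, nrm (f v) <= M * nrm v) -> (forall v, nrm (g v) <= M * nrm v) ->
  (forall x, f (k x) = g (k x)) -> forall v, f v = g v.
Proof.
move=> bf bg fg v; have [t ht] := dense_seq v.
have lip (h : {linear H -> E}) : (forall v, nrm (h v) <= M * nrm v) ->
    forall x y, nrm (h x - h y) <= M * nrm (x - y).
  by move=> bh x y; rewrite -linearB.
apply: (gcvg_uniq (gcvg_lip (lip f bf) ht)).
have := gcvg_lip (lip g bg) ht; congr gcvg; apply/funext => n.
by rewrite /lincomb !linear_sum; apply: eq_bigr => a _; rewrite !linearZ /= fg.
Qed.

Hypothesis contr : forall t, nrm (lincomb j t) <= nrm (lincomb k t).

(** The graph of the extension: y is a limit of images along some sequence of combinations tending
    to v. The contraction hypothesis makes it total, single-valued and contractive. *)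
Let ext_rel v y := exists2 t : nat -> comb,
  gcvg (fun n => lincomb k (t n)) v & gcvg (fun n => lincomb j (t n)) y.

Let ext_total v : exists y, ext_rel v y.
Proof.
have [t [D ht]] := dense_seq v.
have [|y hy] := @gcvg_of_cauchy R E (fun n => lincomb j (t n)) (2 * D).
  move=> n; rewrite -lincombB; apply: le_trans (contr _) _; rewrite lincombB.
  apply: le_trans (nrm_dist v _ _) _; rewrite nrmBC.
  have := ht n; have := ht n.+1; have := nrm_ge0 (v - lincomb k (t n)).
  by rewrite exprS; lra.
by exists y, t => //; exists D.
Qed.

Let ext_uniq v y y' : ext_rel v y -> ext_rel v y' -> y = y'.
Proof.
move=> [t ht hy] [s hs hy'].
have [D hD] := gcvgD ht (gcvgN hs).
have hj := gcvgD hy (gcvgN hy').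
apply/subr0_eq/(gcvg_uniq hj); exists D => n; have := hD n.
rewrite subrr !sub0r !nrmN; apply: le_trans.
by rewrite -!lincombB contr.
Qed.

Let ext_linear a v w y z : ext_rel v y -> ext_rel w z ->
  ext_rel (a *: v + w) (a *: y + z).
Proof.
move=> [t ht hy] [s hs hz]; exists (fun n => scale_comb a (t n) ++ s n).
  have := gcvgD (gcvgZ a ht) hs; congr gcvg; apply/funext => n.
  by rewrite lincomb_cat lincomb_scale.
have := gcvgD (gcvgZ a hy) hz; congr gcvg; apply/funext => n.
by rewrite lincomb_cat lincomb_scale.
Qed.

Let ext_contr v y : ext_rel v y -> nrm y <= nrm v.
Proof.
move=> [t [D ht] [D' hy]]; rewrite leNgt; apply/negP => vy.
suff : nrm y - nrm v = 0 by lra.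
apply: (@le_half_eq0 _ _ (D + D')); first lra.
move=> n; have := contr (t n); have := nrm_distl v (lincomb k (t n)).
have := nrm_distl y (lincomb j (t n)); have := ht n; have := hy n.
by rewrite !ler_norml => ? ? /andP[_ ?] /andP[? _]; lra.
Qed.

Lemma linear_extension : exists P : {linear H -> E},
  (forall x, P (k x) = j x) /\ forall v, nrm (P v) <= nrm v.
Proof.
have [P hP] := choice ext_total.
have linP : linear P.
  by move=> a v w; apply: ext_uniq (hP _) (ext_linear _ (hP _) (hP _)).
pose L := GRing.isLinear.Build _ _ _ _ P linP.
pose PL : {linear H -> E} := HB.pack P L.
exists PL; split=> [x|v]; last exact: ext_contr (hP v).
apply: ext_uniq (hP _) _; exists (fun=> [:: (1, x)]).
all: by under [fun n => _]funext do rewrite lincomb1; exact: gcvg_cst.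
Qed.

End extension.

Section gns_representation.
Variables (R : realType) (G : groupType) (Om : Type) (H : hilbertType R).
Variables (k : Om -> H) (act : G -> Om -> Om).
Hypothesis dense_k : forall v e, 0 < e -> exists t, nrm (v - lincomb k t) <= e.
Hypothesis act1 : forall x, act 1%g x = x.
Hypothesis actM : forall g h x, act (g * h)%g x = act g (act h x).
Hypothesis act_hdot :
  forall g x y, hdot (k (act g x)) (k (act g y)) = hdot (k x) (k y).

Lemma gns_representation : exists pi : representation G H,
  unitary_rep pi /\ forall g x, pi g (k x) = k (act g x).
Proof.
have sq g t : nrm (lincomb (k \o act g) t) = nrm (lincomb k t).
  apply/eqP; rewrite -(eqrXn2 (n := 2))// ?nrm_ge0//; apply/eqP/(@complexI R).
  rewrite -!hdot_nrm /lincomb !hdot_suml; apply: eq_bigr => a _.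
  rewrite !hdot_sumr; apply: eq_bigr => b _.
  by rewrite !hdotZl !hdotZr /= act_hdot.
have ex g : exists P : {linear H -> H},
    (forall x, P (k x) = k (act g x)) /\ forall v, nrm (P v) <= nrm v.
  by apply: linear_extension => // t; rewrite sq.
have [P hP] := choice ex.
have P1 v : P 1%g v = v.
  have := @eq_of_dense _ _ _ _ _ dense_k (P 1%g) idfun 1; apply.
  - by move=> w; rewrite mul1r; exact: (hP _).2.
  - by move=> w; rewrite mul1r.
  - by move=> x; rewrite (hP _).1 act1.
have PM g h v : P (g * h)%g v = P g (P h v).
  have := @eq_of_dense _ _ _ _ _ dense_k (P (g * h)%g) (P g \o P h) 1; apply.
  - by move=> w; rewrite mul1r; exact: (hP _).2.
  - by move=> w; rewrite mul1r; apply: le_trans ((hP _).2 _) ((hP _).2 _).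
  - by move=> x; rewrite /= !(hP _).1 actM.
have Pb g : exists M : R[i], forall v, `|P g v| <= M * `|v|.
  by exists 1 => v; rewrite mul1r !nrmE lecR; exact: (hP g).2.
exists (Representation Pb P1 PM); split=> [g|g x]; last exact: (hP g).1.
(* Both g and its inverse act by contractions, so g acts isometrically. *)
apply: isometry_hdot => v; apply: le_anti; rewrite (hP g).2 /=.
by rewrite -{1}(P1 v) -(mulVg g) PM; exact: (hP _).2.
Qed.

End gns_representation.

(** * Positive definite Gaussian kernels *)

Lemma quadratic_discriminant (R : realType) (a f c : R) : 0 <= a ->
  (forall r, 0 <= r ^+ 2 * a + 2 * r * f + c) -> f ^+ 2 <= c * a.
Proof.
rewrite le_eqVlt => /predU1P[<-|a0] key.
  rewrite mulr0 leNgt lt_def sqr_ge0 andbT sqrf_eq0; apply/negP => f0.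
  (* With a = 0 the polynomial is affine in r and takes the value -1 here. *)
  have := key (- (c + 1) / (2 * f)); rewrite mulr0 add0r.
  have -> : 2 * (- (c + 1) / (2 * f)) * f = - (c + 1) by field.
  lra.
have := key (- f / a); have a00 : a != 0 by rewrite gt_eqF.
have -> : (- f / a) ^+ 2 * a + 2 * (- f / a) * f + c = (c * a - f ^+ 2) / a by field.
by rewrite pmulr_lge0 ?invr_gt0// subr_ge0.
Qed.

Section real_kernels.
Variables (R : realType) (Om : Type).
Local Notation comb := (seq (R * Om)).
Implicit Types (A B : Om -> Om -> R) (s t : comb).

Definition rform A s : R := \sum_(a <- s) \sum_(b <- s) a.1 * b.1 * A a.2 b.2.

Definition real_psd A : Prop :=
  (forall x y, A x y = A y x) /\ forall s, 0 <= rform A s.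

Definition rpair A s x : R := \sum_(a <- s) a.1 * A a.2 x.

Lemma rform_cons A c x s : (forall x y, A x y = A y x) ->
  rform A ((c, x) :: s) = c ^+ 2 * A x x + 2 * c * rpair A s x + rform A s.
Proof.
move=> sA; rewrite /rform big_cons big_cons /=.
under [X in _ + X = _]eq_bigr do rewrite big_cons /=.
rewrite big_split /=.
have -> : \sum_(a <- s) c * a.1 * A x a.2 = c * rpair A s x.
  by rewrite mulr_sumr; apply: eq_bigr => a _; rewrite sA mulrA.
have -> : \sum_(a <- s) a.1 * c * A a.2 x = c * rpair A s x.
  by rewrite mulr_sumr; apply: eq_bigr => a _; rewrite mulrCA mulrA.
by ring.
Qed.

Lemma rformD A B s : rform (fun x y => A x y + B x y) s = rform A s + rform B s.
Proof.
rewrite /rform -big_split; apply: eq_bigr => a _ /=.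
by rewrite -big_split; apply: eq_bigr => b _ /=; rewrite mulrDr.
Qed.

Lemma rform_conj A (f : Om -> R) s :
  rform (fun x y => f x * f y * A x y) s =
  rform A [seq (a.1 * f a.2, a.2) | a <- s].
Proof.
rewrite /rform big_map; apply: eq_bigr => a _; rewrite big_map.
by apply: eq_bigr => b _ /=; ring.
Qed.

Lemma rpair_sqr A s x : real_psd A -> rpair A s x ^+ 2 <= rform A s * A x x.
Proof.
move=> [sA pA]; set f := rpair A s x.
apply: quadratic_discriminant.
  by have := pA [:: (1, x)]; rewrite /rform !big_seq1 /= !mul1r.
by move=> r; rewrite -rform_cons.
Qed.

(** Induction on the support, for all A at once. If A x x > 0, the Schur complement A' of A at x is
    again positive and vanishes on the row of x, so the induction hypothesis applies to it. The rank
    one remainder A y x * A x z / A x x only rescales the coefficients of B. *)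
Lemma schur_product A B s : real_psd A -> real_psd B ->
  0 <= rform (fun x y => A x y * B x y) s.
Proof.
elim: s A => [|[c x] s IH] A [sA pA] [sB pB]; first by rewrite /rform big_nil.
have row0 A' : real_psd A' -> (forall y, A' x y = 0) ->
    0 <= rform (fun y z => A' y z * B y z) ((c, x) :: s).
  move=> pA' A'0; rewrite rform_cons; last by move=> y z; rewrite pA'.1 sB.
  rewrite A'0 mul0r mulr0 /rpair big1 ?mulr0 ?add0r; first exact: IH.
  by move=> a _; rewrite pA'.1 A'0 mul0r mulr0.
have : 0 <= A x x by have := pA [:: (1, x)]; rewrite /rform !big_seq1 /= !mul1r.
rewrite le_eqVlt => /predU1P[A0|A0].
  apply: row0 => // y; apply/eqP; rewrite -sqrf_eq0 eq_le sqr_ge0 andbT.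
  have := rpair_sqr [:: (1, y)] x (conj sA pA).
  by rewrite /rpair big_seq1 mul1r -A0 mulr0 sA.
have A00 : A x x != 0 by rewrite gt_eqF.
pose A' y z := A y z - A y x * A x z / A x x.
have pA' : real_psd A'.
  split=> [y z|t]; first by rewrite /A' (sA y z) (sA y x) (sA x z) [A x y * _]mulrC.
  have -> : rform A' t = rform A t - rpair A t x ^+ 2 / A x x.
    rewrite /rpair expr2 /rform mulr_suml mulr_suml -sumrB; apply: eq_bigr => a _.
    rewrite mulr_sumr mulr_suml -sumrB; apply: eq_bigr => b _.
    by rewrite /A' (sA x); field.
  by rewrite subr_ge0 ler_pdivrMr//; exact: rpair_sqr.
have -> : rform (fun y z => A y z * B y z) ((c, x) :: s) =
    rform (fun y z => A' y z * B y z) ((c, x) :: s) +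
    (A x x)^-1 * rform (fun y z => A y x * A z x * B y z) ((c, x) :: s).
  rewrite /rform mulr_sumr -big_split; apply: eq_bigr => a _ /=.
  rewrite mulr_sumr -big_split; apply: eq_bigr => b _ /=.
  by rewrite /A' (sA x); field.
apply: addr_ge0.
  by apply: row0 => // y; rewrite /A' mulrAC divff// mul1r subrr.
by apply: mulr_ge0; [rewrite invr_ge0 ltW|rewrite (rform_conj B (A ^~ x))].
Qed.

Lemma real_psdM A B : real_psd A -> real_psd B -> real_psd (fun x y => A x y * B x y).
Proof.
move=> pA pB; split=> [x y|s]; first by rewrite pA.1 pB.1.
exact: schur_product.
Qed.

Lemma real_psdD A B : real_psd A -> real_psd B -> real_psd (fun x y => A x y + B x y).
Proof.
move=> pA pB; split=> [x y|s]; first by rewrite pA.1 pB.1.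
by rewrite rformD addr_ge0 ?pA.2 ?pB.2.
Qed.

Lemma real_psd_cst (c : R) : 0 <= c -> real_psd (fun _ _ => c).
Proof.
move=> c0; split=> // s.
have -> : rform (fun _ _ => c) s = c * (\sum_(a <- s) a.1) ^+ 2.
  rewrite /rform expr2 mulr_suml mulr_sumr; apply: eq_bigr => a _.
  by rewrite !mulr_sumr; apply: eq_bigr => b _; rewrite mulrC.
by rewrite mulr_ge0// sqr_ge0.
Qed.

Lemma real_psdX A n : real_psd A -> real_psd (fun x y => A x y ^+ n).
Proof.
move=> pA; elim: n => [|n IH].
  by have := real_psd_cst ler01; congr real_psd; do 2!apply/funext => ?; rewrite expr0.
by have := real_psdM pA IH; congr real_psd; do 2!apply/funext => ?; rewrite exprS.
Qed.

Lemma real_psd_lim (A_ : nat -> Om -> Om -> R) A : (forall n, real_psd (A_ n)) ->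
  (forall x y, A_ n x y @[n --> \oo] --> A x y) -> real_psd A.
Proof.
move=> pA cA; split=> [x y|s].
  have h := cA y x; apply: (cvg_unique _ (cA x y)) => //.
  suff -> : (fun n => A_ n x y) = (fun n => A_ n y x) by [].
  by apply/funext => n; rewrite (pA n).1.
have : rform (A_ n) s @[n --> \oo] --> rform A s.
  apply: cvg_big => [|a _]; first exact: add_continuous.
  apply: cvg_big => [|b _]; first exact: add_continuous.
  by apply: cvgMl_tmp; exact: cA.
by move=> hc; apply: (cvgr_to_ge hc); apply: nearW => n; exact: (pA n).2.
Qed.

(** The partial sums of the exponential series are combinations of Schur powers of A with
    nonnegative coefficients, and positivity passes to pointwise limits. *)
Lemma real_psd_expR A : real_psd A -> real_psd (fun x y => expR (A x y)).
Proof.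
move=> pA; apply: (@real_psd_lim (fun n x y => series (exp_coeff (A x y)) n)).
  elim=> [|n IH].
    have := real_psd_cst (lexx 0); congr real_psd; do 2!apply/funext => ?.
    by rewrite /series /= big_geq.
  have := real_psdD IH (real_psdM (real_psdX n pA) (@real_psd_cst (n`!%:R^-1) _)).
  rewrite invr_ge0 ler0n => /(_ isT); congr real_psd; do 2!apply/funext => ?.
  by rewrite /series /= big_nat_recr.
by move=> x y; exact: is_cvg_series_exp_coeff.
Qed.

Lemma real_psd_conj A (f : Om -> R) : real_psd A -> real_psd (fun x y => f x * f y * A x y).
Proof.
move=> pA; split=> [x y|s]; first by rewrite pA.1 [f x * _]mulrC.
by rewrite rform_conj pA.2.
Qed.

(** As A is real and symmetric, the cross terms cancel in the real part and the form splits over the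
    real and imaginary parts of the coefficients. *)
Lemma psd_kernel_real A : real_psd A -> psd_kernel (fun x y => (A x y)%:C).
Proof.
move=> pA; split=> [x y|s]; first by rewrite conjc_real pA.1.
have -> : qform (fun x y => (A x y)%:C) s =
    rform A [seq (complex.Re a.1, a.2) | a <- s] +
    rform A [seq (complex.Im a.1, a.2) | a <- s].
  rewrite /qform /gram /pairing /kcomb /rform !big_map raddf_sum /=.
  rewrite -big_split; apply: eq_bigr => b _ /=.
  rewrite mulr_sumr raddf_sum /= !big_map -big_split; apply: eq_bigr => a _ /=.
  by rewrite (pA.1 b.2); case: a.1 b.1 => [p q] [p' q'] /=; ring.
by rewrite addr_ge0 ?pA.2.
Qed.

End real_kernels.

Lemma real_psd_hdot (R : realType) (E : hilbertType R) (Om : Type) (b : Om -> E) (c : R) :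
  0 <= c -> real_psd (fun x y => c * complex.Re (hdot (b x) (b y))).
Proof.
move=> c0; split=> [x y|s].
  by rewrite (hdotC (b y)); case: (hdot _ _).
have -> : rform (fun x y => c * complex.Re (hdot (b x) (b y))) s =
    c * nrm (\sum_(a <- s) a.1%:C *: b a.2) ^+ 2.
  have -> : nrm (\sum_(a <- s) a.1%:C *: b a.2) ^+ 2 =
    complex.Re (hdot (\sum_(a <- s) a.1%:C *: b a.2) (\sum_(a <- s) a.1%:C *: b a.2)).
    by rewrite hdot_nrm.
  rewrite hdot_suml raddf_sum mulr_sumr; apply: eq_bigr => a _ /=.
  rewrite hdot_sumr raddf_sum mulr_sumr; apply: eq_bigr => a' _ /=.
  by rewrite hdotZl hdotZr; case: (hdot _ _) => p q /=; ring.
by rewrite mulr_ge0 ?sqr_ge0.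
Qed.

(** The kernel is exp(2c Re <b x, b y>) multiplied by f x * f y with f x = exp(-c |b x|^2). *)
Lemma gaussian_psd (R : realType) (E : hilbertType R) (Om : Type) (b : Om -> E) (c : R) :
  0 <= c -> real_psd (fun x y => expR (- (c * nrm (b x - b y) ^+ 2))).
Proof.
move=> c0; have c2 : 0 <= 2 * c by lra.
have := real_psd_conj (fun x => expR (- (c * nrm (b x) ^+ 2)))
  (real_psd_expR (real_psd_hdot b c2)).
congr real_psd; do 2!apply/funext => ?; rewrite -!expRD; congr expR.
by rewrite sqr_nrmB; ring.
Qed.

(** * Bounded cocycles and fixed points *)

Section cocycles.
Variables (R : realType) (G : groupType).

Definition cocycle (K : numFieldType) (E : completeNormedModType K)
  (pi : representation G E) (b : G -> E) : Prop :=
  forall g h, b (g * h)%g = b g + pi g (b h).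

Lemma cocycle1 (K : numFieldType) (E : completeNormedModType K)
  (pi : representation G E) (b : G -> E) : cocycle pi b -> b 1%g = 0.
Proof.
move=> cb; have := cb 1%g 1%g; rewrite mulg1 rep1 => /eqP.
by rewrite -subr_eq subrr => /eqP.
Qed.

Lemma cocycleV (K : numFieldType) (E : completeNormedModType K)
  (pi : representation G E) (b : G -> E) g :
  cocycle pi b -> b g^-1%g = - pi g^-1%g (b g).
Proof.
move=> cb; apply/eqP; rewrite -addr_eq0 -cb mulVg.
by rewrite (cocycle1 cb).
Qed.

Lemma unitary_nrm (E : hilbertType R) (pi : representation G E) :
  unitary_rep pi -> forall g v, nrm (pi g v) = nrm v.
Proof.
move=> upi g v; apply/eqP; rewrite -(eqrXn2 (n := 2))// ?nrm_ge0//; apply/eqP.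
by apply: (@complexI R); rewrite -!hdot_nrm upi.
Qed.

Lemma expRN_le (y a : R) : 0 < a -> a <= y -> expR (- y) <= a^-1.
Proof.
move=> a0 ay; rewrite expRN lef_pV2 ?posrE ?expR_gt0//.
by have := expR_ge1Dx y; lra.
Qed.

Section bounded.
Variables (E : hilbertType R) (pi : representation G E) (b : G -> E).
Hypotheses (upi : unitary_rep pi) (cb : cocycle pi b).

Lemma cocycle_dist g x y : nrm (b (g * x)%g - b (g * y)%g) = nrm (b x - b y).
Proof. by rewrite !cb opprD addrACA subrr add0r -linearB unitary_nrm. Qed.

Section gaussian_model.
Variables (c : R) (H : hilbertType R) (k : G -> H).
Hypothesis c0 : 0 < c.
Hypothesis kE : forall x y, hdot (k x) (k y) = (expR (- (c * nrm (b x - b y) ^+ 2)))%:C.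
Hypothesis unbounded : forall M, exists g, M < nrm (b g).

(* Points of an unbounded orbit can be chosen far apart, hence almost orthogonal
   in the model. *)
Let spread n : exists2 s : seq G, size s = n &
  nrm (\sum_(g <- s) k g) ^+ 2 <= 2 * n%:R.
Proof.
elim: n => [|n [s sn hs]].
  by exists [::] => //; rewrite big_nil nrm0 expr0n /= mulr0.
(* As L >= 1 and c L >= y, points at distance L have inner product at most exp(-y) <= 1/y. The n
   cross terms then add up to at most 1/2, and the new vector increases the squared norm by at most
   1 + 2 * 1/2 = 2. *)
pose y := 2 * n.+1%:R : R; pose L := 1 + y / c.
have y0 : 0 < y by rewrite mulr_gt0// ltr0n.
have yc0 : 0 < y / c by rewrite divr_gt0.
have [g hg] := unbounded (L + \sum_(h <- s) nrm (b h)).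
exists (g :: s); first by rewrite /= sn.
rewrite big_cons sqr_nrmD.
have -> : nrm (k g) ^+ 2 = 1.
  apply: (@complexI R); rewrite -hdot_nrm kE subrr nrm0 expr0n mulr0 oppr0.
  by rewrite expR0.
have far h : h \in s -> expR (- (c * nrm (b g - b h) ^+ 2)) <= y^-1.
  move=> hs'; apply: expRN_le => //.
  have Lh : L <= nrm (b g - b h).
    have := nrm_distl (b g) (b h); rewrite ler_norml => /andP[_ h1].
    have : nrm (b h) <= \sum_(h <- s) nrm (b h).
      rewrite (big_rem h)//= lerDl; apply: sumr_ge0 => ? _; exact: nrm_ge0.
    by lra.
  rewrite -ler_pdivrMl// mulrC; apply: le_trans (_ : L <= _); first by rewrite /L; lra.
  apply: le_trans (Lh) _; rewrite expr2 ler_peMl ?nrm_ge0//.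
  by apply: le_trans Lh; rewrite /L; lra.
rewrite hdot_sumr raddf_sum /=.
have : \sum_(h <- s) complex.Re (hdot (k g) (k h)) <= n%:R * y^-1.
  rewrite -sn big_seq; apply: le_trans (_ : \sum_(h <- s | h \in s) y^-1 <= _).
    by apply: ler_sum => h hs'; rewrite kE /= far.
  by rewrite -big_seq big_const_seq count_predT iter_addr_0 mulr_natl.
have : n%:R * y^-1 <= 2^-1.
  by rewrite ler_pdivrMr// /y mulrA mulVf// mul1r ler_nat.
rewrite -[n.+1%:R]natr1; move: hs; lra.
Qed.

(** Against a sum of n spread-out vectors Cauchy-Schwarz gives n |w| <= |z| sqrt(2n), which fails
    for large n unless w = 0. *)
Lemma constant_eq0 (z : H) (w : R[i]) : (forall g, hdot z (k g) = w) -> w = 0.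
Proof.
move=> zk; apply: nrm_eq0; apply/eqP; rewrite -sqrf_eq0; apply/eqP.
apply: le_anti; rewrite sqr_ge0 andbT leNgt; apply/negP => w0.
pose n := (Num.truncn (2 * nrm z ^+ 2 / nrm w ^+ 2)).+1.
have hn : 2 * nrm z ^+ 2 < n%:R * nrm w ^+ 2.
  by rewrite -ltr_pdivrMr// truncnS_gt.
have [s sn hs] := spread n.
have : hdot z (\sum_(g <- s) k g) = n%:R * w.
  rewrite hdot_sumr (eq_bigr (fun=> w)) => [|g _]; last exact: zk.
  by rewrite big_const_seq count_predT iter_addr_0 sn mulr_natl.
move=> zs; have := nrm_hdot_le z (\sum_(g <- s) k g); rewrite zs nrmM => h.
have nn : nrm (n%:R : R[i]) = n%:R.
  by rewrite /nrm normr_nat -(rmorph_nat (real_complex R)).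
rewrite nn in h.
have n0 : 0 < n%:R :> R by rewrite ltr0n.
have := lerXn2r 2 (mulr_ge0 (ltW n0) (nrm_ge0 w)) (mulr_ge0 (nrm_ge0 z) (nrm_ge0 _)) h.
rewrite !exprMn => h2.
have h3 : n%:R ^+ 2 * nrm w ^+ 2 <= nrm z ^+ 2 * (2 * n%:R).
  by apply: le_trans h2 _; rewrite ler_wpM2l ?sqr_ge0.
have h4 : n%:R * (n%:R * nrm w ^+ 2) <= n%:R * (2 * nrm z ^+ 2) by move: h3; rewrite expr2; lra.
by move: h4; rewrite ler_pM2l//; lra.
Qed.

End gaussian_model.

Lemma property_T_bounded : property_T R G -> exists M, forall g, nrm (b g) <= M.
Proof.
move=> [Q [kappa [kappa0 hT]]]; apply: contrapT => nbd.
have unb M : exists g, M < nrm (b g).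
  apply: contrapT => h; apply: nbd; exists M => g; rewrite leNgt; apply/negP => hg.
  by apply: h; exists g.
pose m := \sum_(q <- Q) nrm (b q) ^+ 2.
have m0 : 0 <= m by apply: sumr_ge0 => q _; exact: sqr_ge0.
(* For q in Q, |k q - k 1|^2 = 2 (1 - exp(-c |b q|^2)) <= 2 c m, and this c keeps 2 c m below
   kappa^2. *)
pose c := kappa ^+ 2 / (2 * (m + 1)).
have m1 : 0 < 2 * (m + 1) by lra.
have c0 : 0 < c by rewrite divr_gt0// exprn_gt0.
have [H [k [kE dk]]] := rkhs_exists (psd_kernel_real (gaussian_psd b (ltW c0))).
have [|g h x|g x y|rho [urho rhok]] := @gns_representation R G G H k (fun g x => (g * x)%g) dk.
- by move=> x; rewrite mul1g.
- by rewrite mulgA.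
- by rewrite !kE cocycle_dist.
have nk1 g : nrm (k g) = 1.
  apply/eqP; rewrite -(eqrXn2 (n := 2))// ?nrm_ge0//; apply/eqP.
  apply: (@complexI R); rewrite -hdot_nrm kE subrr nrm0 expr0n mulr0 oppr0.
  by rewrite expR0 expr1n.
have [|z z0 zinv] := hT H rho urho.
  exists (k 1%g); first by apply/negP => /eqP k0; have := nk1 1%g; rewrite k0 nrm0; lra.
  move=> q qQ; rewrite !nrmE -rcM ltcR nk1 mulr1 rhok mulg1.
  rewrite -(@ltr_pXn2r _ 2%N) ?nnegrE ?nrm_ge0 ?(ltW kappa0)//.
  rewrite sqr_nrmB !nk1 kE (cocycle1 cb) subr0 /=.
  have := expR_ge1Dx (- (c * nrm (b q) ^+ 2)).
  have bm : nrm (b q) ^+ 2 <= m.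
    by rewrite /m (big_rem q)//= lerDl; apply: sumr_ge0 => ? _; exact: sqr_ge0.
  have cbm : c * nrm (b q) ^+ 2 <= c * m by exact: (ler_wpM2l (ltW c0) bm).
  have : 2 * (c * m) < kappa ^+ 2.
    have -> : 2 * (c * m) = kappa ^+ 2 * (m / (m + 1)) by rewrite /c; field; lra.
    by rewrite -[ltRHS]mulr1 ltr_pM2l ?exprn_gt0// ltr_pdivrMr ?mul1r; lra.
  by rewrite expr1n; lra.
(* Invariance of z makes its inner products with the orbit constant, hence zero; the orbit spans a
   dense subspace, so z = 0. *)
have zk g : hdot z (k g) = hdot z (k 1%g).
  by rewrite -[in LHS](mulg1 g) -rhok -{1}(zinv g) urho.
have w0 := constant_eq0 c0 kE unb zk.
case/eqP: z0; apply: hdot_inj => v.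
apply: (gcvg_uniq (u := fun=> 0)); last exact: gcvg_cst.
have [t [D ht]] := dense_seq dk v.
exists (nrm z * D) => n; rewrite subr0.
have -> : hdot z v = hdot z (v - lincomb k (t n)).
  rewrite hdotBr /lincomb hdot_sumr big1 ?subr0// => a _.
  by rewrite hdotZr zk w0 mulr0.
by apply: le_trans (nrm_hdot_le _ _) _; rewrite -mulrA ler_wpM2l ?nrm_ge0.
Qed.

(* The fixed point is the Chebyshev centre of the orbit [b G]. *)
Lemma bounded_fixed_point : (exists M, forall g, nrm (b g) <= M) ->
  exists y, forall g, b g = y - pi g y.
Proof.
move=> [M hM].
pose P v r := forall g, nrm (v - b g) ^+ 2 <= r.
have PM : exists v, P v (M ^+ 2).
  exists 0 => g; rewrite sub0r nrmN; apply: lerXn2r => //; rewrite ?nnegrE ?nrm_ge0//.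
  exact: le_trans (nrm_ge0 _) (hM g).
pose S := [set r | exists v, P v r].
have infS : has_inf S.
  split; first by exists (M ^+ 2).
  by exists 0 => r [v /(_ 1%g)]; apply: le_trans; exact: sqr_ge0.
pose r0 := inf S.
(* By the parallelogram law the midpoint of two almost optimal centres has a squared radius smaller
   by |u - v|^2 / 4, which cannot fall below the infimum. *)
have near2 e u v : P u (r0 + e ^+ 2) -> P v (r0 + e ^+ 2) -> 0 <= e -> nrm (u - v) <= 2 * e.
  move=> Pu Pv e0.
  have : S (r0 + e ^+ 2 - nrm (u - v) ^+ 2 / 4).
    exists ((2^-1 : R)%:C *: (u + v)) => g.
    have -> : (2^-1 : R)%:C *: (u + v) - b g = (2^-1 : R)%:C *: ((u - b g) + (v - b g)).
      rewrite addrACA -opprD scalerBr; congr (_ - _).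
      rewrite scalerDr -scalerDl -rcD (_ : 2^-1 + 2^-1 = 1) ?scale1r//; lra.
    rewrite nrmZ nrm_real exprMn ger0_norm ?invr_ge0//.
    have := parallelogram (u - b g) (v - b g).
    have -> : u - b g - (v - b g) = u - v by rewrite opprB addrA subrK.
    have := Pu g; have := Pv g; rewrite exprVn; lra.
  move=> /(ge_inf infS.2); rewrite -/r0 => h.
  by rewrite -(@ler_pXn2r _ 2%N) ?nnegrE ?nrm_ge0// ?mulr_ge0// exprMn; lra.
have ex n : exists v, P v (r0 + (2^-1 ^+ n) ^+ 2).
  have e0 : 0 < ((2^-1 : R) ^+ n) ^+ 2 by rewrite exprn_gt0// half_exp_gt0.
  have [r [v Pv] rlt] := inf_adherent e0 infS.
  by exists v => g; apply: le_trans (Pv g) (ltW rlt).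
have [v hv] := choice ex.
have [l hl] : exists l, gcvg v l.
  apply: (@gcvg_of_cauchy _ _ _ 2) => n.
  have P1 : P (v n.+1) (r0 + (2^-1 ^+ n) ^+ 2).
    move=> g; apply: le_trans (hv n.+1 g) _; rewrite lerD2l.
    by apply: lerXn2r; rewrite ?nnegrE ?(ltW (half_exp_gt0 _ _))// half_exp_anti.
  by apply: near2; rewrite ?(ltW (half_exp_gt0 _ _)).
exists l => g; apply/eqP; rewrite eq_sym subr_eq; apply/eqP.
have h1 : gcvg (fun n => b g + pi g (v n)) (b g + pi g l).
  apply: gcvgD; first exact: gcvg_cst.
  by apply: (gcvg_lip (M := 1)) hl => x y; rewrite mul1r -linearB unitary_nrm.
(* The affine isometry v -> pi g v + b g permutes the orbit, so it maps v n to another almost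
   optimal centre, which [near2] places within 2 * 2^-n of v n. *)
apply: (gcvg_uniq _ h1); have [D hD] := hl; exists (D + 2) => n.
apply: le_trans (nrm_dist (v n) _ _) _; rewrite mulrDl lerD//.
apply: near2; rewrite ?(ltW (half_exp_gt0 _ _))// => h.
have -> : b g + pi g (v n) - b h = pi g (v n - b (g^-1 * h)%g).
  by rewrite linearB -{1}[h](mulVKg g) cb opprD addrACA subrr add0r.
by rewrite unitary_nrm //; exact: hv.
Qed.

End bounded.
End cocycles.

(** * Hilbert direct sums *)

Lemma hdot_lincomb (R : realType) (Om : Type) (K : Om -> Om -> R[i]) (H : hilbertType R)
  (k : Om -> H) s t : (forall x y, hdot (k x) (k y) = K x y) ->
  hdot (lincomb k s) (lincomb k t) = gram K s t.
Proof.
move=> kE; rewrite /lincomb /gram /pairing /kcomb hdot_sumr.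
apply: eq_bigr => b _; rewrite hdotZr hdot_suml; congr (_ * _).
by apply: eq_bigr => a _; rewrite hdotZl kE.
Qed.

Section direct_sum.
Variables (R : realType) (G : groupType) (E_ : nat -> hilbertType R).
Variable pi_ : forall n, representation G (E_ n).
Hypothesis upi : forall n, unitary_rep (pi_ n).
Local Notation Om := {n & E_ n}.
Local Notation comb := (seq (R[i] * Om)).
Local Notation tg n v := (existT (fun m => Hilbert.sort (E_ m)) n v).

(** The tagged vector is cast along the equality of tags and replaced by 0 when they differ; the
    cast disappears because equality proofs on nat are unique. *)
Definition component n (x : Om) : E_ n :=
  match tag x =P n with
  | ReflectT e => eq_rect (tag x) (fun m => E_ m : Type) (tagged x) n e
  | ReflectF _ => 0
  end.

Lemma component_eq n (v : E_ n) : component n (tg n v) = v.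
Proof. by rewrite /component; case: eqP => //= e; rewrite (eq_axiomK e). Qed.

Lemma component_neq n x : tag x != n -> component n x = 0.
Proof. by rewrite /component; case: eqP. Qed.

(* The Hilbert direct sum is the reproducing kernel space of this kernel on the
   disjoint union of the summands. *)
Definition sum_kernel (x y : Om) : R[i] :=
  hdot (component (tag x) x) (component (tag x) y).

Lemma sum_kernelE N x y : (tag x < N)%N ->
  sum_kernel x y = \sum_(n < N) hdot (component n x) (component n y).
Proof.
move=> xN; rewrite (bigD1 (Ordinal xN))//= big1 ?addr0// => n nx.
rewrite component_neq ?hdot0l//; apply: contra nx => /eqP e.
by apply/eqP/val_inj.
Qed.

Lemma sum_gramE N (s t : comb) : (forall a, a \in map (tag \o snd) s -> (a < N)%N) ->
  gram sum_kernel s t =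
  \sum_(n < N) hdot (lincomb (component n) s) (lincomb (component n) t).
Proof.
move=> sN; rewrite /gram /pairing /kcomb.
under [RHS]eq_bigr do rewrite hdot_sumr.
rewrite exchange_big; apply: eq_bigr => b _ /=.
under [RHS]eq_bigr do rewrite hdotZr hdot_suml mulr_sumr.
rewrite exchange_big mulr_sumr /=.
elim: s sN => [|a s IH] sN; first by rewrite !big_nil.
rewrite !big_cons IH => [|c cs]; last by apply: sN; rewrite inE cs orbT.
congr (_ + _); rewrite (@sum_kernelE N); last by apply: sN; rewrite inE eqxx.
by rewrite !mulr_sumr; apply: eq_bigr => n _; rewrite hdotZl.
Qed.

Lemma comb_tag_bound (s : comb) :
  exists N, forall a, a \in map (tag \o snd) s -> (a < N)%N.
Proof.
exists (\max_(a <- map (tag \o snd) s) a).+1 => a ha; rewrite ltnS.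
exact: (leq_bigmax_seq _ ha).
Qed.

Lemma sum_qformE N (s : comb) : (forall a, a \in map (tag \o snd) s -> (a < N)%N) ->
  qform sum_kernel s = \sum_(n < N) nrm (lincomb (component n) s) ^+ 2.
Proof.
move=> /sum_gramE h; rewrite /qform h raddf_sum /=.
by apply: eq_bigr => n _; rewrite hdot_nrm.
Qed.

Lemma sum_kernel_psd : psd_kernel sum_kernel.
Proof.
split=> [[n v] [m w]|s].
  rewrite /sum_kernel /=; have [mn|mn] := eqVneq n m.
    by subst m; rewrite !component_eq -hdotC.
  rewrite (@component_neq m (tg n v))// (@component_neq n (tg m w)) /= 1?eq_sym//.
  by rewrite !hdot0r conjc0.
have [N hN] := comb_tag_bound s; rewrite (sum_qformE hN).
by apply: sumr_ge0 => n _; exact: sqr_ge0.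
Qed.

Definition sum_act g (x : Om) : Om := tg (tag x) (pi_ (tag x) g (tagged x)).

Lemma component_act n g x : component n (sum_act g x) = pi_ n g (component n x).
Proof.
case: x => m v; have [mn|mn] := eqVneq m n.
  by subst n; rewrite /sum_act /= !component_eq.
by rewrite !component_neq// linear0.
Qed.

(** The last clause is what refutes a sequence of counterexamples: the components of a single vector
    eventually have norm at most 1. *)
Definition is_direct_sum (H : hilbertType R) (pi : representation G H)
    (i : forall n, {linear E_ n -> H}) (p : forall n, {linear H -> E_ n}) : Prop :=
  [/\ unitary_rep pi,
      (forall n g v, i n (pi_ n g v) = pi g (i n v)) /\
      (forall n g z, p n (pi g z) = pi_ n g (p n z)),
      (forall n v, nrm (i n v) = nrm v) /\ (forall n z, nrm (p n z) <= nrm z),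
      (forall n v, p n (i n v) = v) /\ (forall m n v, n != m -> p m (i n v) = 0) &
      forall z e, 0 < e -> exists N, forall n, (N <= n)%N -> nrm (p n z) <= e].

Theorem direct_sum : exists H pi i p, @is_direct_sum H pi i p.
Proof.
have [H [k [kE dk]]] := rkhs_exists sum_kernel_psd.
have nk N (s : comb) : (forall a, a \in map (tag \o snd) s -> (a < N)%N) ->
    nrm (lincomb k s) ^+ 2 = \sum_(n < N) nrm (lincomb (component n) s) ^+ 2.
  by move=> hN; rewrite -sum_qformE// /qform -(hdot_lincomb _ _ kE) hdot_nrm.
have [|g h [n v]|g x y|pi [upi' piE]] := @gns_representation R G Om H k sum_act dk.
- by case=> n v; rewrite /sum_act /= rep1.
- by rewrite /sum_act /= repM.
- by rewrite !kE /sum_kernel !component_act upi.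
(* The kernel is indexed by vectors, so linearity is not built in: the defect is a combination all
   of whose components vanish, hence it has norm 0. *)
have ilin n : linear (fun v : E_ n => k (tg n v)).
  move=> a v w.
  pose s : comb := [:: (1, tg n (a *: v + w)); (- a, tg n v); (-1, tg n w)].
  apply/subr0_eq/nrm_eq0/eqP; rewrite -sqrf_eq0; apply/eqP.
  have -> : k (tg n (a *: v + w)) - (a *: k (tg n v) + k (tg n w)) = lincomb k s.
    rewrite /lincomb !big_cons big_nil /= scale1r scaleN1r addr0 scaleNr.
    by rewrite opprD.
  have [N hN] := comb_tag_bound s; rewrite (nk _ _ hN) big1// => m _.
  rewrite /lincomb !big_cons big_nil /= addr0.
  have [nm|nm] := eqVneq n m.
    move: v w @s hN; rewrite nm => v w s _; rewrite !component_eq scale1r scaleN1r scaleNr.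
    by rewrite -opprD subrr nrm0 expr0n.
  by rewrite !component_neq// !scaler0 !addr0 nrm0 expr0n.
pose i n : {linear E_ n -> H} := HB.pack (fun v : E_ n => k (tg n v))
  (GRing.isLinear.Build _ _ _ _ _ (ilin n)).
have ct n (t : comb) : nrm (lincomb (component n) t) <= nrm (lincomb k t).
  rewrite -(@ler_pXn2r _ 2%N) ?nnegrE ?nrm_ge0//.
  have [N hN] := comb_tag_bound t.
  rewrite (@nk (maxn N n.+1)); last by move=> a /hN aN; rewrite leq_max aN.
  have nN : (n < maxn N n.+1)%N by rewrite leq_max leqnn orbT.
  rewrite (bigD1 (Ordinal nN))//= lerDl.
  by apply: sumr_ge0 => m _; exact: sqr_ge0.
pose p n : {linear H -> E_ n} := sval (cid (linear_extension dk (ct n))).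
have hp n : (forall x, p n (k x) = component n x) /\ forall v, nrm (p n v) <= nrm v.
  exact: svalP (cid (linear_extension dk (ct n))).
move: p hp => p hp.
exists H, pi, i, p; split=> //.
- split=> [n g v|n g z]; first by rewrite /= piE.
  have := @eq_of_dense _ _ _ _ _ dk (p n \o pi g) (pi_ n g \o p n) 1; apply.
  + by move=> w; rewrite mul1r; apply: le_trans ((hp n).2 _) _; rewrite unitary_nrm.
  + by move=> w; rewrite mul1r /= unitary_nrm//; exact: (hp n).2.
  + by move=> x; rewrite /= piE !(hp n).1 component_act.
- split=> [n v|n z]; last exact: (hp n).2.
  apply/eqP; rewrite -(eqrXn2 (n := 2))// ?nrm_ge0//; apply/eqP.
  by apply: (@complexI R); rewrite -!hdot_nrm /= kE /sum_kernel /= !component_eq.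
- split=> [n v|m n v nm]; first by rewrite /= (hp n).1 component_eq.
  by rewrite /= (hp m).1 component_neq.
- move=> z e /(dk z)[t ht]; have [N hN] := comb_tag_bound t.
  exists N => n Nn; apply: le_trans ht.
  have -> : p n z = p n (z - lincomb k t).
    rewrite linearB [p n (lincomb _ _)](_ : _ = 0) ?subr0//.
    rewrite /lincomb linear_sum big_seq big1// => a at_.
    rewrite linearZ /= (hp n).1 component_neq ?scaler0//.
    rewrite neq_ltn (leq_trans (hN (tag a.2) _) Nn)//.
    by apply/mapP; exists a.
  exact: (hp n).2.
Qed.

Lemma direct_sum_series H pi i p (x : forall n, E_ n) (C : R) :
  @is_direct_sum H pi i p -> (forall n, nrm (x n) <= C * 2^-1 ^+ n) ->
  exists2 z, gcvg (fun n => \sum_(m < n) i m (x m)) z & forall n, p n z = x n.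
Proof.
move=> [_ _ [ii pp] [pi_eq pi_neq] _] hx.
have [|z hz] := @gcvg_of_cauchy R H (fun n => \sum_(m < n) i m (x m)) C.
  by move=> n; rewrite big_ord_recr /= addrAC subrr add0r ii; exact: hx.
exists z => // n; have hpz := gcvg_shift n.+1 hz.
have lip a b : nrm (p n a - p n b) <= 1 * nrm (a - b) by rewrite mul1r -linearB.
have h := gcvg_lip lip hpz; apply: (gcvg_uniq h).
have := gcvg_cst (x n); congr gcvg; apply/funext => m.
have nm : (n < m + n.+1)%N by rewrite addnS ltnS leq_addl.
rewrite linear_sum (bigD1 (Ordinal nm))//= pi_eq big1 ?addr0// => k kn.
by rewrite pi_neq//; apply: contra kn => /eqP kn; apply/eqP/val_inj.
Qed.

End direct_sum.

(** * Uniform solution of the cocycle equation *)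

Section control.
Variables (R : realType) (G : groupType) (S : {fset G}).
Hypothesis hS : generates S.

Definition near_rep (E : hilbertType R) (eps : R) (pi rho : representation G E) : Prop :=
  forall s, s \in S -> forall v, nrm (pi s v - rho s v) <= eps * nrm v.

(** The constants precede E, pi and rho; this order of quantifiers is what permits an eps uniform in
    pi. *)
Definition controlled (g : G) (C e0 : R) : Prop :=
  forall (E : hilbertType R) (pi rho : representation G E) (eps : R),
    unitary_rep pi -> 0 <= eps <= e0 -> near_rep eps pi rho ->
    (forall v, nrm (pi g v - rho g v) <= C * eps * nrm v) /\
    forall b M, cocycle rho b -> 0 <= M -> (forall s, s \in S -> nrm (b s) <= M) ->
      nrm (b g) <= C * M.

Lemma word_control g : exists C e0, [/\ 0 <= C, 0 < e0 & controlled g C e0].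
Proof.
apply: (hS (H := fun g => exists C e0, [/\ 0 <= C, 0 < e0 & controlled g C e0])).
- move=> s sS; exists 1, 1; split=> // E pi rho eps upi _ near.
  split=> [v|b M cb M0 hM]; first by rewrite mul1r; exact: near.
  by rewrite mul1r hM.
- exists 0, 1; split=> // E pi rho eps upi _ near.
  split=> [v|b M cb M0 hM]; first by rewrite !rep1 subrr nrm0 !mul0r.
  by rewrite (cocycle1 cb) nrm0 mul0r.
move=> {}g h [Cg [eg [Cg0 eg0 hg]]] [Ch [eh [Ch0 eh0 hh]]].
(* This gives Ch * eps <= 1/2, so that rho h shrinks no vector by more than a factor 2 and its
   inverse has norm at most 2. *)
pose eo := (2 * (Ch + 1))^-1; have eo0 : 0 < eo by rewrite invr_gt0; lra.
(* The term 2 (Cg + Ch) covers the operators. For the cocycle, |b (g h^-1)| <= Cg M + (1 + Cg) * 2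
   Ch M, where eps <= 1 bounds rho g by 1 + Cg. *)
exists (2 * (Cg + Ch) + 2 * Ch * (1 + Cg)), (Num.min (Num.min eg eh) (Num.min eo 1)).
split.
- by rewrite addr_ge0// ?mulr_ge0//; lra.
- by rewrite !lt_min eg0 eh0 eo0 ltr01.
move=> E pi rho eps upi; rewrite !le_min.
move=> /andP[e0 /andP[/andP[eeg eeh] /andP[eeo e1]]] near.
have [hg1 hg2] := hg E pi rho eps upi (introT andP (conj e0 eeg)) near.
have [hh1 hh2] := hh E pi rho eps upi (introT andP (conj e0 eeh)) near.
have Che : Ch * eps <= 2^-1.
  apply: le_trans (ler_wpM2l Ch0 eeo) _.
  by rewrite /eo ler_pdivrMr; lra.
have rhoV v : rho h (rho h^-1%g v) = v by rewrite -repM mulgV rep1.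
have b2 v : nrm (rho h^-1%g v) <= 2 * nrm v.
  have := hh1 (rho h^-1%g v); rewrite rhoV => h1.
  have := nrm_distl (pi h (rho h^-1%g v)) v; rewrite unitary_nrm// ler_norml => /andP[_ h2].
  have h3 : Ch * eps * nrm (rho h^-1%g v) <= 2^-1 * nrm (rho h^-1%g v).
    by rewrite ler_wpM2r ?nrm_ge0.
  lra.
have hV v : nrm (pi h^-1%g v - rho h^-1%g v) <= Ch * eps * (2 * nrm v).
  rewrite -(unitary_nrm upi h (_ - _)) linearB -repM mulgV rep1 -{1}(rhoV v) nrmBC.
  apply: le_trans (hh1 _) _; rewrite ler_wpM2l ?mulr_ge0//.
split=> [v|b M cb M0 hM].
  rewrite !repM.
  have -> : pi g (pi h^-1%g v) - rho g (rho h^-1%g v) =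
    pi g (pi h^-1%g v - rho h^-1%g v) + (pi g (rho h^-1%g v) - rho g (rho h^-1%g v)).
    by rewrite linearB addrA subrK.
  apply: le_trans (nrmD _ _) _; rewrite unitary_nrm//.
  apply: le_trans (lerD (hV v) (hg1 _)) _.
  have h1 : Cg * eps * nrm (rho h^-1%g v) <= Cg * eps * (2 * nrm v).
    by rewrite ler_wpM2l ?mulr_ge0.
  have h2 : 0 <= 2 * Ch * (1 + Cg) * eps * nrm v.
    by rewrite !mulr_ge0 ?nrm_ge0//; lra.
  by lra.
rewrite cb (cocycleV h cb) linearN.
set u := rho h^-1%g (b h).
have hu : nrm u <= 2 * (Ch * M).
  by apply: le_trans (b2 _) _; rewrite ler_pM2l ?ltr0n// hh2.
have h1 : nrm (rho g u) <= (1 + Cg) * nrm u.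
  have := hg1 u; have := nrm_distl (rho g u) (pi g u).
  rewrite (unitary_nrm upi) nrmBC ler_norml => /andP[_ h1] h2.
  have h3 : Cg * eps * nrm u <= Cg * 1 * nrm u.
    by rewrite ler_wpM2r ?nrm_ge0// ler_wpM2l.
  lra.
have h2 : (1 + Cg) * nrm u <= (1 + Cg) * (2 * (Ch * M)) by rewrite ler_wpM2l//; lra.
have h3 := hg2 b M cb M0 hM.
have h4 : 0 <= (Cg + 2 * Ch) * M by rewrite mulr_ge0//; lra.
by apply: le_trans (nrmB _ _) _; lra.
Qed.

Lemma cocycle_gen (E : hilbertType R) (pi : representation G E) (b b' : G -> E) :
  cocycle pi b -> cocycle pi b' -> (forall s, s \in S -> b s = b' s) -> b =1 b'.
Proof.
move=> cb cb' bS; apply: (hS (H := fun g => b g = b' g)) => //.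
  by rewrite (cocycle1 cb) (cocycle1 cb').
by move=> g h bg bh; rewrite cb cb' (cocycleV h cb) (cocycleV h cb') bg bh.
Qed.

Lemma coboundary_cocycle (E : hilbertType R) (pi : representation G E) y :
  cocycle pi (fun g => y - pi g y).
Proof. by move=> g h; rewrite repM linearB addrA subrK. Qed.

Hypothesis hT : property_T R G.

Lemma uniform_fixed_point : exists2 C0, 0 <= C0 &
  forall (E : hilbertType R) (pi : representation G E) b M,
    unitary_rep pi -> cocycle pi b -> 0 <= M -> (forall s, s \in S -> nrm (b s) <= M) ->
    exists2 y, forall g, b g = y - pi g y & nrm y <= C0 * M.
Proof.
apply: contrapT => nC.
have bad n : exists x : {E : hilbertType R & (representation G E * (G -> E))%type},
    [/\ unitary_rep (projT2 x).1, cocycle (projT2 x).1 (projT2 x).2,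
        forall s, s \in S -> nrm ((projT2 x).2 s) <= 2^-1 ^+ n &
        forall y, (forall g, (projT2 x).2 g = y - (projT2 x).1 g y) -> 1 < nrm y].
  apply: contrapT => nx; apply: nC; exists (2 ^+ n); first exact: exprn_ge0.
  move=> E pi b M upi cb M0 hM; have [M00|M00] := eqVneq M 0.
    exists 0; last by rewrite nrm0 M00 mulr0.
    apply: (cocycle_gen cb (coboundary_cocycle pi 0)) => s sS.
    rewrite linear0 subr0; apply: nrm_eq0; apply: le_anti.
    by rewrite nrm_ge0 -M00 hM.
  have Mp : 0 < M by rewrite lt_def M00.
  have n0 : 0 < (2 : R) ^+ n by rewrite exprn_gt0.
  apply: contrapT => ny; apply: nx.
  (* This scaling brings the cocycle to size 2^-n on S, while every solution keeps norm above 1. *)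
  pose c : R := (2 ^+ n * M)^-1; have c0 : 0 < c by rewrite invr_gt0 mulr_gt0.
  have nc : nrm c%:C = c by rewrite nrm_real gtr0_norm.
  exists (existT _ E (pi, fun g => c%:C *: b g)); split=> //=.
  - by move=> g h /=; rewrite cb scalerDr linearZ.
  - move=> s sS; rewrite nrmZ nc; apply: le_trans (ler_wpM2l (ltW c0) (hM s sS)) _.
    by rewrite /c invfM exprVn -mulrA mulVf ?mulr1// gt_eqF.
  move=> y hy; rewrite ltNge; apply/negP => y1; apply: ny.
  exists (c^-1%:C *: y) => [g|].
    rewrite linearZ -scalerBr -hy scalerA -rcM mulVf ?scale1r// gt_eqF//.
  have cV : c^-1 = 2 ^+ n * M by rewrite /c invrK.
  have cV0 : 0 < 2 ^+ n * M by rewrite mulr_gt0.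
  by rewrite nrmZ nrm_real cV gtr0_norm// -[leRHS]mulr1 ler_pM2l.
have [x hx] := choice bad.
pose E_ n := projT1 (x n); pose pi_ n : representation G (E_ n) := (projT2 (x n)).1.
pose b_ n : G -> E_ n := (projT2 (x n)).2.
have upi n : unitary_rep (pi_ n) by have [] := hx n.
have cb n : cocycle (pi_ n) (b_ n) by have [] := hx n.
have sb n s : s \in S -> nrm (b_ n s) <= 2^-1 ^+ n by have [_ _ + _] := hx n; apply.
have nob n y : (forall g, b_ n g = y - pi_ n g y) -> 1 < nrm y.
  by have [_ _ _] := hx n; apply.
have [H [pi [i [p ds]]]] := direct_sum upi.
(* Smallness is known on S only; word control with rho = pi and eps = 0 carries it to each g, so the
   summed cocycle converges there. *)
have bb g : exists C, forall n, nrm (b_ n g) <= C * 2^-1 ^+ n.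
  have [C [e0 [C0 e00 ctl]]] := word_control g; exists C => n.
  have [|s sS v|_ +] := ctl _ (pi_ n) (pi_ n) 0 (upi n).
  - by rewrite lexx ltW.
  - by rewrite subrr nrm0 mul0r.
  by move=> h; apply: h => [||s sS]; [exact: cb | exact: ltW (half_exp_gt0 _ _) | exact: sb].
have bex g : exists z, gcvg (fun n => \sum_(m < n) i m (b_ m g)) z /\
    forall n, p n z = b_ n g.
  have [C hC] := bb g; have [z z1 z2] := direct_sum_series ds hC.
  by exists z.
have [b hb] := choice bex.
have [upi' [ie pe] [ii pp] _ p0] := ds.
have cbb : cocycle pi b.
  move=> g h; have [h1 _] := hb (g * h)%g; apply: (gcvg_uniq h1).
  have lip u v : nrm (pi g u - pi g v) <= 1 * nrm (u - v).
    by rewrite mul1r -linearB unitary_nrm.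
  have := gcvgD (hb g).1 (gcvg_lip lip (hb h).1); congr gcvg; apply/funext => n.
  rewrite linear_sum -big_split; apply: eq_bigr => m _ /=.
  by rewrite cb linearD ie.
have [y hy] := bounded_fixed_point upi' cbb (property_T_bounded upi' cbb hT).
have [N hN] := p0 y 1 ltr01.
have := hN N (leqnn N); rewrite leNgt => /negP; apply; apply: nob => g.
by rewrite -(hb g).2 hy linearB pe.
Qed.

End control.

(** * Contractible realizations and simplicial cocycles *)

Section lebesgue_number.
Variable R : realType.

Let dist_half (a b c d e : R) :
  `|a - b| < d / 2 -> `|b - c| <= e -> e < d / 2 -> `|a - c| < d.
Proof.
move=> ab bc ed; rewrite -[a - c](subrKA b); apply: le_lt_trans (ler_normD _ _) _.
lra.
Qed.

(** Compactness in near-covering form gives one N for the whole square. Half of each local radius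
    goes to moving the centre, the other half to the size of a cell. *)
Lemma square_lebesgue_number (V : Type) (P : V -> R -> R -> Prop) :
  (forall s t : R, 0 <= s <= 1 -> 0 <= t <= 1 -> exists v, exists2 d, 0 < d &
     forall s' t', `|s - s'| < d -> `|t - t'| < d -> P v s' t') ->
  exists2 N : nat, (0 < N)%N & forall s t : R, 0 <= s <= 1 -> 0 <= t <= 1 ->
    exists v, forall s' t', `|s - s'| <= N%:R^-1 -> `|t - t'| <= N%:R^-1 -> P v s' t'.
Proof.
move=> loc.
have cpt : compact (`[0, 1]%classic `*` `[0, 1]%classic : set (R * R)).
  by apply: compact_setX; exact: segment_compact.
move/compact_near_coveringP : cpt => /(_ nat \oo (fun N q => exists v,
  forall s' t', `|q.1 - s'| <= N.+1%:R^-1 -> `|q.2 - t'| <= N.+1%:R^-1 -> P v s' t')).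
case.
  move=> [s t] [/= s01 t01].
  have [||v [d d0 hd]] := loc s t.
  - by move: s01; rewrite in_itv.
  - by move: t01; rewrite in_itv.
  have d2 : 0 < d / 2 by lra.
  have near_inv : \forall N \near \oo, N.+1%:R^-1 < d / 2.
    exact: near_infty_natSinv_lt (PosNum d2).
  exists (ball (s, t) (d / 2), [set N | N.+1%:R^-1 < d / 2]).
    by split => //=; exact: nbhsx_ballx.
  move=> [[s1 t1] N] /= [[b1 b2] Nd]; exists v => s' t' hs ht.
  have {}b1 : `|s - s1| < d / 2 by move: b1; rewrite -ball_normE.
  have {}b2 : `|t - t1| < d / 2 by move: b2; rewrite -ball_normE.
  by apply: hd; [exact: dist_half b1 hs Nd | exact: dist_half b2 ht Nd].
move=> N _ hN; exists N.+1 => // s t s01 t01.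
by apply: (hN N (leqnn N) (s, t)); split; rewrite /= in_itv.
Qed.

End lebesgue_number.

Section realization_theory.
Variables (R : realType) (V : choiceType) (X : simplicial_complex V).
Local Notation T := (realization R X).
Local Notation bary x := (val (x : T) : V -> R).

Lemma star_open (v : V) : open [set x : T | 0 < bary x v].
Proof.
move=> s x Xs sx /= xv; exists (bary x v) => // y sy /(_ v).
by have := ler_norm (bary x v - bary y v); rewrite /=; lra.
Qed.

Lemma support_simplex (x : T) : exists2 s, X s & forall v, 0 < bary x v -> v \in s.
Proof.
have [s Xs [x0 xs x1]] := set_mem (valP x); exists s => // v xv.
by apply: contraLR xv => /xs ->; rewrite ltxx.
Qed.

Lemma support_neq0 (x : T) : exists v, 0 < bary x v.
Proof.
have [s Xs [x0 xs x1]] := set_mem (valP x); apply: contrapT => h.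
have : \sum_(v <- s) bary x v = 0.
  apply: big1 => v _; apply/eqP; rewrite eq_le x0 andbT leNgt; apply/negP => xv.
  by apply: h; exists v.
by rewrite x1 => /eqP; rewrite oner_eq0.
Qed.

(** Clamping extends edge paths to the whole line, so their continuity needs no subspace
    topology. *)
Definition clamp (s : R) : R := Num.max 0 (Num.min 1 s).

Lemma clamp_itv s : 0 <= clamp s <= 1.
Proof. by rewrite /clamp le_max lexx ge_max ler01 ge_min lexx. Qed.

Lemma clampE s : 0 <= s <= 1 -> clamp s = s.
Proof. by move=> /andP[s0 s1]; rewrite /clamp min_r// max_r. Qed.

Lemma clamp_cases s :
  [\/ s <= 0 /\ clamp s = 0, 0 <= s <= 1 /\ clamp s = s | 1 <= s /\ clamp s = 1].
Proof.
have [s0|s0] := leP s 0.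
  by constructor 1; rewrite /clamp max_l// ge_min s0 orbT.
have [s1|s1] := leP s 1; first by constructor 2; rewrite clampE ltW.
by constructor 3; rewrite /clamp min_l ?max_r// ltW.
Qed.

Lemma clamp_dist s t : `|clamp s - clamp t| <= `|s - t|.
Proof.
have h1 := ler_norm (s - t); have h2 := ler_norm (t - s); rewrite distrC in h2.
rewrite ler_norml; case: (clamp_cases s) => -[hs ->]; case: (clamp_cases t) => -[ht ->];
  lra.
Qed.

Definition edge_point (u w : V) (s : R) : V -> R :=
  fun v => (1 - clamp s) * (v == u)%:R + clamp s * (v == w)%:R.

Lemma sum_indicator (s : {fset V}) u : u \in s -> \sum_(v <- s) (v == u)%:R = 1 :> R.
Proof.
move=> us; rewrite (bigD1_seq u) ?fset_uniq//= eqxx big1 ?addr0// => v.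
by move=> /negbTE ->.
Qed.

Lemma edge_point_mem u w s : X [fset u; w]%fset -> edge_point u w s \in @barycentric R V X.
Proof.
move=> Xuw; apply/mem_set; exists [fset u; w]%fset => //; split.
- move=> v; have /andP[c0 c1] := clamp_itv s.
  by apply: addr_ge0; apply: mulr_ge0; rewrite ?ler0n ?subr_ge0.
- move=> v; rewrite !inE negb_or => /andP[/negbTE vu /negbTE vw].
  by rewrite /edge_point vu vw !mulr0 addr0.
- rewrite /edge_point big_split /= -!mulr_sumr !sum_indicator ?inE ?eqxx ?orbT//.
  by rewrite !mulr1 subrK.
Qed.

Definition edge_path u w (h : X [fset u; w]%fset) s : T := SigSub (edge_point_mem s h).

(** The path stays in one closed simplex, on which the coherent topology is Euclidean. *)
Lemma edge_path_continuous u w (h : X [fset u; w]%fset) : continuous (edge_path h).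
Proof.
move=> s A; rewrite nbhsE => -[U [oU Us] UA].
have Xc : carried [fset u; w]%fset (edge_path h s).
  move=> v; rewrite !inE negb_or => /andP[/negbTE vu /negbTE vw].
  by rewrite /= /edge_point vu vw !mulr0 addr0.
have [d d0 hd] := oU _ _ h Xc Us.
apply/nbhs_ballP; exists d => // t; rewrite -ball_normE /= => st.
apply/UA/hd => [v|v].
  rewrite !inE negb_or => /andP[/negbTE vu /negbTE vw].
  by rewrite /= /edge_point vu vw !mulr0 addr0.
apply: le_lt_trans st; apply: le_trans (clamp_dist s t).
rewrite /= /edge_point; have := normr_ge0 (clamp s - clamp t).
have -> : (1 - clamp s) * (v == u)%:R + clamp s * (v == w)%:R -
  ((1 - clamp t) * (v == u)%:R + clamp t * (v == w)%:R) =
  (clamp s - clamp t) * ((v == w)%:R - (v == u)%:R) by ring.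
case: (v == u) (v == w) => [] [] /= c0; rewrite ?subrr ?mulr0 ?normr0 ?subr0 ?sub0r//.
- by rewrite mulrN1 normrN.
- by rewrite mulr1.
Qed.

End realization_theory.

(** * Sums of a cocycle along paths in the realization *)

Section path_lifting.
Variables (R : realType) (V : choiceType) (X : simplicial_complex V).
Variables (E : zmodType) (z : V -> V -> E).
Local Notation T := (realization R X).
Local Notation bary x := (val (x : T) : V -> R).

Hypothesis zM : forall s u v w, X s -> u \in s -> v \in s -> w \in s ->
  z u v + z v w = z u w.

Lemma simplicial_zM (x : T) u v w : 0 < bary x u -> 0 < bary x v -> 0 < bary x w ->
  z u v + z v w = z u w.
Proof.
by have [s Xs h] := support_simplex x; move=> /h us /h vs /h ws; exact: zM Xs us vs ws.
Qed.

Lemma simplicial_z0 u : z u u = 0.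
Proof.
have uu : u \in [fset u]%fset by rewrite inE.
have := zM (simplex_vertex X u) uu uu uu.
by move=> /(canRL (addrK _)); rewrite subrr.
Qed.

Section chain.
Variables (gam : R -> T) (w0 : V).
Hypothesis gam1 : 0 < bary (gam 1) w0.

(* [lift_chain t v a]: the path [gam] restricted to [t, 1] is covered by a
   sequence of open stars starting with that of [v] and ending with that of
   [w0], and [a] is the sum of [z] along the corresponding edge path. *)
Inductive lift_chain : R -> V -> E -> Prop :=
| lift_end : lift_chain 1 w0 0
| lift_step t t' v v' a : t <= t' -> t' <= 1 ->
    (forall r, t <= r <= t' -> 0 < bary (gam r) v) -> lift_chain t' v' a ->
    lift_chain t v (z v v' + a).

Lemma lift_chain_star t v a : lift_chain t v a -> t <= 1 /\ 0 < bary (gam t) v.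
Proof.
case=> [|{}t t' {}v v' {}a tt' t'1 h _]; first by [].
by split; [exact: le_trans t'1 | apply: h; rewrite lexx].
Qed.

Lemma lift_chain_last v a : lift_chain 1 v a -> a = z v w0.
Proof.
move Et : 1 => t c; elim: c Et => [|{}t t' {}v v' {}a tt' t'1 h c IH] t1.
  by rewrite simplicial_z0.
have t'E : 1 = t' by lra.
rewrite (IH t'E); apply: (@simplicial_zM (gam 1)) => //.
  by apply: h; lra.
by rewrite t'E; have [] := lift_chain_star c.
Qed.

(** Two chains over the same path are merged: the one whose first interval ends earlier drops it,
    and the other chain is restarted at that point, which lies in all the stars involved. This is a
    double induction on the chains. *)
Lemma lift_chain_uniq t v a v' a' :
  lift_chain t v a -> lift_chain t v' a' -> a = z v v' + a'.
Proof.
move=> c; elim: c v' a' => [v' a'|{}t t1 {}v v1 {}a tt1 t11 h c IH v' a' c'].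
  move=> c'; rewrite (lift_chain_last c'); have [_ v'0] := lift_chain_star c'.
  by rewrite (@simplicial_zM (gam 1)) ?simplicial_z0.
elim: c' tt1 h => [|{}t t1' {}v' v1' {}a' tt1' t1'1 h' c' IH'] tt1 h.
  have t1E : t1 = 1 by lra.
  have c1 : lift_chain t1 w0 0 by rewrite t1E; exact: lift_end.
  rewrite (IH _ _ c1) !addr0; apply: (@simplicial_zM (gam 1)) => //.
    by apply: h; rewrite tt1 -t1E lexx.
  by rewrite -t1E; have [] := lift_chain_star c.
have [_ v1t1] := lift_chain_star c.
have [_ v1t1'] := lift_chain_star c'.
have [t1t1'|t1't1] := leP t1 t1'.
  have c1 : lift_chain t1 v' (z v' v1' + a').
    by apply: lift_step c' => // r /andP[r1 r2]; apply: h'; rewrite r2 (le_trans tt1).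
  rewrite (IH _ _ c1) addrA (@simplicial_zM (gam t1))//.
    by apply: h; rewrite tt1 lexx.
  by apply: h'; rewrite tt1.
rewrite IH' ?ltW//; last first.
  by move=> r /andP[r1 r2]; apply: h; rewrite r2 (le_trans tt1').
rewrite addrA (@simplicial_zM (gam t1'))//.
  by apply: h; rewrite tt1' ltW.
by apply: h'; rewrite tt1' lexx.
Qed.

Lemma lift_chain_rel (Q : V -> V -> Prop) t v a :
  (forall u, Q u u) -> (forall u v w, Q u v -> Q v w -> Q u w) ->
  (forall s u v, X s -> u \in s -> v \in s -> Q u v) ->
  lift_chain t v a -> Q v w0.
Proof.
move=> Q0 QM QX; elim=> [|{}t t' {}v v' {}a tt' t'1 h c IH]; first exact: Q0.
apply: QM IH; have [s Xs hs] := support_simplex (gam t').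
apply: (QX s) => //; apply: hs; last by have [] := lift_chain_star c.
by apply: h; rewrite tt' lexx.
Qed.

End chain.

Section contraction.
Variables (p : T) (H : T * R -> T) (w0 : V).
Hypothesis H_cont : {within [set: T] `*` `[0, 1], continuous H}.
Hypothesis H0 : forall x, H (x, 0) = x.
Hypothesis H1 : forall x, H (x, 1) = p.
Hypothesis pw0 : 0 < bary p w0.

Lemma homotopy_star (c : R -> T) (s t : R) : continuous c -> 0 <= t <= 1 ->
  exists v, exists2 d, 0 < d & forall s' t', `|s - s'| < d -> `|t - t'| < d ->
    0 <= t' <= 1 -> 0 < bary (H (c s', t')) v.
Proof.
move=> cc t01; have [v hv] := support_neq0 (H (c s, t)); exists v.
have At : ([set: T] `*` `[0, 1]) (c s, t) by split; rewrite //= in_itv.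
have := iffLR (subspace_continuousP _ _) H_cont _ At.
move=> /(_ _ (open_nbhs_nbhs (conj (@star_open R V X v) hv))).
move=> [[P Q] /= [nP nQ] PQ].
have /nbhs_ballP[d1 d10 hd1] := cc s _ nP.
have /nbhs_ballP[d2 d20 hd2] := nQ.
exists (Num.min d1 d2); first by rewrite lt_min; apply/andP.
move=> s' t'; rewrite !lt_min => /andP[ss' _] /andP[_ tt'] t'01.
apply: (PQ (c s', t')) => /=.
  by split; [apply: hd1|apply: hd2]; rewrite -ball_normE.
by split; rewrite //= in_itv.
Qed.

Lemma homotopy_grid u w (h : X [fset u; w]%fset) :
  exists2 N : nat, (0 < N)%N & forall s t, 0 <= s <= 1 -> 0 <= t <= 1 ->
    exists v, forall s' t', `|s - s'| <= N%:R^-1 -> `|t - t'| <= N%:R^-1 ->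
      0 <= t' <= 1 -> 0 < bary (H (edge_path h s', t')) v.
Proof.
apply: (@square_lebesgue_number R V
  (fun v s t => 0 <= t <= 1 -> 0 < bary (H (edge_path h s, t)) v)) => s t _ t01.
have [v [d d0 hd]] := homotopy_star s (edge_path_continuous (h := h)) t01.
by exists v, d.
Qed.

(** The vertex u is taken as a point of the degenerate edge from u to u, so that vertices and edges
    are handled by the same lemmas. *)
Definition vertex_path (u : V) (t : R) : T :=
  H (edge_path (eq_ind_r X (simplex_vertex X u) (fsetUid [fset u]%fset)) 0, t).

Lemma edge_path0 u w (h : X [fset u; w]%fset) t : H (edge_path h 0, t) = vertex_path u t.
Proof.
congr (H (_, _)); apply/val_inj/funext => v /=; rewrite /edge_point clampE ?lexx ?ler01//.
by rewrite !mul0r.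
Qed.

Lemma edge_path1 u w (h : X [fset u; w]%fset) t : H (edge_path h 1, t) = vertex_path w t.
Proof.
congr (H (_, _)); apply/val_inj/funext => v /=; rewrite /edge_point !clampE ?lexx ?ler01//.
by rewrite subrr subr0 !mul0r add0r addr0.
Qed.

(* The homotopy [H] is applied to the edge [u w]; a fine grid on the square has
   each of its cells sent into an open star, and neighbouring columns of the grid
   give chains with compatible sums. *)
Lemma edge_lift u w (h : X [fset u; w]%fset) : exists a b,
  [/\ lift_chain (vertex_path u) w0 0 u a,
      lift_chain (vertex_path w) w0 0 w b & a = z u w + b].
Proof.
have [N N0 hN] := homotopy_grid h.
pose x (k : nat) : R := k%:R / N%:R.
have NR : 0 < N%:R :> R by rewrite ltr0n.
have x01 k : (k <= N)%N -> 0 <= x k <= 1.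
  by move=> kN; rewrite divr_ge0//= ler_pdivrMr// mul1r ler_nat.
have xS k : x k.+1 = x k + N%:R^-1 by rewrite /x -natr1 mulrDl mul1r.
have x0 : x 0 = 0 by rewrite /x mul0r.
have xN : x N = 1 by rewrite /x divff// gt_eqF.
have Ni : 0 <= N%:R^-1 :> R by rewrite invr_ge0 ler0n.
pose K i t := H (edge_path h (x i), t).
have ex i j : exists v, (i <= N)%N -> (j <= N)%N ->
    forall s' t', `|x i - s'| <= N%:R^-1 -> `|x j - t'| <= N%:R^-1 ->
      0 <= t' <= 1 -> 0 < bary (H (edge_path h s', t')) v.
  case: (leqP i N) => iN; last by exists u.
  case: (leqP j N) => jN; last by exists u.
  by have [v hv] := hN _ _ (x01 i iN) (x01 j jN); exists v.
have [v_ hv_] := choice (fun ij : nat * nat => ex ij.1 ij.2).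
pose v i j := v_ (i, j).
have hv i j := hv_ (i, j); rewrite /= in hv.
have dist0 k : `|x k - x k| <= N%:R^-1 by rewrite subrr normr0.
have dist1 k : `|x k.+1 - x k| <= N%:R^-1 by rewrite xS addrAC subrr add0r ger0_norm.
have dist1' k : `|x k - x k.+1| <= N%:R^-1 by rewrite distrC.
(* [A i k] is the sum over column i from height x (N - k) up to 1; k counts from the top because
   chains are built backwards from time 1. *)
pose fix A i k := if k is k'.+1 then z (v i (N - k)%N) (v i (N - k')%N) + A i k'
  else z (v i N) w0.
have chainA i k : (i <= N)%N -> (k <= N)%N ->
    lift_chain (K i) w0 (x (N - k)%N) (v i (N - k)%N) (A i k).
  move=> iN; elim: k => [_|k IH kN] /=.
    rewrite subn0 xN -[z _ _]addr0; apply: lift_step (lift_end _ _) => // r r1.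
    have -> : r = 1 by lra.
    by apply: hv => //; [rewrite xN subrr normr0|rewrite ler01 lexx].
  have Nk : (N - k = (N - k.+1).+1)%N by rewrite subnSK.
  apply: lift_step (IH (ltnW kN)).
  - by rewrite Nk xS; lra.
  - by have /andP[] := x01 (N - k)%N (leq_subr _ _).
  move=> r /andP[r1 r2]; apply: hv => //; first exact: leq_subr.
    by rewrite ler_norml; move: r2; rewrite Nk xS => r2; lra.
  have /andP[? _] := x01 (N - k.+1)%N (leq_subr _ _).
  have /andP[_ ?] := x01 (N - k)%N (leq_subr _ _).
  by apply/andP; split; lra.
(* At height 1 the homotopy is constant, in the star of [w0]. Below, the four stars at the corners
   of a cell share the point [y], so both ways around the cell give the same sum. *)
have compare i k : (i < N)%N -> (k <= N)%N ->
    A i k = z (v i (N - k)%N) (v i.+1 (N - k)%N) + A i.+1 k.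
  move=> iN; have iN' := ltnW iN; elim: k => [_|k IH kN] /=.
    rewrite subn0; have ab : 0 <= (1 : R) <= 1 by rewrite ler01 lexx.
    rewrite (@simplicial_zM (K i 1))//.
    - by apply: hv; rewrite ?xN ?subrr ?normr0.
    - by apply: hv; rewrite ?xN ?subrr ?normr0.
    - by rewrite /K H1.
  have Nk : (N - k = (N - k.+1).+1)%N by rewrite subnSK.
  rewrite (IH (ltnW kN)) !addrA; congr (_ + _).
  have kN' : ((N - k.+1) <= N)%N by rewrite leq_subr.
  have kN'' : ((N - k) <= N)%N by rewrite leq_subr.
  have ab := x01 _ kN'.
  pose y := K i (x (N - k.+1)%N).
  have y1 : 0 < bary y (v i (N - k.+1)%N) by apply: hv.
  have y2 : 0 < bary y (v i (N - k)%N) by apply: hv; rewrite // Nk.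
  have y3 : 0 < bary y (v i.+1 (N - k.+1)%N) by apply: hv.
  have y4 : 0 < bary y (v i.+1 (N - k)%N) by apply: hv; rewrite // Nk.
  by rewrite !(@simplicial_zM y).
have zz : 0 <= (0 : R) <= 1 by rewrite lexx ler01.
have vpos i : (i <= N)%N -> 0 < bary (edge_path h (x i)) (v i 0).
  by move=> iN; rewrite -(H0 (edge_path h (x i))); apply: hv; rewrite ?x0 ?subrr ?normr0.
(* At height 0 the homotopy is the identity, so the stars met there are those of u and w. *)
have top i : (i <= N)%N -> v i 0 \in [fset u; w]%fset.
  move=> /vpos; apply: contraTT; rewrite !inE negb_or => /andP[/negbTE vu /negbTE vw].
  by rewrite /= /edge_point vu vw !mulr0 addr0 ltxx.
have v0u : v 0 0 = u.
  have := vpos 0 (leq0n N); rewrite /= x0 /edge_point clampE// mul0r addr0 subr0 mul1r.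
  by case: eqP => //; rewrite ltxx.
have vNw : v N 0 = w.
  have := vpos N (leqnn N); rewrite /= xN /edge_point clampE ?lexx ?ler01// subrr mul0r add0r mul1r.
  by case: eqP => //; rewrite ltxx.
have tele i : (i <= N)%N -> A 0 N = z (v 0 0) (v i 0) + A i N.
  elim: i => [_|i IH iN]; first by rewrite simplicial_z0 add0r.
  rewrite (IH (ltnW iN)) (compare i N iN (leqnn N)) subnn addrA; congr (_ + _).
  by apply: (zM h); apply: top => //; exact: ltnW.
exists (A 0 N), (A N N); split.
- have := chainA 0 N (leq0n _) (leqnn _); rewrite subnn x0 v0u.
  by congr (lift_chain _ _ _ _ _); apply/funext => t; rewrite /K x0 edge_path0.
- have := chainA N N (leqnn _) (leqnn _); rewrite subnn x0 vNw.
  by congr (lift_chain _ _ _ _ _); apply/funext => t; rewrite /K xN edge_path1.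
- by rewrite (tele N (leqnn N)) v0u vNw.
Qed.

End contraction.

Hypothesis contrX : contractible R T.

(** F u is the sum of z along the track of u under the contraction; the tracks of two adjacent
    vertices bound the image of a square. *)
Theorem simplicial_cocycle_exact : exists F : V -> E,
  forall u w, X [fset u; w]%fset -> z u w = F u - F w.
Proof.
have [p [H [Hc H0 H1]]] := contrX; have [w0 pw0] := support_neq0 p.
have g1 u : 0 < bary (vertex_path H u 1) w0 by rewrite /vertex_path H1.
have ex u : exists a, lift_chain (vertex_path H u) w0 0 u a.
  have [|a [b [ca _ _]]] := edge_lift Hc H0 H1 pw0 (u := u) (w := u).
    by rewrite fsetUid; exact: simplex_vertex.
  by exists a.
have [F hF] := choice ex; exists F => u w h.
have [a [b [ca cb ab]]] := edge_lift Hc H0 H1 pw0 h.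
rewrite (lift_chain_uniq (g1 u) (hF u) ca) (lift_chain_uniq (g1 w) (hF w) cb).
by rewrite !simplicial_z0 !add0r ab addrK.
Qed.

End path_lifting.

Theorem simplicial_connected (R : realType) (V : choiceType) (X : simplicial_complex V)
    (Q : V -> V -> Prop) : contractible R (realization R X) ->
  (forall u, Q u u) -> (forall u v, Q u v -> Q v u) ->
  (forall u v w, Q u v -> Q v w -> Q u w) ->
  (forall s u v, X s -> u \in s -> v \in s -> Q u v) ->
  forall u v, Q u v.
Proof.
move=> [p [H [Hc H0 H1]]] Q0 QC QM QX; have [w0 pw0] := support_neq0 p.
(* For the zero cocycle a chain is just an edge path ending at [w0]. *)
have Qw u : Q u w0.
  have [|a [b [ca _ _]]] := edge_lift (E := int) (z := fun _ _ => 0)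
      (fun _ _ _ _ _ _ _ _ => addr0 0) Hc H0 H1 pw0 (u := u) (w := u).
    by rewrite fsetUid; exact: simplex_vertex.
  apply: (lift_chain_rel _ Q0 QM QX ca).
  by rewrite /vertex_path H1.
by move=> u v; apply: (QM _ w0) => //; exact: QC.
Qed.

(** * An open mapping theorem *)

Section open_mapping.
Variables (R : realType) (J : Type) (E : completeNormedModType R[i]) (W : lmodType R[i]).
(* [A] is a closed subspace of [W], [bd x M] reads |x| <= M, and the image of [A]
   under [T] is closed for pointwise convergence. *)
Variables (A : W -> Prop) (T : W -> J -> E) (bd : W -> R -> Prop).
Hypothesis A0 : A 0.
Hypothesis A_lin : forall a x y, A x -> A y -> A (a *: x + y).
Hypothesis T_lin : forall a x y j, T (a *: x + y) j = a *: T x j + T y j.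
Hypothesis bd0 : bd 0 0.
Hypothesis bdW : forall x M M', M <= M' -> bd x M -> bd x M'.
Hypothesis bd_lin : forall a x y M M', bd x M -> bd y M' -> bd (a *: x + y) (nrm a * M + M').
Hypothesis A_bd : forall x, A x -> exists M, bd x M.
Hypothesis A_complete : forall (x : nat -> W) C, (forall n, A (x n)) ->
  (forall n, bd (x n.+1 - x n) (C * 2^-1 ^+ n)) ->
  exists y, [/\ A y, forall j, gcvg (fun n => T (x n) j) (T y j) &
                forall M, (forall n, bd (x n) M) -> bd y M].
Hypothesis T_closed : forall (x : nat -> W) (y : J -> E), (forall n, A (x n)) ->
  (forall j, gcvg (fun n => T (x n) j) (y j)) -> exists2 x', A x' & forall j, T x' j = y j.

Let AB x y : A x -> A y -> A (x - y).
Proof. by move=> Ax Ay; rewrite addrC -scaleN1r; exact: A_lin. Qed.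

Let TB x y j : T (x - y) j = T x j - T y j.
Proof. by rewrite addrC -scaleN1r T_lin scaleN1r addrC. Qed.

Let AZ a x : A x -> A (a *: x).
Proof. by move=> Ax; rewrite -[_ *: _]addr0; exact: A_lin. Qed.

Let T0 j : T 0 j = 0.
Proof. by rewrite -(subrr 0) TB subrr. Qed.

Let TZ a x j : T (a *: x) j = a *: T x j.
Proof. by rewrite -[a *: x]addr0 T_lin T0 addr0. Qed.

Let bdB x y M M' : bd x M -> bd y M' -> bd (x - y) (M + M').
Proof.
move=> bx by_; have -> : x - y = (-1) *: y + x by rewrite scaleN1r addrC.
have n1 : nrm (-1 : R[i]) = 1 by rewrite nrmN /nrm normr1.
by have := bd_lin (-1) by_ bx; rewrite n1 mul1r [M' + M]addrC.
Qed.

Let bdZ a x M : bd x M -> bd (a *: x) (nrm a * M).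
Proof. by move=> bx; rewrite -[_ *: _]addr0 -[_ * _]addr0; exact: bd_lin. Qed.

Let cancel_mid (a b c d : E) : a + b - c - (b - d) = a - (c - d).
Proof.
by rewrite (addrAC a b (- c)) !opprB (addrC d (- b)) addrA addrK -addrA [- c + d]addrC.
Qed.

Let close x y r := forall j, nrm (T x j - T y j) <= r.

(* Baire's theorem for the image of [A], whose completeness is [T_closed]. *)
Let category : exists (n : nat) x0 r, [/\ A x0, 0 < r &
  forall x, A x -> close x x0 r -> forall e, 0 < e ->
    exists y, [/\ A y, bd y n%:R & close x y e]].
Proof.
apply: contrapT => no.
(* If no ball works, each ball contains one of at most half its radius that misses the images of all
   vectors bounded by the stage n; q holds the stage, the centre and the radius. *)
have step (q : nat * (W * R)) : exists q' : W * R, A q.2.1 -> 0 < q.2.2 ->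
    [/\ A q'.1, 0 < q'.2 <= q.2.2 / 2, close q'.1 q.2.1 (q.2.2 / 2) &
     forall y, A y -> bd y q.1%:R -> ~ close q'.1 y q'.2].
  case: q => n [x0 r] /=.
  have [Ax0|] := pselect (A x0); last by exists (0, 0).
  have [r0|] := ltP 0 r; last by exists (0, 0).
  apply: contrapT => h; apply: no; exists n, x0, (r / 2); split=> //; first lra.
  move=> x Ax xx0 e e0; apply: contrapT => h'; apply: h.
  exists (x, Num.min (r / 2) e); move=> _ _; split=> //=.
    by rewrite lt_min ge_min lexx e0 !andbT; lra.
  move=> y Ay by_ xy; apply: h'; exists y; split=> // j.
  by apply: le_trans (xy j) _; rewrite ge_min lexx orbT.
have [next hn] := choice step.
pose fix q n := if n is n'.+1 then next (n', q n') else (0 : W, 1 : R).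
have qP n : A (q n).1 /\ 0 < (q n).2.
  elim: n => [|n [IH1 IH2]] //=.
  by have [h1 /andP[h2 _] _ _] := hn (n, q n) IH1 IH2.
pose x n := (q n).1; pose r n := (q n).2.
have r_half n : r n.+1 <= r n / 2.
  by have [_ /andP[_ h] _ _] := hn (n, q n) (qP n).1 (qP n).2.
have x_close n : close (x n.+1) (x n) (r n / 2).
  by have [_ _ h _] := hn (n, q n) (qP n).1 (qP n).2.
have avoid n y : A y -> bd y n%:R -> ~ close (x n.+1) y (r n.+1).
  by have [_ _ _] := hn (n, q n) (qP n).1 (qP n).2; apply.
have r_geom n : r n <= 2^-1 ^+ n.
  elim: n => [|n IH]; first by rewrite expr0 lexx.
  by rewrite exprS; apply: le_trans (r_half n) _; lra.
have tail n k j : nrm (T (x (k + n)%N) j - T (x n) j) <= r n - r (k + n)%N.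
  elim: k => [|k IH]; first by rewrite !subrr nrm0.
  rewrite addSn; apply: le_trans (nrm_dist (T (x (k + n)%N) j) _ _) _.
  by have := x_close (k + n)%N j; have := r_half (k + n)%N; lra.
have hex j : exists l, gcvg (fun n => T (x n) j) l.
  apply: (@gcvg_of_cauchy _ _ _ 1) => n; rewrite mul1r.
  by have := x_close n j; have := r_geom n; have := (qP n).2; rewrite -/(r n); lra.
have [y hy] := choice hex.
have [x' Ax' Tx'] := T_closed (fun n => (qP n).1) hy.
have [M bM] := A_bd Ax'.
(* The limit lies in all the nested balls and is the image of some x' in A. As x' is bounded by n,
   the ball of stage n should have missed it. *)
pose n := (Num.truncn M).+1.
have bn : bd x' n%:R by apply: bdW bM; apply/ltW/truncnS_gt.
apply: (avoid n x' Ax' bn) => j; rewrite Tx' nrmBC.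
have hs := gcvgD (gcvg_shift n.+1 (hy j)) (gcvgN (gcvg_cst (T (x n.+1) j))).
apply: (gcvg_bound hs) => k; have := tail n.+1 k j.
by have := (qP (k + n.+1)%N).2; rewrite -/(r _); lra.
Qed.

Lemma open_mapping : exists2 K, 0 <= K & forall x M, A x -> 0 <= M ->
  (forall j, nrm (T x j) <= M) ->
  exists x', [/\ A x', forall j, T x' j = T x j & bd x' (K * M)].
Proof.
have [n [x0 [r [Ax0 r0 hr]]]] := category.
pose K := (n%:R + n%:R) / r; have K0 : 0 <= K by rewrite divr_ge0 ?addr_ge0 ?ler0n// ltW.
(* With c = r / M both x0 + c x and x0 lie in the good ball. Approximating each within c M / 4 and
   dividing the difference by c leaves an error M / 2 at cost 2n / c = K M. *)
have half x M : A x -> 0 < M -> (forall j, nrm (T x j) <= M) ->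
    exists y, [/\ A y, bd y (K * M) & forall j, nrm (T (x - y) j) <= M / 2].
  move=> Ax M0 hx; pose c := r / M; have c0 : 0 < c by rewrite divr_gt0.
  have nc : nrm c%:C = c by rewrite nrm_real gtr0_norm.
  have e0 : 0 < c * M / 4 by rewrite !mulr_gt0 ?invr_gt0.
  have Ax1 : A (c%:C *: x + x0) by exact: A_lin.
  have [|y1 [Ay1 by1 hy1]] := hr _ Ax1 _ _ e0.
    move=> j; rewrite T_lin addrK nrmZ nc.
    by apply: le_trans (ler_wpM2l (ltW c0) (hx j)) _; rewrite /c divfK ?gt_eqF.
  have [|y2 [Ay2 by2 hy2]] := hr _ Ax0 _ _ e0.
    by move=> j; rewrite subrr nrm0 ltW.
  exists (c^-1%:C *: (y1 - y2)); split.
  - by apply: AZ; exact: AB.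
  - have := bdZ c^-1%:C (bdB by1 by2); rewrite nrm_real gtr0_norm ?invr_gt0//.
    by congr bd; rewrite /K /c invf_div; field; rewrite gt_eqF.
  move=> j; rewrite TB TZ TB.
  have -> : T x j - c^-1%:C *: (T y1 j - T y2 j) =
      c^-1%:C *: ((T (c%:C *: x + x0) j - T y1 j) - (T x0 j - T y2 j)).
    rewrite T_lin cancel_mid [RHS]scalerBr scalerA -rcM mulVf ?gt_eqF//.
    by rewrite scale1r.
  rewrite nrmZ nrm_real gtr0_norm ?invr_gt0// mulrC ler_pdivrMr//.
  by apply: le_trans (nrmB _ _) _; have := hy1 j; have := hy2 j; lra.
(* The corrections have sizes K M, K M / 2, K M / 4, and so on, with sum 2 K M. *)
exists (2 * K); first by rewrite mulr_ge0.
move=> x M Ax; rewrite le_eqVlt => /predU1P[<-|M0] hx.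
  exists 0; split=> [//|j|]; last by rewrite mulr0.
  by rewrite T0; apply/esym/nrm_eq0/le_anti; rewrite nrm_ge0 hx.
have step (q : nat * W) : exists y, A q.2 ->
    (forall j, nrm (T q.2 j) <= M * 2^-1 ^+ q.1) ->
    [/\ A y, bd y (K * (M * 2^-1 ^+ q.1)) &
        forall j, nrm (T (q.2 - y) j) <= M * 2^-1 ^+ q.1.+1].
  case: q => k y /=; have [Ay|] := pselect (A y); last by exists 0.
  have [hy|] := pselect (forall j, nrm (T y j) <= M * 2^-1 ^+ k); last by exists 0.
  have Mk : 0 < M * 2^-1 ^+ k by rewrite mulr_gt0 ?half_exp_gt0.
  have [y' [h1 h2 h3]] := half _ _ Ay Mk hy; exists y' => _ _; split=> // j.
  by apply: le_trans (h3 j) _; rewrite exprS; lra.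
have [nx hnx] := choice step.
pose fix u k := if k is k'.+1 then u k' - nx (k', u k') else x.
have uP k : A (u k) /\ forall j, nrm (T (u k) j) <= M * 2^-1 ^+ k.
  elim: k => [|k [IH1 IH2]]; first by split=> // j; rewrite expr0 mulr1.
  by have [h1 h2 h3] := hnx (k, u k) IH1 IH2; split=> //=; exact: AB.
pose s k := x - u k.
have sS k : s k.+1 - s k = nx (k, u k).
  by rewrite /s /= !opprB addrA -(addrA x) subrK addrAC subrr add0r.
have As k : A (s k) by apply: AB => //; exact: (uP k).1.
have [|y [Ay Ty by_]] := @A_complete s (K * M) As.
  move=> k; rewrite sS -mulrA.
  by have [] := hnx (k, u k) (uP k).1 (uP k).2.
exists y; split=> // [j|].
  apply: (gcvg_uniq (Ty j)); exists M => k.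
  by rewrite /s TB opprB addrC subrK; exact: (uP k).2.
apply: by_ => k; apply: (@bdW _ (2 * (K * M) * (1 - 2^-1 ^+ k))).
  rewrite -subr_ge0; have -> : 2 * K * M - 2 * (K * M) * (1 - 2^-1 ^+ k) =
    2 * (K * M) * 2^-1 ^+ k by ring.
  by rewrite mulr_ge0 ?(ltW (half_exp_gt0 _ _))// mulr_ge0// mulr_ge0// ltW.
elim: k => [|k IH]; first by rewrite expr0 subrr mulr0 /s /= subrr.
have -> : s k.+1 = 1 *: s k + nx (k, u k) by rewrite scale1r -sS addrC subrK.
have [_ hb _] := hnx (k, u k) (uP k).1 (uP k).2.
apply: bdW (bd_lin 1 IH hb).
by rewrite /nrm normr1 /= exprS; lra.
Qed.

End open_mapping.

(** * Edge cochains on the universal cover *)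

Lemma fset3_imfset (A B : choiceType) (f : A -> B) (u v w : A) :
  [fset f x | x in [fset u; v; w]]%fset = [fset f u; f v; f w]%fset.
Proof.
apply/fsetP => y; apply/imfsetP/idP => /=.
  by move=> [x]; rewrite !inE => /orP[/orP[]|] /eqP -> ->; rewrite eqxx ?orbT.
rewrite !inE => /orP[/orP[]|] /eqP ->.
- by exists u; rewrite // !inE eqxx.
- by exists v; rewrite // !inE eqxx ?orbT.
- by exists w; rewrite // !inE eqxx ?orbT.
Qed.

Lemma card_fset3 (A : choiceType) (u v w : A) : (#|` [fset u; v; w]%fset| <= 3)%N.
Proof.
apply: leq_trans (leq_card_fsetU _ _).1 _; rewrite cardfs1 addn1 ltnS.
by apply: leq_trans (leq_card_fsetU _ _).1 _; rewrite !cardfs1.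
Qed.

Section simplices.
Variables (R : realType) (G : groupType) (X : EM_cover R G).
Local Notation V := (em_vertex X).
Local Notation deck := (@em_deck R G X).
Local Notation spans u v w := (em_cover X [fset u; v; w]%fset).
Implicit Types u v w : V.

Lemma deckK g : cancel (deck g) (deck g^-1%g).
Proof. by move=> v; rewrite -em_deckM mulVg em_deck1. Qed.

Lemma deck_inj g : injective (deck g).
Proof. exact: can_inj (deckK g). Qed.

Lemma spans_deck g u v w : spans u v w -> spans (deck g u) (deck g v) (deck g w).
Proof. by move=> h; rewrite -fset3_imfset; exact: em_deck_simplex. Qed.

Lemma spans_deckE g u v w : spans (deck g u) (deck g v) (deck g w) <-> spans u v w.
Proof.
split=> [h|]; last exact: spans_deck.
by have := spans_deck g^-1%g h; rewrite !deckK.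
Qed.

(** One lift is chosen for each triple spanning a base simplex. After a deck translation matching
    first vertices, unique lifting at that vertex identifies the two simplices. Repeated vertices
    are allowed, so edges are included. *)
Lemma finite_triples : exists L : seq (V * V * V), forall u v w, spans u v w ->
  exists g, exists2 q, q \in L &
    [/\ u = deck g q.1.1, v = deck g q.1.2 & w = deck g q.2].
Proof.
have [f fE] : exists f : {fset {fset em_base_vertex X}},
    [set s : {fset em_base_vertex X} | em_base X s /\ (#|` s| <= 3)%N] = [set` f].
  exact/finite_fsetP/em_base_finite.
pose W := em_base_vertex X.
have [p [_ [_ _ _]]] := em_contractible X.
have [x0 _] := support_neq0 p.
have exq (c : W * W * W) : exists q : V * V * V,
    (exists u v w, [/\ spans u v w & (em_proj u, em_proj v, em_proj w) = c]) ->
    spans q.1.1 q.1.2 q.2 /\ (em_proj q.1.1, em_proj q.1.2, em_proj q.2) = c.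
  have [[u [v [w [h E]]]]|h] := pselect (exists u v w,
    [/\ spans u v w & (em_proj u, em_proj v, em_proj w) = c]).
    by exists (u, v, w) => _.
  by exists (x0, x0, x0).
have [rep hrep] := choice exq.
pose s0 := flatten (map (@enum_fset _) (enum_fset f)).
pose L0 := [seq (ab, c) | ab <- [seq (a, b) | a <- s0, b <- s0], c <- s0].
exists (map rep L0) => u v w huvw.
have [_ img inj uniq] := em_covering X.
pose B := [fset em_proj u; em_proj v; em_proj w]%fset.
have XB : em_base X B by rewrite /B -fset3_imfset; exact: img.
have Bs0 a : a \in B -> a \in s0.
  move=> aB; apply/flattenP; exists (enum_fset B) => //; apply: map_f.
  have : [set s : {fset em_base_vertex X} | em_base X s /\ (#|` s| <= 3)%N] B.
    by split=> //; exact: card_fset3.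
  by rewrite fE.
pose c := (em_proj u, em_proj v, em_proj w).
have [|hq [pu pv pw]] := hrep c; first by exists u, v, w.
have cL : c \in L0.
  by apply: allpairs_f; first apply: allpairs_f;
    apply: Bs0; rewrite !inE eqxx ?orbT.
have [g gu] := em_deck_trans pu; exists g, (rep c); first exact: map_f.
have qs : spans u (deck g (rep c).1.2) (deck g (rep c).2).
  by rewrite -gu; exact: spans_deck.
have uB : em_proj u \in B by rewrite !inE eqxx.
have [s [_ su]] := uniq u B XB uB.
have s1 : s = [fset u; v; w]%fset.
  by apply: su; split; rewrite ?fset3_imfset// !inE eqxx.
have s2 : s = [fset u; deck g (rep c).1.2; deck g (rep c).2]%fset.
  by apply: su; split; rewrite ?fset3_imfset ?em_deck_proj ?pv ?pw// !inE eqxx.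
have in2 : deck g (rep c).1.2 \in [fset u; v; w]%fset by rewrite -s1 s2 !inE eqxx orbT.
have in3 : deck g (rep c).2 \in [fset u; v; w]%fset by rewrite -s1 s2 !inE eqxx orbT.
split=> //; apply: (inj _ huvw); rewrite ?em_deck_proj ?pv ?pw// !inE eqxx ?orbT//.
Qed.

End simplices.

Section edge_cochains.
Variables (R : realType) (G : groupType) (X : EM_cover R G).
Local Notation V := (em_vertex X).
Local Notation deck := (@em_deck R G X).
Local Notation spans u v w := (em_cover X [fset u; v; w]%fset).
Implicit Types u v w : V.

Definition edge u w : Prop := u <> w /\ em_cover X [fset u; w]%fset.

Definition triangle (q : V * V * V) : Prop :=
  [/\ q.1.1 <> q.1.2, q.1.2 <> q.2, q.1.1 <> q.2 & spans q.1.1 q.1.2 q.2].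

Lemma eq_simplex (s t : {fset V}) : em_cover X t -> s = t -> em_cover X s.
Proof. by move=> h ->. Qed.

Lemma spans2 u w : spans u w w <-> em_cover X [fset u; w]%fset.
Proof.
have -> // : [fset u; w; w]%fset = [fset u; w]%fset.
by apply/fsetP => x; rewrite !inE -orbA orbb.
Qed.

Lemma edge_sym u w : edge u w -> edge w u.
Proof. by move=> [uw h]; split=> [/esym //|]; rewrite fsetUC. Qed.

Lemma edge_deck g u w : edge (deck g u) (deck g w) <-> edge u w.
Proof.
split=> -[uw /spans2 h]; split.
- by move=> e; apply: uw; rewrite e.
- by apply/spans2/(spans_deckE g).
- by move=> /deck_inj.
- by apply/spans2/spans_deckE.
Qed.

Lemma spans_edges u v w : spans u v w ->
  [/\ em_cover X [fset u; v]%fset, em_cover X [fset v; w]%fset & em_cover X [fset u; w]%fset].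
Proof.
have sub a b : a \in [fset u; v; w]%fset -> b \in [fset u; v; w]%fset ->
    spans u v w -> em_cover X [fset a; b]%fset.
  move=> ha hb h; apply: (simplex_sub h).
    by apply/fsubsetP => x; rewrite in_fset2 => /orP[] /eqP ->.
  by apply/fset0Pn; exists a; rewrite !inE eqxx.
by move=> h; split; apply: sub => //; rewrite !inE eqxx ?orbT.
Qed.

Lemma triangle_edges q : triangle q ->
  [/\ edge q.1.1 q.1.2, edge q.1.2 q.2 & edge q.1.1 q.2].
Proof. by move=> [h1 h2 h3 /spans_edges[]]. Qed.

Variables (E : hilbertType R) (pi : representation G E).

(* 1-cochains are represented as functions of all pairs of vertices, zero on
   those that are not edges. *)
Definition edge_cochain (phi : V -> V -> E) : Prop :=
  [/\ forall u w, phi w u = - phi u w,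
      forall g u w, phi (deck g u) (deck g w) = pi g (phi u w)
    & forall u w, ~ edge u w -> phi u w = 0].

Definition edge_diff (phi : V -> V -> E) (q : V * V * V) : E :=
  phi q.1.2 q.2 - phi q.1.1 q.2 + phi q.1.1 q.1.2.

Lemma edge_diff_lin (a : R[i]) (phi psi : V -> V -> E) q :
  edge_diff (a *: phi + psi) q = a *: edge_diff phi q + edge_diff psi q.
Proof.
rewrite /edge_diff -![(_ + _) _ _]/(a *: phi _ _ + psi _ _).
by rewrite opprD (addrACA (a *: phi q.1.2 q.2)) [LHS]addrACA scalerDr scalerBr.
Qed.

Lemma edge_cochain_lin (a : R[i]) (phi psi : V -> V -> E) :
  edge_cochain phi -> edge_cochain psi -> edge_cochain (a *: phi + psi).
Proof.
move=> [a1 e1 o1] [a2 e2 o2]; split.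
- move=> u w; rewrite -![(_ + _) _ _]/(a *: phi _ _ + psi _ _).
  by rewrite a1 a2 scalerN opprD.
- move=> g u w; rewrite -![(_ + _) _ _]/(a *: phi _ _ + psi _ _).
  by rewrite e1 e2 linearD linearZ.
- move=> u w ne; rewrite -![(_ + _) _ _]/(a *: phi _ _ + psi _ _).
  by rewrite o1// o2// scaler0 addr0.
Qed.

Lemma edge_diff_deck phi g u v w : edge_cochain phi ->
  edge_diff phi (deck g u, deck g v, deck g w) = pi g (edge_diff phi (u, v, w)).
Proof. by move=> [_ eq _]; rewrite /edge_diff /= !eq linearD linearB. Qed.

Lemma edge_diff_swap12 phi u v w : edge_cochain phi ->
  edge_diff phi (v, u, w) = - edge_diff phi (u, v, w).
Proof.
move=> [alt _ _]; rewrite /edge_diff /= (alt u v) !opprD opprK.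
by congr (_ + _); exact: addrC.
Qed.

Lemma edge_diff_swap23 phi u v w : edge_cochain phi ->
  edge_diff phi (u, w, v) = - edge_diff phi (u, v, w).
Proof.
move=> [alt _ _]; rewrite /edge_diff /= (alt v w) !opprD opprK.
by rewrite addrAC.
Qed.

Definition ord1_2 : 'I_3 := Ordinal (isT : 1 < 3)%N.

Lemma mk_edge_subproof u w : edge u w ->
  [ffun i : 'I_2 => if i == ord0 then u else w] \in @ordered_simplex V (em_cover X) 1.
Proof.
move=> [uw h]; apply/mem_set.
have inj : injective [ffun i : 'I_2 => if i == ord0 then u else w].
{ move=> i j; rewrite !ffunE.
  case: i j => [[|[|i]] hi] [[|[|j]] hj] //=.
  all: try by move=> _; apply: ord_inj.
  all: by move=> e; exfalso; apply: uw; rewrite e. }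
split; first exact: inj.
apply: (eq_simplex h); apply/fsetP => x; rewrite in_fset2; apply/imfsetP/orP => /=.
  move=> [i _ ->]; rewrite ffunE; case: ifP => _; [left|right]; exact: eqxx.
by move=> [/eqP->|/eqP->]; [exists ord0 | exists ord_max] => //; rewrite ffunE.
Qed.

Definition mk_edge u w (e : edge u w) : ordered_simplex (em_cover X) 1 :=
  SigSub (mk_edge_subproof e).

Lemma mk_triangle_subproof q : triangle q ->
  [ffun i : 'I_3 => if i == ord0 then q.1.1 else if i == ord1_2 then q.1.2 else q.2]
    \in @ordered_simplex V (em_cover X) 2.
Proof.
case: q => [[u v] w] [/= uv vw uw h]; apply/mem_set.
have inj : injective [ffun i : 'I_3 => if i == ord0 then u else if i == ord1_2 then v else w].
{ move=> i j; rewrite !ffunE.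
  case: i j => [[|[|[|i]]] hi] [[|[|[|j]]] hj] //=.
  all: try by move=> _; apply: ord_inj.
  all: move=> e; exfalso.
  all: try by apply: uv; rewrite e.
  all: try by apply: vw; rewrite e.
  all: by apply: uw; rewrite e. }
split; first exact: inj.
apply: (eq_simplex h); apply/fsetP => x; rewrite !inE -orbA; apply/imfsetP/or3P => /=.
  move=> [i _ ->]; rewrite ffunE; case: ifP => _; first by constructor 1.
  by case: ifP => _; [constructor 2|constructor 3].
by move=> [/eqP->|/eqP->|/eqP->]; [exists ord0 | exists ord1_2 | exists ord_max] => //;
  rewrite ffunE.
Qed.

Definition mk_triangle q (t : triangle q) : ordered_simplex (em_cover X) 2 :=
  SigSub (mk_triangle_subproof t).

Definition vertices (s : ordered_simplex (em_cover X) 2) : V * V * V :=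
  (val s ord0, val s ord1_2, val s ord_max).

Lemma vertices_triangle s : triangle (vertices s).
Proof.
have [inj h] := set_mem (valP s); split=> /= [/inj|/inj|/inj|] //.
apply: (eq_simplex h); apply/fsetP => x; rewrite !inE -orbA; apply/or3P/imfsetP => /=.
  by move=> [] /eqP ->; [exists ord0 | exists ord1_2 | exists ord_max].
move=> [[[|[|[|i]]] hi] _ ->] //; [constructor 1|constructor 2|constructor 3];
  by apply/eqP; congr (val s _); apply/val_inj.
Qed.

Lemma vertices_mk q (t : triangle q) : vertices (mk_triangle t) = q.
Proof. by case: q t => [[u v] w] t; rewrite /vertices /= !ffunE. Qed.

Lemma edge1_edge (s : ordered_simplex (em_cover X) 1) : edge (val s ord0) (val s ord_max).
Proof.
have [inj h] := set_mem (valP s); split=> [/inj //|].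
apply: (eq_simplex h); apply/fsetP => x; rewrite in_fset2; apply/orP/imfsetP => /=.
  by move=> [] /eqP ->; [exists ord0 | exists ord_max].
move=> [[[|[|i]] hi] _ ->] //; [left|right];
  by apply/eqP; congr (val s _); apply/val_inj.
Qed.

Definition to_edge (f : ordered_simplex (em_cover X) 1 -> E) u w : E :=
  match pselect (edge u w) with left e => f (mk_edge e) | right _ => 0 end.

Definition of_edge (phi : V -> V -> E) (s : ordered_simplex (em_cover X) 1) : E :=
  phi (val s ord0) (val s ord_max).

Lemma to_edgeE f u w (s : ordered_simplex (em_cover X) 1) :
  val s ord0 = u -> val s ord_max = w -> to_edge f u w = f s.
Proof.
move=> <- <-; rewrite /to_edge; case: pselect => [e|[]]; last exact: edge1_edge.
congr f; apply/val_inj/ffunP => -[[|[|i]] hi] //=; rewrite ffunE /=.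
  by congr (val s _); apply/val_inj.
by congr (val s _); apply/val_inj.
Qed.

Lemma coboundaryE f s : coboundary f s = edge_diff (to_edge f) (vertices s).
Proof.
rewrite /coboundary !big_ord_recl big_ord0 addr0 expr0 scale1r /= /bump /=.
rewrite expr1 scaleN1r expr2 mulrNN mulr1 scale1r /edge_diff addrA.
congr (_ - _ + _); apply/esym/to_edgeE; rewrite /= ffunE; congr (val s _);
  exact/val_inj.
Qed.

Lemma cochain_to_edge f : cochain pi f -> edge_cochain (to_edge f).
Proof.
move=> [alt eqv]; split.
- move=> u w; rewrite {2}/to_edge; case: pselect => [e|ne]; last first.
    rewrite oppr0 /to_edge; case: pselect => // e; case: ne; exact: edge_sym.
  rewrite (@to_edgeE f w u (mk_edge (edge_sym e))) /= ?ffunE//.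
  rewrite (alt (tperm ord0 ord_max) (mk_edge e)); first by rewrite odd_tperm expr1 scaleN1r.
  move=> -[[|[|i]] hi] //=; rewrite !ffunE /=.
    by rewrite (_ : Ordinal hi = ord0) ?tpermL//; apply/val_inj.
  by rewrite (_ : Ordinal hi = ord_max) ?tpermR//; apply/val_inj.
- move=> g u w; rewrite {2}/to_edge; case: pselect => [e|ne]; last first.
    rewrite linear0 /to_edge; case: pselect => // e; case: ne; exact/(edge_deck g).
  have e' : edge (deck g u) (deck g w) by apply/edge_deck.
  rewrite (@to_edgeE f _ _ (mk_edge e')) /= ?ffunE//.
  by apply: eqv => i /=; rewrite !ffunE; case: eqP.
- by move=> u w; rewrite /to_edge; case: pselect.
Qed.

Lemma cochain_of_edge phi : edge_cochain phi -> cochain pi (of_edge phi).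
Proof.
move=> [alt eqv _]; split; last by move=> g s t st; rewrite /of_edge !st eqv.
move=> p s t st; rewrite /of_edge !st.
have [p0|p0] := eqVneq (p ord0) ord0.
  have p1 : p ord_max = ord_max.
    have : p ord_max != ord0 by rewrite -p0 (inj_eq perm_inj).
    by case: (p ord_max) => [[|[|i]] hi] // _; apply/val_inj.
  have -> : p = 1%g.
    apply/permP => -[[|[|i]] hi] //; rewrite perm1.
      by rewrite (_ : Ordinal hi = ord0) ?p0//; apply/val_inj.
    by rewrite (_ : Ordinal hi = ord_max) ?p1//; apply/val_inj.
  by rewrite odd_perm1 expr0 scale1r !perm1.
have p01 : p ord0 = ord_max.
  by move: p0; case: (p ord0) => [[|[|i]] hi] // _; apply/val_inj.
have p1 : p ord_max = ord0.
  have : p ord_max != ord_max by rewrite -p01 (inj_eq perm_inj).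
  by case: (p ord_max) => [[|[|i]] hi] // _; apply/val_inj.
have -> : p = tperm ord0 ord_max.
  apply/permP => -[[|[|i]] hi] //.
    by rewrite (_ : Ordinal hi = ord0) ?p01 ?tpermL//; apply/val_inj.
  by rewrite (_ : Ordinal hi = ord_max) ?p1 ?tpermR//; apply/val_inj.
by rewrite odd_tperm expr1 scaleN1r tpermL tpermR alt.
Qed.

Lemma to_edge_of_edge phi u w : edge_cochain phi -> to_edge (of_edge phi) u w = phi u w.
Proof.
move=> [_ _ off]; rewrite /to_edge; case: pselect => [e|/off ->] //.
by rewrite /of_edge /= !ffunE.
Qed.

Hypothesis upi : unitary_rep pi.

(** The norm of a coboundary ignores translations, as pi is unitary, and reorderings, which change
    only the sign. *)
Lemma edge_diff_orbit m (r : 'I_m -> ordered_simplex (em_cover X) 2) phi q :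
  orbit_representatives r -> edge_cochain phi -> triangle q ->
  exists j, nrm (edge_diff phi q) = nrm (edge_diff phi (vertices (r j))).
Proof.
move=> hr cphi t; have [j [[g [p hp]] _]] := hr (mk_triangle t); exists j.
rewrite -(vertices_mk t) /vertices !hp edge_diff_deck// unitary_nrm//.
pose a k := val (r j) (inord k).
have aE i : val (r j) i = a i by rewrite /a inord_val.
rewrite /vertices !aE.
have s12 u v w : nrm (edge_diff phi (v, u, w)) = nrm (edge_diff phi (u, v, w)).
  by rewrite edge_diff_swap12 ?nrmN.
have s23 u v w : nrm (edge_diff phi (u, w, v)) = nrm (edge_diff phi (u, v, w)).
  by rewrite edge_diff_swap23 ?nrmN.
have d01 : p ord0 != p ord1_2 by rewrite (inj_eq perm_inj).
have d02 : p ord0 != p ord_max by rewrite (inj_eq perm_inj).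
have d12 : p ord1_2 != p ord_max by rewrite (inj_eq perm_inj).
move: d01 d02 d12; case: (p ord0) (p ord1_2) (p ord_max) =>
  [[|[|[|i]]] hi] [[|[|[|k]]] hk] [[|[|[|l]]] hl] //= _ _ _.
all: by do ?[done | rewrite s12; done | rewrite s23; done | rewrite s23 s12; done
  | rewrite s12 s23; done | rewrite s12 s23 s12; done].
Qed.

Lemma H2_reduced_closed : H2_reduced X pi -> forall (phi : nat -> V -> V -> E) y,
  (forall n, edge_cochain (phi n)) ->
  (forall q, triangle q -> gcvg (fun n => edge_diff (phi n) q) (y q)) ->
  exists2 psi, edge_cochain psi & forall q, triangle q -> edge_diff psi q = y q.
Proof.
move=> [m [r [hr hcl]]] phi y cphi hy.
pose Y : 'rV[E]_m := \row_j y (vertices (r j)).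
have hYn n : [set \row_j coboundary f (r j) | f in @cochain R G X E pi 1]
    (\row_j edge_diff (phi n) (vertices (r j)) : 'rV[E]_m).
  exists (of_edge (phi n)); first exact: cochain_of_edge.
  apply/rowP => j; rewrite !mxE coboundaryE /edge_diff.
  by rewrite !to_edge_of_edge.
have dist : exists D, forall n j,
    nrm (y (vertices (r j)) - edge_diff (phi n) (vertices (r j))) <= D * 2^-1 ^+ n.
  have [D hD] := choice (fun j => hy _ (vertices_triangle (r j))).
  exists (\sum_j `|D j|) => n j; apply: le_trans (hD j n) _.
  rewrite ler_wpM2r ?(ltW (half_exp_gt0 _ _))//; apply: le_trans (ler_norm _) _.
  by rewrite (bigD1 j)//= lerDl; apply: sumr_ge0.
have [D hD] := dist.
have [f cf fY] : [set \row_j coboundary f (r j) | f in @cochain R G X E pi 1] Y.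
  apply: hcl => B /nbhs_ballP[e /= e0 eB].
  have [e1 eE] : exists e1 : R, e = e1%:C by exists (complex.Re e); apply/ge0_Re/ltW.
  have {}e0 : 0 < e1 by rewrite -ltcR -eE; exact: e0.
  rewrite eE in eB.
  have D1 : 0 < `|D| + 1 by have := normr_ge0 D; lra.
  have [n nE] := half_exp_lt (divr_gt0 e0 D1).
  exists (\row_j edge_diff (phi n) (vertices (r j))); split=> //.
  apply: eB; split; first by rewrite ltcR.
  move=> i j; rewrite !mxE -ball_normE /= nrmE ltcR.
  apply: le_lt_trans (hD n j) _; rewrite ltr_pdivlMr// in nE; apply: le_lt_trans nE.
  have h1 : D * 2^-1 ^+ n <= `|D| * 2^-1 ^+ n.
    by rewrite ler_wpM2r ?(ltW (half_exp_gt0 _ _)) ?ler_norm.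
  have := half_exp_gt0 R n; rewrite mulrDr mulr1 [_ * `|D|]mulrC; lra.
have ce := cochain_to_edge cf.
(* Equality is known on representatives only; for another triangle the orbit lemma is applied to the
   difference of f and phi n. *)
exists (to_edge f) => // q t; apply: (gcvg_uniq _ (hy q t)); exists D => n.
have cd : edge_cochain ((-1) *: phi n + to_edge f) by exact: edge_cochain_lin.
have dE q' : edge_diff ((-1) *: phi n + to_edge f) q' =
    edge_diff (to_edge f) q' - edge_diff (phi n) q'.
  by rewrite edge_diff_lin scaleN1r addrC.
rewrite -dE; have [j ->] := edge_diff_orbit hr cd t.
rewrite dE -coboundaryE; have : coboundary f (r j) = y (vertices (r j)).
  by have := congr1 (fun M : 'rV[E]_m => M ord0 j) fY; rewrite /Y !mxE.
by move=> ->; exact: hD.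
Qed.

End edge_cochains.

(** * The constant of the coboundary operator *)

Section d1_constant.
Variables (R : realType) (G : groupType) (X : EM_cover R G).
Local Notation V := (em_vertex X).
Local Notation deck := (@em_deck R G X).

Lemma finite_edges : exists L : seq (V * V), forall u w, edge u w ->
  exists g, exists2 q, q \in L & u = deck g q.1 /\ w = deck g q.2.
Proof.
have [L hL] := finite_triples X; exists [seq (q.1.1, q.1.2) | q <- L] => u w [_ /spans2 h].
have [g [q qL [-> -> _]]] := hL _ _ _ h; exists g, (q.1.1, q.1.2) => //.
exact: map_f.
Qed.

Lemma edge_cochain0 (E : hilbertType R) (pi : representation G E) :
  @edge_cochain R G X E pi (fun _ _ => 0).
Proof. by split=> // *; rewrite ?oppr0 ?linear0. Qed.

Lemma edge_cochain_map (E E' : hilbertType R) (pi : representation G E)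
    (pi' : representation G E') (f : {linear E -> E'}) (phi : V -> V -> E) :
  (forall g v, f (pi g v) = pi' g (f v)) -> edge_cochain pi phi ->
  edge_cochain pi' (fun u w => f (phi u w)).
Proof.
move=> fe [alt eqv off]; split=> [u w|g u w|u w ne].
- by rewrite alt linearN.
- by rewrite eqv fe.
- by rewrite off ?linear0.
Qed.

Lemma edge_diff_map (E E' : hilbertType R) (f : {linear E -> E'}) (phi : V -> V -> E) q :
  edge_diff (fun u w => f (phi u w)) q = f (edge_diff phi q).
Proof. by rewrite /edge_diff linearD linearB. Qed.

(** There are finitely many orbits of edges, and the norm is constant on each. *)
Lemma edge_cochain_bounded (E : hilbertType R) (pi : representation G E) phi :
  unitary_rep pi -> @edge_cochain R G X E pi phi ->
  exists M, forall u w, nrm (phi u w) <= M.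
Proof.
move=> upi [alt eqv off]; have [L hL] := finite_edges.
have S0 (s : seq (V * V)) : 0 <= \sum_(q <- s) nrm (phi q.1 q.2).
  by apply: sumr_ge0 => q _; exact: nrm_ge0.
exists (\sum_(q <- L) nrm (phi q.1 q.2)) => u w.
have [e|/off ->] := pselect (edge u w); last by rewrite nrm0.
have [g [q qL [-> ->]]] := hL _ _ e; rewrite eqv unitary_nrm//.
by rewrite (big_rem q)//= lerDl.
Qed.

(* [K] bounds the inverse of the coboundary operator C^1 / ker -> im. *)
Definition d1_bounded (K : R) (E : hilbertType R) (pi : representation G E) : Prop :=
  forall (phi : V -> V -> E) M, edge_cochain pi phi -> 0 <= M ->
    (forall q, triangle q -> nrm (edge_diff phi q) <= M) ->
    exists psi, [/\ edge_cochain pi psi,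
      forall q, triangle q -> edge_diff psi q = edge_diff phi q &
      forall u w, nrm (psi u w) <= K * M].

Lemma d1_bounded_of_reduced (E : hilbertType R) (pi : representation G E) :
  unitary_rep pi -> H2_reduced X pi -> exists2 K, 0 <= K & d1_bounded K pi.
Proof.
move=> upi hred.
pose J := {q : V * V * V | triangle q}.
have [| | | | | | | | |K K0 hK] := @open_mapping R J E (V -> V -> E) (@edge_cochain R G X E pi)
  (fun phi j => edge_diff phi (sval j)) (fun phi M => forall u w, nrm (phi u w) <= M).
- exact: edge_cochain0.
- exact: edge_cochain_lin.
- by move=> a x y j; exact: edge_diff_lin.
- by move=> u w; rewrite nrm0.
- by move=> x M M' MM h u w; exact: le_trans (h u w) MM.
- move=> a x y M M' hx hy u w; apply: le_trans (nrmD _ _) _.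
  by rewrite lerD// nrmZ ler_wpM2l ?nrm_ge0.
- by move=> x; exact: edge_cochain_bounded.
- move=> x C cx hx.
  have hex uw : exists l, gcvg (fun n => x n uw.1 uw.2) l.
    by apply: (@gcvg_of_cauchy _ _ _ C) => n; exact: hx.
  have [y0 hy0] := choice hex; pose y u w := y0 (u, w).
  have hy u w : gcvg (fun n => x n u w) (y u w) := hy0 (u, w).
  exists y; split.
  + split=> [u w|g u w|u w ne].
    * apply: (gcvg_uniq (hy w u)); have := gcvgN (hy u w); congr gcvg.
      by apply/funext => n; have [alt _ _] := cx n; rewrite (alt u w).
    * apply: (gcvg_uniq (hy _ _)).
      have lip a b : nrm (pi g a - pi g b) <= 1 * nrm (a - b).
        by rewrite mul1r -linearB unitary_nrm.
      have := gcvg_lip lip (hy u w); congr gcvg.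
      by apply/funext => n; have [_ eqv _] := cx n; rewrite eqv.
    * apply: (gcvg_uniq (hy u w)); have := gcvg_cst (0 : E); congr gcvg.
      by apply/funext => n; have [_ _ off] := cx n; rewrite off.
  + move=> j; exact: gcvgD (gcvgD (hy _ _) (gcvgN (hy _ _))) (hy _ _).
  + by move=> M hM u w; apply: gcvg_bound (hy u w) _ => n.
- move=> x y cx hy.
  pose y' q := match pselect (triangle q) with left t => y (exist _ q t) | right _ => 0 end.
  have y'E (j : J) : y' (sval j) = y j.
    rewrite /y'; case: j => q t /=; case: pselect => // t'.
    by rewrite (Prop_irrelevance t' t).
  have [q t|psi cpsi hpsi] := H2_reduced_closed upi hred cx (y := y').
    by have := hy (exist _ q t); rewrite -y'E.
  by exists psi => // j; rewrite hpsi ?y'E//; exact: svalP.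
exists K => // phi M cphi M0 hM.
have [|psi [cpsi dpsi bpsi]] := hK phi M cphi M0.
  by move=> j; apply: hM; exact: svalP.
by exists psi; split=> // q t; exact: (dpsi (exist _ q t)).
Qed.

Lemma d1_bounded_uniform :
  (forall (E : hilbertType R) (pi : representation G E), unitary_rep pi -> H2_reduced X pi) ->
  exists2 K, 0 <= K & forall (E : hilbertType R) (pi : representation G E),
    unitary_rep pi -> d1_bounded K pi.
Proof.
move=> hred; apply: contrapT => nK.
have bad n : exists x : {E : hilbertType R & (representation G E * (V -> V -> E))%type},
    [/\ unitary_rep (projT2 x).1, edge_cochain (projT2 x).1 (projT2 x).2,
        forall q, triangle q -> nrm (edge_diff (projT2 x).2 q) <= 2^-1 ^+ n &
        forall psi, edge_cochain (projT2 x).1 psi ->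
          (forall q, triangle q -> edge_diff psi q = edge_diff (projT2 x).2 q) ->
          exists u w, 1 < nrm (psi u w)].
  apply: contrapT => nx; apply: nK; exists (2 ^+ n); first exact: exprn_ge0.
  move=> E pi upi phi M cphi M0 hM; have [M00|M00] := eqVneq M 0.
    exists (fun _ _ => 0); split; first exact: edge_cochain0.
      move=> q t; rewrite /edge_diff subrr addr0.
      by apply/esym/nrm_eq0/le_anti; rewrite nrm_ge0 -M00 andbT; exact: hM.
    by move=> u w; rewrite nrm0 M00 mulr0.
  have Mp : 0 < M by rewrite lt_def M00.
  have n0 : 0 < (2 : R) ^+ n by rewrite exprn_gt0.
  apply: contrapT => ny; apply: nx.
  pose c : R := (2 ^+ n * M)^-1; have c0 : 0 < c by rewrite invr_gt0 mulr_gt0.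
  have nc : nrm c%:C = c by rewrite nrm_real gtr0_norm.
  have cZ a x : edge_cochain pi x -> edge_cochain pi (a *: x : V -> V -> E).
    by move=> cx; rewrite -[a *: x]addr0; apply: edge_cochain_lin => //; exact: edge_cochain0.
  have dZ a (x : V -> V -> E) q : edge_diff (a *: x) q = a *: edge_diff x q.
    have := edge_diff_lin a x 0 q; rewrite addr0 => ->.
    by rewrite [edge_diff 0 q](_ : _ = 0) ?addr0// /edge_diff subrr addr0.
  exists (existT _ E (pi, c%:C *: phi)); split=> //=.
  - exact: cZ.
  - move=> q t; rewrite dZ nrmZ nc; apply: le_trans (ler_wpM2l (ltW c0) (hM q t)) _.
    by rewrite /c invfM exprVn -mulrA mulVf ?mulr1// gt_eqF.
  move=> psi cpsi hpsi; apply: contrapT => small; apply: ny.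
  exists (c^-1%:C *: psi); split=> [|q t|u w]; first exact: cZ.
    by rewrite dZ hpsi// dZ scalerA -rcM mulVf ?scale1r// gt_eqF.
  have cV : c^-1 = 2 ^+ n * M by rewrite /c invrK.
  have cV0 : 0 < 2 ^+ n * M by rewrite mulr_gt0.
  rewrite -[(_ *: _) u w]/(_ *: psi u w) nrmZ nrm_real cV gtr0_norm// -[leRHS]mulr1 ler_pM2l//.
  by rewrite leNgt; apply/negP => h; apply: small; exists u, w.
have [x hx] := choice bad.
pose E_ n := projT1 (x n); pose pi_ n : representation G (E_ n) := (projT2 (x n)).1.
pose phi_ n : V -> V -> E_ n := (projT2 (x n)).2.
have upi n : unitary_rep (pi_ n) by have [] := hx n.
have cphi n : edge_cochain (pi_ n) (phi_ n) by have [] := hx n.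
have dphi n q : triangle q -> nrm (edge_diff (phi_ n) q) <= 2^-1 ^+ n.
  by have [_ _ + _] := hx n; apply.
have bphi n psi : edge_cochain (pi_ n) psi ->
    (forall q, triangle q -> edge_diff psi q = edge_diff (phi_ n) q) ->
    exists u w, 1 < nrm (psi u w).
  by have [_ _ _] := hx n; apply.
have [H [pi [i [p ds]]]] := direct_sum upi.
have [upi' [ie pe] [ii pp] _ p0] := ds.
(* Only the coboundaries of the phi_ n are small, so these partial sums need not converge. Their
   coboundaries do, and closedness of the image for the sum supplies a primitive [Psi] of the
   limit. *)
pose Phi k u w := \sum_(n < k) i n (phi_ n u w).
have cPhi k : edge_cochain pi (Phi k).
  have ci n := edge_cochain_map (ie n) (cphi n).
  split=> [u w|g u w|u w ne].
  - by rewrite -sumrN; apply: eq_bigr => n _; have [alt _ _] := ci n; exact: alt.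
  - by rewrite linear_sum; apply: eq_bigr => n _; have [_ eqv _] := ci n; exact: eqv.
  - by apply: big1 => n _; have [_ _ off] := ci n; exact: off.
have dPhi k q : edge_diff (Phi k) q = \sum_(n < k) i n (edge_diff (phi_ n) q).
  rewrite /edge_diff /Phi -sumrB -big_split; apply: eq_bigr => n _ /=.
  by rewrite linearD linearB.
have yex q : exists y, triangle q -> gcvg (fun k => edge_diff (Phi k) q) y /\
    forall n, p n y = edge_diff (phi_ n) q.
  have [t|] := pselect (triangle q); last by exists 0.
  have [|y y1 y2] := direct_sum_series (x := fun n => edge_diff (phi_ n) q) (C := 1) ds.
    by move=> n; rewrite mul1r dphi.
  by exists y => _; split=> //; move: y1; congr gcvg; apply/funext => k; rewrite dPhi.
have [y hy] := choice yex.
have [q t|Psi cPsi dPsi] := H2_reduced_closed upi' (hred H pi upi') cPhi (y := y).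
  exact: (hy q t).1.
have [L hL] := finite_edges.
(* A single N serves all edges, because they form finitely many orbits. *)
have [N hN] : exists N, forall q, q \in L -> forall n, (N <= n)%N -> nrm (p n (Psi q.1 q.2)) <= 1.
  elim: L {hL} => [|q L [N hN]]; first by exists 0.
  have [N' hN'] := p0 (Psi q.1 q.2) 1 ltr01.
  exists (maxn N N') => q'; rewrite inE => /predU1P[->|q'L] n; rewrite geq_max => /andP[h1 h2].
    exact: hN'.
  exact: hN.
have cN := edge_cochain_map (pe N) cPsi.
have [|u [w]] := bphi N _ cN.
  by move=> q t; rewrite edge_diff_map dPsi// (hy q t).2.
rewrite ltNge => /negP; apply.
have [_ eqv off] := cPsi.
have [e|ne] := pselect (edge u w); last by rewrite off// linear0 nrm0.
have [g [q qL [-> ->]]] := hL _ _ e; rewrite eqv pe unitary_nrm//.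
exact: hN.
Qed.

End d1_constant.

(** * Perturbation *)

(** The deck action is free with the fibres as orbits, so a section of the projection gives
    coordinates; right translation normalizes them at u0. *)
Lemma deck_coordinate (R : realType) (G : groupType) (X : EM_cover R G) :
  exists (c : em_vertex X -> G) u0,
    c u0 = 1%g /\ forall g u, c (em_deck g u) = (g * c u)%g.
Proof.
have [p [_ [_ _ _]]] := em_contractible X; have [u0 _] := support_neq0 p.
have [surj _ _ _] := em_covering X.
have [sec hsec] := choice surj.
have ex u : exists g, em_deck g (sec (em_proj u)) = u.
  by apply: em_deck_trans; rewrite hsec.
have [c hc] := choice ex.
have cE g u : c (em_deck g u) = (g * c u)%g.
  set s := sec (em_proj u).
  have e : em_deck (c (em_deck g u)) s = em_deck (g * c u)%g s.
    by rewrite em_deckM /s hc -{2}(hc (em_deck g u)) em_deck_proj.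
  have := @em_deck_free _ _ X ((g * c u)^-1 * c (em_deck g u))%g s.
  by rewrite em_deckM e deckK => /(_ erefl) h; rewrite -[LHS](mulVKg (g * c u)%g) h mulg1.
exists (fun u => c u * (c u0)^-1)%g, u0; split; first by rewrite mulgV.
by move=> g u; rewrite cE mulgA.
Qed.

Section perturbation.
Variables (R : realType) (G : groupType) (S : {fset G}) (X : EM_cover R G).
Hypotheses (hS : generates S) (hT : property_T R G).
Local Notation V := (em_vertex X).
Local Notation deck := (@em_deck R G X).
(* [c u] is the deck transformation that takes the chosen vertex of the orbit of
   [u] to [u]. *)
Variables (c : V -> G) (u0 : V).
Hypotheses (c0 : c u0 = 1%g) (cM : forall g u, c (deck g u) = (g * c u)%g).

Definition perturbed (E : hilbertType R) (eps M : R) (pi rho : representation G E)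
    (b : G -> E) : Prop :=
  [/\ unitary_rep pi, 0 <= eps, near_rep S eps pi rho, cocycle rho b &
      0 <= M /\ forall s, s \in S -> nrm (b s) <= M].

(* The homogeneous 1-cochain attached to [b], transported from [rho] to [pi]. *)
Definition transport (E : hilbertType R) (pi : representation G E) (b : G -> E) (u w : V) : E :=
  pi (c u) (b ((c u)^-1 * c w)%g).

Lemma transport_deck E pi b g u w :
  @transport E pi b (deck g u) (deck g w) = pi g (transport pi b u w).
Proof. by rewrite /transport !cM repM invgM -mulgA mulKg. Qed.

Lemma word_bound g : exists C e0, [/\ 0 <= C, 0 < e0 &
  forall (E : hilbertType R) eps M (pi rho : representation G E) b, eps <= e0 ->
    perturbed eps M pi rho b ->
    (forall v, nrm (pi g v - rho g v) <= C * eps * nrm v) /\ nrm (b g) <= C * M].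
Proof.
have [C [e0 [C0 e00 h]]] := @word_control R G S hS g; exists C, e0; split=> //.
move=> E eps M pi rho b ee [upi eps0 near cb [M0 hM]].
have [|h1 h2] := h E pi rho eps upi _ near; first by rewrite eps0.
by split=> //; exact: h2.
Qed.

(** As b satisfies the cocycle identity for rho exactly, the defect is only the cost of exchanging
    pi x for rho x on b y, a product of an O(eps) and an O(M) bound. *)
Lemma transport_defect1 u v w : exists C e0, [/\ 0 <= C, 0 < e0 &
  forall (E : hilbertType R) eps M (pi rho : representation G E) b, eps <= e0 ->
    perturbed eps M pi rho b ->
    nrm (transport pi b u v + transport pi b v w - transport pi b u w) <= C * (eps * M)].
Proof.
set x := ((c u)^-1 * c v)%g; set y := ((c v)^-1 * c w)%g.
have [Cx [ex [Cx0 ex0 hx]]] := word_bound x.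
have [Cy [ey [Cy0 ey0 hy]]] := word_bound y.
exists (Cx * Cy), (Num.min ex ey); split; [exact: mulr_ge0 | by rewrite lt_min ex0 |].
move=> E eps M pi rho b; rewrite le_min => /andP[eex eey] pert.
have [hx1 _] := hx E eps M pi rho b eex pert.
have [_ hy2] := hy E eps M pi rho b eey pert.
have [upi eps0 near cb [M0 hM]] := pert.
have -> : transport pi b u v + transport pi b v w - transport pi b u w =
    pi (c u) (pi x (b y) - rho x (b y)).
  have xy : ((c u)^-1 * c w = x * y)%g by rewrite /x /y mulgA mulgK.
  have cv : (c v = c u * x)%g by rewrite /x mulVKg.
  rewrite /transport xy -/x -/y (cb x y) cv repM -!linearD -linearB; congr (pi _ _).
  by rewrite opprD addrACA subrr add0r.
rewrite unitary_nrm//; apply: le_trans (hx1 _) _.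
have h : Cx * eps * nrm (b y) <= Cx * eps * (Cy * M) by rewrite ler_wpM2l// mulr_ge0.
by apply: le_trans h _; rewrite le_eqVlt; apply/orP; left; apply/eqP; ring.
Qed.

Lemma transport_defect : exists C e0, [/\ 0 <= C, 0 < e0 &
  forall u v w, em_cover X [fset u; v; w]%fset ->
  forall (E : hilbertType R) eps M (pi rho : representation G E) b, eps <= e0 ->
    perturbed eps M pi rho b ->
    nrm (transport pi b u v + transport pi b v w - transport pi b u w) <= C * (eps * M)].
Proof.
have [L hL] := finite_triples X.
have [C [e0 [C0 e00 h]]] : exists C e0, [/\ 0 <= C, 0 < e0 & forall q, q \in L ->
  forall (E : hilbertType R) eps M (pi rho : representation G E) b, eps <= e0 ->
    perturbed eps M pi rho b ->
    nrm (transport pi b q.1.1 q.1.2 + transport pi b q.1.2 q.2 - transport pi b q.1.1 q.2)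
      <= C * (eps * M)].
  elim: L {hL} => [|q L [C [e0 [C0 e00 h]]]]; first by exists 0, 1; split.
  have [C' [e0' [C'0 e0'0 h']]] := transport_defect1 q.1.1 q.1.2 q.2.
  exists (C + C'), (Num.min e0 e0'); split; [exact: addr_ge0|by rewrite lt_min e00|].
  move=> q'; rewrite inE => /predU1P[->|q'L] E eps M pi rho b.
    rewrite le_min => /andP[_ ee] pert; apply: le_trans (h' _ _ _ _ _ _ ee pert) _.
    have [_ eps0 _ _ [M0 _]] := pert.
    by rewrite mulrDl lerDr !mulr_ge0.
  rewrite le_min => /andP[ee _] pert; apply: le_trans (h _ q'L _ _ _ _ _ _ ee pert) _.
  have [_ eps0 _ _ [M0 _]] := pert.
  by rewrite mulrDl lerDl !mulr_ge0.
exists C, e0; split=> // u v w huvw E eps M pi rho b ee pert.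
have [g [q qL [-> -> ->]]] := hL _ _ _ huvw.
have [upi _ _ _ _] := pert.
by rewrite !transport_deck -linearD -linearB unitary_nrm//; exact: (h q qL _ _ _ _ _ _ ee pert).
Qed.

(* [F] plays the role of minus the potential [b \o c] of the transported cochain. *)
Definition near_potential (E : hilbertType R) (C : R) (pi rho : representation G E)
    (b : G -> E) (eps M : R) (F : V -> E) : Prop :=
  forall u w, em_cover X [fset u; w]%fset ->
    nrm (F u - F w - transport pi b u w) <= C * (eps * M).

Let add_errors (E : zmodType) (a a' b b' d d' : E) :
  a - b + d = a - a' - (b - b') + (d - d') + (d' + a' - b').
Proof.
have -> : a - a' - (b - b') = a - b - (a' - b').
  by rewrite !opprD !opprK !addrA (addrAC a (- a')).
rewrite -[d' + a' - b']addrA -(addrA _ (d - d')) (addrA (d - d')) subrK.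
by rewrite [RHS]addrACA addNr addr0.
Qed.

Lemma potential_exists K : 0 <= K -> exists C e0, [/\ 0 <= C, 0 < e0 &
  forall (E : hilbertType R) eps M (pi rho : representation G E) b, eps <= e0 ->
    perturbed eps M pi rho b -> d1_bounded X K pi ->
    exists F : V -> E, near_potential C pi rho b eps M F /\
      forall g u w, F (deck g u) - pi g (F u) = F (deck g w) - pi g (F w)].
Proof.
move=> K0; have [C [e0 [C0 e00 h]]] := transport_defect.
exists (4 * K * C + C), e0; split=> //; first by rewrite addr_ge0// !mulr_ge0.
move=> E eps M pi rho b ee pert hK.
have [upi eps0 near cb [M0 hM]] := pert.
set m := C * (eps * M); have m0 : 0 <= m by rewrite /m !mulr_ge0.
pose t u w := transport pi b u w.
have tt u v w : em_cover X [fset u; v; w]%fset -> nrm (t u v + t v w - t u w) <= m.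
  by move=> s; exact: h s _ _ _ _ _ _ ee pert.
have t0 u : t u u = 0 by rewrite /t /transport mulVg (cocycle1 cb) linear0.
pose half : R[i] := (2^-1 : R)%:C.
have half2 (v : E) : v = half *: (v + v).
  rewrite scalerDr -scalerDl -rcD (_ : 2^-1 + 2^-1 = 1) ?scale1r//; lra.
have nhalf : nrm half = 2^-1 by rewrite nrm_real ger0_norm ?invr_ge0.
(* The transported cochain is alternating only up to an error, so it is antisymmetrized; the defect
   of the degenerate triple (u, w, u) bounds the change. *)
pose phi u w := if pselect (edge u w) is left _ then half *: (t u w - t w u) else 0.
have cphi : edge_cochain pi phi.
  split=> [u w|g u w|u w ne]; rewrite /phi.
  - case: pselect => [e|ne]; case: pselect => [e'|ne'].
    + by rewrite -scalerN opprB.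
    + by case: ne'; exact: edge_sym.
    + by case: ne; exact: edge_sym.
    + by rewrite oppr0.
  - case: pselect => [e|ne]; case: pselect => [e'|ne'].
    + by rewrite /t !transport_deck -linearB linearZ.
    + by case: ne'; exact/(edge_deck g).
    + by case: ne; exact/edge_deck.
    + by rewrite linear0.
  - by case: pselect.
have phit u w : edge u w -> nrm (phi u w - t u w) <= m.
  move=> e; rewrite /phi; case: pselect => // _.
  have -> : half *: (t u w - t w u) - t u w = half *: - (t u w + t w u).
    rewrite {2}[t u w]half2 -scalerBr; congr (_ *: _).
    by rewrite opprD addrA (addrAC (t u w)) subrr sub0r -opprD (addrC (t w u)).
  rewrite nrmZ nhalf nrmN; have := tt u w u.
  rewrite t0 subr0 => /(_ _) h1.
  have s : em_cover X [fset u; w; u]%fset.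
    apply: eq_simplex e.2 _; apply/fsetP => x; rewrite !inE.
    by rewrite orbC orbA orbb.
  by have := h1 s; have := nrm_ge0 (t u w + t w u); lra.
(* Three edges each contribute m, and the defect of t on the triangle contributes another m. *)
have dphi q : triangle q -> nrm (edge_diff phi q) <= 4 * m.
  case: q => [[u v] w] tr; have [/phit e1 /phit e2 /phit e3] := triangle_edges tr.
  have [_ _ _ /tt h1] := tr; rewrite /= in e1 e2 e3 h1.
  have -> : edge_diff phi (u, v, w) = (phi v w - t v w) - (phi u w - t u w) +
      (phi u v - t u v) + (t u v + t v w - t u w).
    exact: add_errors.
  apply: le_trans (nrmD _ _) _.
  have h2 := nrmD (phi v w - t v w - (phi u w - t u w)) (phi u v - t u v).
  have h3 := nrmB (phi v w - t v w) (phi u w - t u w); lra.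
have m40 : 0 <= 4 * m by rewrite mulr_ge0.
have [psi [cpsi dpsi bpsi]] := hK phi (4 * m) cphi m40 dphi.
pose z : V -> V -> E := (-1) *: psi + phi.
have cz : edge_cochain pi z by exact: edge_cochain_lin.
have zE u w : z u w = phi u w - psi u w.
  by rewrite -[z u w]/((-1) *: psi u w + phi u w) scaleN1r addrC.
have dz q : triangle q -> edge_diff z q = 0.
  by move=> tr; rewrite edge_diff_lin scaleN1r dpsi// addNr.
have [altz eqvz offz] := cz.
have z0 u : z u u = 0 by apply: offz => -[].
have zM s u v w : em_cover X s -> u \in s -> v \in s -> w \in s -> z u v + z v w = z u w.
  move=> Xs us vs ws.
  have [->|uv] := eqVneq u v; first by rewrite z0 add0r.
  have [->|vw] := eqVneq v w; first by rewrite z0 addr0.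
  have [->|uw] := eqVneq u w; first by rewrite z0 altz addNr.
  have tr : triangle (u, v, w).
    split=> /=; [exact/eqP | exact/eqP | exact/eqP |].
    apply: (simplex_sub Xs); last by apply/fset0Pn; exists u; rewrite !inE eqxx.
    by apply/fsubsetP => x; rewrite !inE => /orP[/orP[]|] /eqP ->.
  have := dz _ tr; rewrite /edge_diff /= => h1.
  by apply/eqP; rewrite -subr_eq0; apply/eqP; rewrite -h1 -addrA addrC.
have [F hF] := simplicial_cocycle_exact zM (em_contractible X).
exists F; split.
- move=> u w huw; rewrite -hF// zE.
  have [uw|/eqP uw] := eqVneq u w.
    have -> : phi u w = 0 by have [_ _ off] := cphi; apply: off => -[/(_ uw)].
    have -> : psi u w = 0 by have [_ _ off] := cpsi; apply: off => -[/(_ uw)].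
    rewrite uw -/(t w w) t0 subr0 subr0 nrm0 mulr_ge0 ?addr_ge0 ?mulr_ge0//.
  have -> : phi u w - psi u w - transport pi b u w = (phi u w - t u w) - psi u w.
    by rewrite addrAC.
  apply: le_trans (nrmB _ _) _; have := phit u w (conj uw huw); have := bpsi u w.
  have -> : (4 * K * C + C) * (eps * M) = K * (4 * m) + m by rewrite /m; ring.
  lra.
(* F itself is not equivariant, but F (g u) - pi g (F u) is constant along edges, hence constant on
   the connected cover. *)
move=> g; apply: (simplicial_connected
  (Q := fun u w => F (deck g u) - pi g (F u) = F (deck g w) - pi g (F w)) (em_contractible X)) => //.
  by move=> u v w -> ->.
move=> s u w Xs us ws.
have huw : em_cover X [fset u; w]%fset.
  apply: (simplex_sub Xs); last by apply/fset0Pn; exists u; rewrite !inE eqxx.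
  by apply/fsubsetP => x; rewrite !inE => /orP[] /eqP ->.
have hguw : em_cover X [fset deck g u; deck g w]%fset.
  by apply/spans2/spans_deck/spans2.
have := hF _ _ hguw; rewrite eqvz hF// linearB => h1.
apply/eqP; rewrite subr_eq.
have -> : F (deck g u) = pi g (F u) - pi g (F w) + F (deck g w) by rewrite h1 subrK.
by rewrite [X in X == _]addrC [X in X == _]addrA [X in X == _]addrAC.
Qed.

(** The existence of such constants is an equivalence relation in u and w, so it suffices to treat
    vertices of one simplex. There b (c w) - b (c u) is the transported value with pi (c u) replaced
    by rho (c u). *)
Lemma potential_compare C1 : 0 <= C1 -> forall u w, exists C e0, [/\ 0 <= C, 0 < e0 &
  forall (E : hilbertType R) eps M (pi rho : representation G E) b F, eps <= e0 ->
    perturbed eps M pi rho b -> near_potential C1 pi rho b eps M F ->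
    nrm (F u - F w - (b (c w) - b (c u))) <= C * (eps * M)].
Proof.
move=> C10; apply: (simplicial_connected (em_contractible X)).
- move=> u; exists 0, 1; split=> // E eps M pi rho b F _ _ _.
  by rewrite !subrr nrm0 mul0r.
- move=> u v [C [e0 [C0 e00 h]]]; exists C, e0; split=> // E eps M pi rho b F ee pert np.
  have -> : F v - F u - (b (c u) - b (c v)) = - (F u - F v - (b (c v) - b (c u))).
    by rewrite [RHS]opprD opprK !opprB.
  by rewrite nrmN; exact: h ee pert np.
- move=> u v w [C [e0 [C0 e00 h]]] [C' [e0' [C0' e00' h']]].
  exists (C + C'), (Num.min e0 e0'); split; [exact: addr_ge0 | by rewrite lt_min e00 |].
  move=> E eps M pi rho b F; rewrite le_min => /andP[ee ee'] pert np.
  have h1 := h _ _ _ _ _ _ _ ee pert np; have h2 := h' _ _ _ _ _ _ _ ee' pert np.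
  have -> : F u - F w - (b (c w) - b (c u)) =
      F u - F v - (b (c v) - b (c u)) + (F v - F w - (b (c w) - b (c v))).
    by rewrite addrACA -opprD [b (c v) - _ + _]addrC !addrA !subrK.
  by apply: le_trans (nrmD _ _) _; rewrite mulrDl lerD.
move=> s u w Xs us ws.
have huw : em_cover X [fset u; w]%fset.
  apply: (simplex_sub Xs); last by apply/fset0Pn; exists u; rewrite !inE eqxx.
  by apply/fsubsetP => x; rewrite !inE => /orP[] /eqP ->.
set x := ((c u)^-1 * c w)%g.
have [Cx [ex [Cx0 ex0 hx]]] := word_bound x.
have [Cu [eu [Cu0 eu0 hu]]] := word_bound (c u).
exists (C1 + Cu * Cx), (Num.min ex eu).
split; [by rewrite addr_ge0// mulr_ge0 | by rewrite lt_min ex0 |].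
move=> E eps M pi rho b F; rewrite le_min => /andP[eex eeu] pert np.
have [_ hx2] := hx E eps M pi rho b eex pert.
have [hu1 _] := hu E eps M pi rho b eeu pert.
have [upi eps0 near cb [M0 hM]] := pert.
have -> : b (c w) - b (c u) = rho (c u) (b x).
  have -> : (c w = c u * x)%g by rewrite /x mulVKg.
  by rewrite (cb (c u) x) addrC addKr.
have -> : F u - F w - rho (c u) (b x) =
    F u - F w - transport pi b u w + (pi (c u) (b x) - rho (c u) (b x)).
  by rewrite addrA subrK.
apply: le_trans (nrmD _ _) _; rewrite mulrDl; apply: lerD; first exact: np.
apply: le_trans (hu1 _) _.
have h : Cu * eps * nrm (b x) <= Cu * eps * (Cx * M) by rewrite ler_wpM2l// mulr_ge0.
by apply: le_trans h _; rewrite le_eqVlt; apply/orP; left; apply/eqP; ring.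
Qed.

Lemma potential_on_generators C1 : 0 <= C1 -> exists C e0, [/\ 0 <= C, 0 < e0 &
  forall (E : hilbertType R) eps M (pi rho : representation G E) b F, eps <= e0 ->
    perturbed eps M pi rho b -> near_potential C1 pi rho b eps M F ->
    forall s, s \in S -> nrm (F u0 - F (deck s u0) - b s) <= C * (eps * M)].
Proof.
move=> C10; have comp := potential_compare C10.
have [C [e0 [C0 e00 h]]] : exists C e0, [/\ 0 <= C, 0 < e0 &
  forall (E : hilbertType R) eps M (pi rho : representation G E) b F, eps <= e0 ->
    perturbed eps M pi rho b -> near_potential C1 pi rho b eps M F ->
    forall s, s \in enum_fset S -> nrm (F u0 - F (deck s u0) - b s) <= C * (eps * M)].
  elim: (enum_fset S) => [|s L [C [e0 [C0 e00 h]]]]; first by exists 0, 1; split.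
  have [C' [e0' [C'0 e0'0 h']]] := comp u0 (deck s u0).
  exists (C + C'), (Num.min e0 e0'); split; [exact: addr_ge0|by rewrite lt_min e00|].
  move=> E eps M pi rho b F; rewrite le_min => /andP[ee ee'] pert np s'.
  have [_ eps0 _ cb [M0 _]] := pert.
  rewrite inE => /predU1P[->|s'L].
    have := h' _ _ _ _ _ _ _ ee' pert np.
    rewrite cM c0 mulg1 (cocycle1 cb) subr0 => h1; apply: le_trans h1 _.
    by rewrite mulrDl lerDr !mulr_ge0.
  apply: le_trans (h _ _ _ _ _ _ _ ee pert np _ s'L) _.
  by rewrite mulrDl lerDl !mulr_ge0.
by exists C, e0; split.
Qed.

(* One step of the iteration: up to an error of size [O(eps * M)], [b] is the
   [rho]-coboundary of a vector of size [O(M)]. *)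
Lemma approximate_fixed_point K : 0 <= K -> exists C e0, [/\ 0 <= C, 0 < e0 &
  forall (E : hilbertType R) eps M (pi rho : representation G E) b, eps <= e0 ->
    perturbed eps M pi rho b -> d1_bounded X K pi ->
    exists2 y, nrm y <= C * M &
      forall s, s \in S -> nrm (b s - (y - rho s y)) <= C * (eps * M)].
Proof.
move=> K0; have [C1 [e1 [C10 e10 h1]]] := potential_exists K0.
have [C2 [e2 [C20 e20 h2]]] := potential_on_generators C10.
have [C0 C00 h0] := uniform_fixed_point hS hT.
exists (C2 + C0 * (C2 + 1)), (Num.min (Num.min e1 e2) 1); split.
- by rewrite addr_ge0// mulr_ge0// addr_ge0.
- by rewrite !lt_min e10 e20 ltr01.
move=> E eps M pi rho b; rewrite !le_min => /andP[/andP[ee1 ee2] eps1] pert hK.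
have [upi eps0 near cb [M0 hM]] := pert.
have [F [npF DF]] := h1 _ _ _ _ _ _ ee1 pert hK.
have hF := h2 _ _ _ _ _ _ _ ee2 pert npF.
(* [D g] could be computed at any vertex instead of u0, which makes g -> F u0 - F (g u0) an exact
   cocycle for pi. *)
pose D g := F (deck g u0) - pi g (F u0).
pose beta g := F u0 - pi g (F u0) - D g.
have betaE g : beta g = F u0 - F (deck g u0).
  by rewrite /beta /D opprB addrA subrK.
have cbeta : cocycle pi beta.
  move=> g h; rewrite !betaE; have := DF g u0 (deck h u0); rewrite -em_deckM => /eqP.
  rewrite subr_eq => /eqP ->; rewrite linearB (addrAC (F (deck (g * h)%g u0))).
  rewrite -(addrA (F (deck (g * h)%g u0))); move: (pi g _ - _) => d.
  by rewrite opprD addrA subrK.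
have epsM : eps * M <= M by rewrite -[leRHS]mul1r ler_wpM2r.
have bM s : s \in S -> nrm (beta s) <= (C2 + 1) * M.
  move=> sS; have := hF s sS; rewrite -betaE => h3; have := hM s sS.
  have := nrm_distl (beta s) (b s); rewrite ler_norml => /andP[_ h4] h5.
  have h6 : C2 * (eps * M) <= C2 * M by rewrite ler_wpM2l.
  lra.
have C2M : 0 <= (C2 + 1) * M by rewrite mulr_ge0// addr_ge0.
have [y hy ny] := h0 E pi beta _ upi cbeta C2M bM.
have yM : nrm y <= (C0 * (C2 + 1)) * M by rewrite -mulrA.
exists y; first by apply: le_trans yM _; rewrite mulrDl lerDr mulr_ge0.
(* The error has two sources: beta replaces b, and y solves the equation for pi instead of rho. *)
move=> s sS; have -> : b s - (y - rho s y) = - (beta s - b s) - (pi s y - rho s y).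
  rewrite hy (opprB (y - pi s y)) -(addrA (b s)) -opprD; congr (_ - _).
  by rewrite [RHS]addrA subrK.
apply: le_trans (nrmB _ _) _; rewrite nrmN betaE mulrDl; apply: lerD; first exact: hF.
apply: le_trans (near s sS y) _.
have h3 : eps * nrm y <= eps * ((C0 * (C2 + 1)) * M) by rewrite ler_wpM2l.
by apply: le_trans h3 _; rewrite le_eqVlt; apply/orP; left; apply/eqP; ring.
Qed.

Lemma perturbed_fixed_point K : 0 <= K -> exists2 eps, 0 < eps &
  forall (E : hilbertType R) M (pi rho : representation G E) b,
    perturbed eps M pi rho b -> d1_bounded X K pi ->
    exists y, forall g, b g = y - rho g y.
Proof.
move=> K0; have [C [e0 [C0 e00 h]]] := approximate_fixed_point K0.
(* C * eps <= 1/2, so each step of the iteration at least halves the bound on S. *)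
pose eps := Num.min e0 (2 * (C + 1))^-1.
have C1 : 0 < 2 * (C + 1) by rewrite mulr_gt0// ltr_wpDl.
have eps0 : 0 < eps by rewrite lt_min e00 invr_gt0.
have Ceps : C * eps <= 2^-1.
  have h1 : C * eps <= C * (2 * (C + 1))^-1 by rewrite ler_wpM2l// ge_min lexx orbT.
  apply: le_trans h1 _; rewrite ler_pdivrMr//; lra.
exists eps => // E M pi rho b [upi _ near cb [M0 hM]] hK.
have stepex b' M' : exists y, perturbed eps M' pi rho b' -> nrm y <= C * M' /\
    forall s, s \in S -> nrm (b' s - (y - rho s y)) <= 2^-1 * M'.
  have [pert|np] := pselect (perturbed eps M' pi rho b'); last by exists 0.
  have [|y y1 y2] := h _ _ _ _ _ _ _ pert hK; first by rewrite ge_min lexx.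
  exists y => _; split=> // s sS; apply: le_trans (y2 s sS) _.
  have [_ _ _ _ [M'0 _]] := pert.
  by rewrite mulrA ler_wpM2r.
have [st hst] := choice (fun q : (G -> E) * R => stepex q.1 q.2).
pose m n := M * 2^-1 ^+ n.
pose nxt n (b' : G -> E) : G -> E := fun g => b' g - (st (b', m n) - rho g (st (b', m n))).
pose B := fix B n := if n is k.+1 then nxt k (B k) else b.
pose Y n := st (B n, m n).
have pB n : perturbed eps (m n) pi rho (B n).
  elim: n => [|n IH]; first by split=> //; rewrite ?(ltW eps0)// /m expr0 mulr1.
  have [_ _ _ cB [m0 _]] := IH.
  split=> //; first exact: ltW.
  - move=> g k; rewrite /= /nxt cB (coboundary_cocycle rho (st (B n, m n)) g k).
    by rewrite [rho g (_ - (_ - rho k _))]linearB opprD addrACA.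
  - rewrite /m exprS mulrCA -/(m n); split; first by rewrite mulr_ge0// invr_ge0.
    by move=> s sS; have [_ h2] := hst (B n, m n) IH; exact: h2.
have Yn n : nrm (Y n) <= C * M * 2^-1 ^+ n.
  by have [h1 _] := hst (B n, m n) (pB n); rewrite -mulrA.
pose y n := \sum_(k < n) Y k.
have ye n : nrm (y n.+1 - y n) <= C * M * 2^-1 ^+ n.
  by rewrite /y big_ord_recr addrC addKr.
have [l yl] := gcvg_of_cauchy ye.
have BE n g : B n g = b g - (y n - rho g (y n)).
  elim: n => [|n IH]; first by rewrite /y big_ord0 linear0 !subr0.
  have -> : y n.+1 = y n + Y n by rewrite /y big_ord_recr.
  by rewrite /= /nxt -/(Y n) IH -(addrA (b g)) -opprD addrACA -opprD [rho g (y n + Y n)]linearD.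
exists l; apply: (cocycle_gen hS cb (coboundary_cocycle rho l)) => s sS.
have lip u v : nrm (rho s u - rho s v) <= (1 + eps) * nrm (u - v).
  rewrite -linearB; have := near s sS (u - v); rewrite nrmBC.
  have := nrm_distl (rho s (u - v)) (pi s (u - v)).
  rewrite (unitary_nrm upi s) ler_norml => /andP[_ h1] h2; lra.
have lim := gcvgD yl (gcvgN (gcvg_lip lip yl)).
apply: (gcvg_uniq _ lim); exists M => n.
have [_ _ _ _ [_ h1]] := pB n.
by have := h1 s sS; rewrite BE.
Qed.

End perturbation.

(** * Affine actions *)

Lemma rep_nrm_bounded (R : realType) (G : groupType) (E : completeNormedModType R[i])
    (pi : representation G E) g : exists M, forall v, nrm (pi g v) <= M * nrm v.
Proof.
have [M hM] := rep_bounded pi g; exists (complex.Re M) => v.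
have := hM v; rewrite !nrmE lecE => /andP[_ /=].
by case: M {hM} => a b /=; rewrite mulr0 subr0.
Qed.

(** The a priori bound M makes the set in [op_norm] bounded above, so that its supremum dominates
    each element. *)
Lemma nrm_op_norm (R : realType) (E F : normedModType R[i]) (T : E -> F) (M : R) :
  (forall (a : R) v, T (a%:C *: v) = a%:C *: T v) ->
  (forall v, nrm (T v) <= M * nrm v) -> forall v, nrm (T v) <= op_norm T * nrm v.
Proof.
move=> TZ TM v; have [->|v0] := eqVneq v 0.
  by have := TM 0; rewrite nrm0 !mulr0.
have nv : 0 < nrm v by rewrite nrm_gt0.
have sc : nrm (T ((nrm v)^-1%:C *: v)) <= op_norm T.
  apply: ub_le_sup.
    exists `|M| => _ [u /= u1 <-]; apply: le_trans (TM u) _.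
    apply: le_trans (ler_wpM2r (nrm_ge0 u) (ler_norm M)) _.
    move: u1; rewrite nrmE -[1]/(1%:C) lecR => u1.
    by rewrite -[leRHS]mulr1 ler_wpM2l.
  exists ((nrm v)^-1%:C *: v) => //=.
  by rewrite nrmE -[1]/(1%:C) lecR nrmZ nrm_real gtr0_norm ?invr_gt0// mulVf// gt_eqF.
by move: sc; rewrite TZ nrmZ nrm_real gtr0_norm ?invr_gt0// mulrC ler_pdivrMr.
Qed.

Lemma deformation_near (R : realType) (G : groupType) (S : {fset G}) (E : hilbertType R)
    eps (pi rho : representation G E) :
  deformation S eps pi rho -> near_rep S eps pi rho.
Proof.
move=> def s sS v; have [M hM] := rep_nrm_bounded pi s; have [N hN] := rep_nrm_bounded rho s.
apply: le_trans (ler_wpM2r (nrm_ge0 v) (def s sS)).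
apply: (@nrm_op_norm _ _ _ (fun v => pi s v - rho s v) (M + N)) => [a u|u].
  by rewrite [pi s _]linearZ [rho s _]linearZ scalerBr.
by apply: le_trans (nrmB _ _) _; rewrite mulrDl lerD.
Qed.

Lemma affine_cocycle (K : numFieldType) (G : groupType) (E : completeNormedModType K)
    (rho : representation G E) (A : G -> E -> E) : affine_action rho A ->
  exists b, (forall g v, A g v = rho g v + b g) /\
    forall g h, b (g * h)%g = b g + rho g (b h).
Proof.
move=> [_ AM [b hb]]; exists b; split=> // g h.
by have := AM g h 0; rewrite !hb !linear0 !add0r addrC.
Qed.

Lemma affine_fixed_point (R : realType) (G : groupType) (S : {fset G}) (X : EM_cover R G) :
  generates S -> property_T R G -> forall K, 0 <= K -> exists2 eps, 0 < eps &
  forall (E : hilbertType R) (pi rho : representation G E) (A : G -> E -> E),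
    unitary_rep pi -> d1_bounded X K pi -> deformation S eps pi rho ->
    affine_action rho A -> has_fixed_point A.
Proof.
move=> hS hT K K0; have [c [u0 [c0 cM]]] := deck_coordinate X.
have [eps eps0 h] := perturbed_fixed_point hS hT c0 cM K0; exists eps => //.
move=> E pi rho A upi hK def /affine_cocycle[b [Ab cb]].
(* Any bound for b on S will do, because eps was chosen before M. *)
have [|y hy] := h E (\sum_(s <- enum_fset S) nrm (b s)) pi rho b _ hK.
  split=> //; [exact: ltW | exact: deformation_near |].
  split=> [|s sS]; first by apply: sumr_ge0 => s _; exact: nrm_ge0.
  by rewrite (big_rem s)//= lerDl; apply: sumr_ge0 => t _; exact: nrm_ge0.
by exists y => g; rewrite Ab hy addrC subrK.
Qed.

Theorem theorem4 (R : realType) (G : groupType) (hG : finitely_presented G)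
    (S : {fset G}) (hS : generates S) (X : EM_cover R G) (hT : property_T R G) :
  (forall (E : hilbertType R) (pi : representation G E),
     unitary_rep pi -> H2_reduced X pi ->
     exists2 eps : R, 0 < eps &
       forall rho : representation G E, deformation S eps pi rho ->
         forall A : G -> E -> E, affine_action rho A -> has_fixed_point A)
  /\
  ((forall (E : hilbertType R) (pi : representation G E),
      unitary_rep pi -> H2_reduced X pi) ->
   exists2 eps : R, 0 < eps &
     forall (E : hilbertType R) (pi : representation G E), unitary_rep pi ->
       forall rho : representation G E, deformation S eps pi rho ->
         forall A : G -> E -> E, affine_action rho A -> has_fixed_point A).
Proof.
split=> [E pi upi hred|hred].
  have [K K0 hK] := d1_bounded_of_reduced upi hred.
  have [eps eps0 h] := affine_fixed_point X hS hT K0; exists eps => // rho def A.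
  exact: h upi hK def.
have [K K0 hK] := d1_bounded_uniform hred.
have [eps eps0 h] := affine_fixed_point X hS hT K0; exists eps => // E pi upi rho def A.
exact: h upi (hK E pi upi) def.
Qed.
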